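(* Consider either the multi-indexed Laguerre case (L) or the multi-indexed Jacobi case (J). Let $\mathcal D$ be a multi-index, let $\mathcal N\ge 1$ be an integer, put $\widetilde{\mathcal N}=\ell_{\mathcal D}+\mathcal N$, and let $\eta_1,\dots,\eta_{\widetilde{\mathcal N}}\in\mathbb C$ be the zeros of $P_{\mathcal D,\mathcal N}(\eta)$. Write $\dot\eta_l^{2}=4\eta_l$ in case L and $\dot\eta_l^{2}=4(1-\eta_l^2)$ in case J, and let $P'_{\mathcal D,\mathcal N}$ denote the derivative with respect to $\eta$. Then $$\sum_{l=1}^{\widetilde{\mathcal N}}\frac{P_{\mathcal D,n}(\eta_l)P_{\mathcal D,m}(\eta_l)}{\dot\eta_l^{2}\,\bigl(P'_{\mathcal D,\mathcal N}(\eta_l)\bigr)^2}=0\qquad (m\ne n,\ m,n\in\{0,1,\dots,\mathcal N-1\}),$$ $$\sum_{l=1}^{\widetilde{\mathcal N}}\frac{P_{\mathcal D,m}(\eta_l)P_{\mathcal D',\mathcal N}(\eta_l)}{\dot\eta_l^{2}\,\bigl(P'_{\mathcal D,\mathcal N}(\eta_l)\bigr)^2}=0\qquad (m\in\{0,1,\dots,\mathcal N-1\},\ \mathcal D'\in\mathcal{EP}),$$ $$\sum_{l=1}^{\widetilde{\mathcal N}}\frac{P_{\mathcal D',\mathcal N}(\eta_l)P_{\mathcal D'',\mathcal N}(\eta_l)}{\dot\eta_l^{2}\,\bigl(P'_{\mathcal D,\mathcal N}(\eta_l)\bigr)^2}=0\qquad (\mathcal D'\ne\mathcal D'',\ \mathcal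 D',\mathcal D''\in\mathcal{EP}).$$
   Context: **Multi-index and parameters.** $\mathcal D=\mathcal D^{\rm I}\cup\mathcal D^{\rm II}$, $\mathcal D^{\rm I}=\{d_1^{\rm I}<\dots<d_M^{\rm I}\}$, $\mathcal D^{\rm II}=\{d_1^{\rm II}<\dots<d_N^{\rm II}\}$, positive integers, $M,N\ge0$, $M+N\ge1$ (the labels I and II are part of the data, so the union is a disjoint one). Real parameters: $g$ in case L, with $g>\max\{N+\frac32,\,d_j^{\rm II}+\frac12\}$; $(g,h)$ in case J, with $g>\max\{N+2,\,d_j^{\rm II}+\frac12\}$, $h>\max\{M+2,\,d_j^{\rm I}+\frac12\}$ (max over all $j$). **Polynomials.** $L^{(\alpha)}_n$, $P^{(\alpha,\beta)}_n$ are the Laguerre and Jacobi polynomials; $P_n=L_n^{(g-1/2)}$ (L), $P_n=P_n^{(g-1/2,h-1/2)}$ (J). For an integer ${\rm v}\ge 0$ put - L: $\mu^{\rm I}_{\rm v}(\eta)=e^{\eta}L^{(g-1/2)}_{\rm v}(-\eta)$, $\ \mu^{\rm II}_{\rm v}(\eta)=\eta^{1/2-g}L^{(1/2-g)}_{\rm v}(\eta)$; - J: $\mu^{\rm I}_{\rm v}(\eta)=\bigl(\frac{1+\eta}2\bigr)^{1/2-h}P^{(g-1/2,1/2-h)}_{\rm v}(\eta)$, $\ \mu^{\rm II}_{\rm v}(\eta)=\bigl(\frac{1-\eta}2\bigr)^{1/2-g}P^{(1/2-g,h-1/2)}_{\rm v}(\eta)$. ${\rm W}[f_1,\dots,f_r](\eta)=\det(d^{i-1}f_j/d\eta^{i-1})_{1\le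 i,j\le r}$ is the Wronskian (equal to $1$ for $r=0$). For an index pair $\mathcal A=(a_1,\dots,a_p;b_1,\dots,b_q)$ (distinct non-negative integers $a_i$ of type I, distinct non-negative integers $b_i$ of type II) the multi-indexed polynomial is $$P_{\mathcal A,n}(\eta)={\rm W}[\mu^{\rm I}_{a_1},\dots,\mu^{\rm I}_{a_p},\mu^{\rm II}_{b_1},\dots,\mu^{\rm II}_{b_q},P_n](\eta)\times\begin{cases}\eta^{(p+g+\frac12)q}e^{-p\eta}&\text{L}\\ \bigl(\frac{1-\eta}2\bigr)^{(p+g+\frac12)q}\bigl(\frac{1+\eta}2\bigr)^{(q+h+\frac12)p}&\text{J}\end{cases}$$ (a polynomial in $\eta$; the formula is read on $0<\eta<\infty$ for L, $-1<\eta<1$ for J). $\mathcal D$ is identified with $(d^{\rm I}_1,\dots,d^{\rm I}_M;d^{\rm II}_1,\dots,d^{\rm II}_N)$. Put $$\ell_{\mathcal D}=\sum_{j=1}^M d_j^{\rm I}-\tfrac12M(M-1)+\sum_{j=1}^N d_j^{\rm II}-\tfrac12N(N-1)+MN .$$ **The set $\mathcal{EP}$.** It consists of the following $\ell_{\mathcal D}$ index pairs $\mathcal D'$: - type I: $\mathcal D$ with one entry $d_j^{\rm I}$ replaced (in the same position) by some integer $\epsilon$ with $0\le\epsilon<d_j^{\rm I}$, $\epsilon\notin\mathcal D^{\rm I}$; - type II: $\mathcal D$ with one entry $d_j^{\rm II}$ replaced (in the same position) by some integer $\epsilon$ with $0\le\epsilon<d_j^{\rm II}$, $\epsilon\notin\mathcal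 D^{\rm II}$; - type III: $\mathcal D$ with one entry $d_j^{\rm I}$ and one entry $d_k^{\rm II}$ both removed. **Standing assumption.** $\mathcal N$, $\mathcal D$ and the parameters are such that $P_{\mathcal D,\mathcal N}$ has degree exactly $\widetilde{\mathcal N}$, its $\widetilde{\mathcal N}$ zeros are pairwise distinct, and none of them equals $0$ (L) or $\pm1$ (J). *)

(* Defs.v *)
From mathcomp Require Import all_boot all_order all_algebra.
From mathcomp Require Import all_classical all_reals all_analysis.
From mathcomp Require Export complex.

Set Implicit Arguments.
Unset Strict Implicit.
Unset Printing Implicit Defensive.

Import Order.TTheory GRing.Theory Num.Theory.
Import numFieldNormedType.Exports.

Local Open Scope classical_set_scope.
Local Open Scope ring_scope.

(* Type I entries, then type II entries. *)
Definition index_pair : Type := (seq nat * seq nat)%type.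

Inductive params (R : Type) : Type :=
| Laguerre of R          (* g *)
| Jacobi of R & R.       (* g, h *)

Definition multi_index (D : index_pair) : bool :=
  [&& sorted ltn D.1, sorted ltn D.2,
      all (ltn 0) D.1, all (ltn 0) D.2 & (0 < size D.1 + size D.2)%N].

(* On a multi-index both truncated subtractions are exact, since k distinct
   positive integers sum to at least k(k+1)/2. *)
Definition ell (D : index_pair) : nat :=
  ((sumn D.1 - (size D.1 * (size D.1).-1)./2) +
   (sumn D.2 - (size D.2 * (size D.2).-1)./2) + size D.1 * size D.2)%N.

Inductive EP (D : index_pair) : index_pair -> Prop :=
| EP_typeI (j e : nat) of (j < size D.1)%N & (e < nth 0%N D.1 j)%N
    & e \notin D.1 : EP D (set_nth 0%N D.1 j e, D.2)
| EP_typeII (j e : nat) of (j < size D.2)%N & (e < nth 0%N D.2 j)%N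
    & e \notin D.2 : EP D (D.1, set_nth 0%N D.2 j e)
| EP_typeIII (d d' : nat) of d \in D.1 & d' \in D.2 :
    EP D (rem d D.1, rem d' D.2).

Section Polynomials.
Variable R : realType.
Implicit Types (c : params R) (A D : index_pair) (f : R -> R).

Definition admissible c D : Prop :=
  match c with
  | Laguerre g =>
      (size D.2)%:R + 3 / 2 < g /\ {in D.2, forall d, d%:R + 1 / 2 < g}
  | Jacobi g h =>
      [/\ (size D.2)%:R + 2 < g, {in D.2, forall d, d%:R + 1 / 2 < g},
          (size D.1)%:R + 2 < h & {in D.1, forall d, d%:R + 1 / 2 < h}]
  end.

Definition pochhammer (a : R) (n : nat) : R := \prod_(i < n) (a + i%:R).

(* binom(n+a, n-k) = (a+k+1)_(n-k) / (n-k)!  *)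
Definition laguerre (a : R) (n : nat) : {poly R} :=
  \poly_(k < n.+1)
    ((-1) ^+ k * pochhammer (a + k.+1%:R) (n - k) / ((n - k)`!%:R * k`!%:R)).

(* (a+1)_n/n! 2F1(-n, n+a+b+1; a+1; (1-x)/2), with (a+1)_n/(a+1)_k written as
   (a+k+1)_(n-k) so that the formula is valid for all real a and b. *)
Definition jacobi (a b : R) (n : nat) : {poly R} :=
  \sum_(k < n.+1)
    (pochhammer (a + k.+1%:R) (n - k) * pochhammer (n%:R + a + b + 1) k
       / ((n - k)`!%:R * k`!%:R)) *: ((1 / 2) *: ('X - 1)) ^+ k.

Definition base_poly c (n : nat) : {poly R} :=
  match c with
  | Laguerre g => laguerre (g - 1 / 2) n
  | Jacobi g h => jacobi (g - 1 / 2) (h - 1 / 2) n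
  end.

Definition muI c (v : nat) (x : R) : R :=
  match c with
  | Laguerre g => expR x * (laguerre (g - 1 / 2) v).[- x]
  | Jacobi g h =>
      ((1 + x) / 2) `^ (1 / 2 - h) * (jacobi (g - 1 / 2) (1 / 2 - h) v).[x]
  end.

Definition muII c (v : nat) (x : R) : R :=
  match c with
  | Laguerre g => x `^ (1 / 2 - g) * (laguerre (1 / 2 - g) v).[x]
  | Jacobi g h =>
      ((1 - x) / 2) `^ (1 / 2 - g) * (jacobi (1 / 2 - g) (h - 1 / 2) v).[x]
  end.

Definition wronskian (fs : seq (R -> R)) (x : R) : R :=
  \det (\matrix_(i < size fs, j < size fs) derive1n i (nth (fun=> 0) fs j) x).

Definition prefactor c A (x : R) : R :=
  let p := (size A.1)%:R in let q := (size A.2)%:R in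
  match c with
  | Laguerre g => x `^ ((p + g + 1 / 2) * q) * expR (- (p * x))
  | Jacobi g h => ((1 - x) / 2) `^ ((p + g + 1 / 2) * q) *
                  ((1 + x) / 2) `^ ((q + h + 1 / 2) * p)
  end.

Definition domain c : set R :=
  match c with
  | Laguerre _ => [set x | 0 < x]
  | Jacobi _ _ => [set x | -1 < x < 1]
  end.

Definition mi_fun c A (n : nat) (x : R) : R :=
  wronskian ([seq muI c a | a <- A.1] ++ [seq muII c b | b <- A.2] ++
             [:: fun y => (base_poly c n).[y]]) x * prefactor c A x.

(* The polynomial that agrees with mi_fun on the domain; it is unique because
   the domain is infinite. *)
Definition mi_poly c A (n : nat) : {poly R} :=
  xget 0 [set P : {poly R} | forall x, domain c x -> P.[x] = mi_fun c A n x].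

Definition mi_polyC c A (n : nat) : {poly R[i]} :=
  map_poly (real_complex R) (mi_poly c A n).

Definition singular c (z : R[i]) : bool :=
  match c with
  | Laguerre _ => z == 0
  | Jacobi _ _ => (z == 1) || (z == -1)
  end.

(* The square of dot-eta as a function of eta. *)
Definition etadot2 c (z : R[i]) : R[i] :=
  match c with
  | Laguerre _ => 4 * z
  | Jacobi _ _ => 4 * (1 - z ^+ 2)
  end.

End Polynomials.

(* Main.v *)
Require Import Defs.
From HB Require Import structures.
From mathcomp Require Import all_boot all_order all_fingroup all_algebra.
From mathcomp Require Import all_classical all_reals all_analysis.
From mathcomp Require Import zify ring lra.

Set Implicit Arguments.
Unset Strict Implicit.
Unset Printing Implicit Defensive.

Import Order.TTheory GRing.Theory Num.Theory.
Local Open Scope ring_scope.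

(** In the variable [y = eta] (L) or [y = (1 - eta)/2] (J) both families are
    cases of one hypergeometric family attached to [y (1 - kap y)], with
    [kap = 0] or [kap = 1], and the multi-indexed polynomials are, up to trivial
    factors, determinants tau of the seed functions.  The Jacobi and Plücker
    identities give bilinear (Hirota type) equations between tau functions that
    differ in one or two columns.  At a zero of [P = P_{D,N}] they turn into an
    equation for [Q''/P' - Q' P''/P'^2], where [Q] is [P_{D,n}] or [P_{D',N}]:
    the residues of [Q/P] form an eigenvector of a matrix that depends on [P]
    only and is symmetric for the weights [1/etadot^2].  Its eigenvalue is the
    sum of the energies of the two entries exchanged or deleted, and
    eigenvectors with distinct eigenvalues are orthogonal.  Eigenvalues of
    different partners may coincide; they are separated by deforming [kap] to
    [kap + eps] over the dual numbers, where their difference becomes a nonzero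
    multiple of [eps]. *)

(** * Determinants with shifted rows *)

(** At a zero of [P], a bilinear equation between [P] and a neighbouring tau function fixes the
    first two derivatives of the neighbour up to its value. The numerator [Q] enters because its
    Wronskian with [P] is a constant times the product of two such neighbours; differentiating this
    product twice closes the equation for [Q].

    An eigenvalue has the form b Y - kap X, with Y linear and X quadratic in the two entries. For a
    fixed kap it can agree for different partners; in case L, where kap = 0, it sees Y alone.
    Together X and Y amount to the sum and the sum of squares of two integers, hence determine the
    pair. First order in eps is enough: eps times a nonzero constant annihilates only elements that
    reduce to 0, so no limit is taken. The price is that the algebra must hold over a ring with
    nilpotents: the hypergeometric coefficients are free of denominators, and the zeros must have
    invertible differences. The deformed tau functions are not Wronskians of given functions, so
    their trivial factors and degrees are read off from the determinant, for all parameters. *)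

Section ColumnDeterminants.
Variable A : comNzRingType.
Implicit Types (s : seq (nat -> A)) (a b w : nat -> A) (f : nat -> nat).

Definition cdet n s : A := \det (\matrix_(i < n, j < n) nth (fun=> 0) s j i).

Definition reindex f s := [seq (fun i => w (f i)) | w <- s].

Lemma nth_reindex f s j i :
  nth (fun=> 0) (reindex f s) j i = nth (fun=> 0) s j (f i).
Proof.
have [js|js] := ltnP j (size s); first by rewrite (nth_map (fun=> 0)).
by rewrite !nth_default // size_map.
Qed.

Lemma cdet_ext n s s' :
  (forall i j, (i < n)%N -> (j < n)%N ->
     nth (fun=> 0) s j i = nth (fun=> 0) s' j i) -> cdet n s = cdet n s'.
Proof. by move=> e; congr (\det _); apply/matrixP => i j; rewrite !mxE e. Qed.

Lemma cdet_reindex n f g s :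
  (forall i, (i < n)%N -> f i = g i) ->
  cdet n (reindex f s) = cdet n (reindex g s).
Proof. by move=> e; apply: cdet_ext => i j ? ?; rewrite !nth_reindex e. Qed.

Lemma cdet_reindex_id n f s :
  (forall i, (i < n)%N -> f i = i) -> cdet n (reindex f s) = cdet n s.
Proof. by move=> e; apply: cdet_ext => i j ? ?; rewrite nth_reindex e. Qed.

Lemma reindex_comp f g s : reindex f (reindex g s) = reindex (g \o f) s.
Proof. by rewrite /reindex -map_comp. Qed.

Lemma cdet_dup_row n f s i1 i2 : (i1 < n)%N -> (i2 < n)%N -> i1 != i2 ->
  f i1 = f i2 -> cdet n (reindex f s) = 0.
Proof.
move=> l1 l2 ne e; rewrite /cdet.
apply: (@determinant_alternate _ _ _ (Ordinal l1) (Ordinal l2)) => // j.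
by rewrite !mxE !nth_reindex /= e.
Qed.

Lemma cdet_dup_col n s j1 j2 : (j1 < n)%N -> (j2 < n)%N -> j1 != j2 ->
  (forall i, nth (fun=> 0) s j1 i = nth (fun=> 0) s j2 i) -> cdet n s = 0.
Proof.
move=> l1 l2 ne e; rewrite /cdet -det_tr.
apply: (@determinant_alternate _ _ _ (Ordinal l1) (Ordinal l2)) => // i.
by rewrite !mxE /= e.
Qed.

Lemma cdet_swap_row n f g s i1 i2 : (i1 < n)%N -> (i2 < n)%N -> i1 != i2 ->
  f i1 = g i2 -> f i2 = g i1 ->
  (forall i, (i < n)%N -> i != i1 -> i != i2 -> f i = g i) ->
  cdet n (reindex f s) = - cdet n (reindex g s).
Proof.
move=> l1 l2 ne e1 e2 e.
pose o1 := Ordinal l1; pose o2 := Ordinal l2.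
have -> : cdet n (reindex f s) =
  \det (xrow o1 o2 (\matrix_(i < n, j < n) nth (fun=> 0) (reindex g s) j i)).
  congr (\det _); apply/matrixP => i j; rewrite !mxE !nth_reindex.
  case: tpermP => [->|->|] //=; first by rewrite e1.
    by rewrite e2.
  by move=> n1 n2; rewrite e //; apply/eqP => h; [apply: n1|apply: n2]; apply: val_inj.
by rewrite /xrow row_permE det_mulmx det_perm odd_tperm ne expr1 mulN1r.
Qed.

Lemma cdet_last_col n s w : size s = n ->
  cdet n.+1 (s ++ [:: w]) =
  \sum_(r < n.+1) w r * ((-1) ^+ (r + n) * cdet n (reindex (bump r) s)).
Proof.
move=> ss; rewrite /cdet (expand_det_col _ ord_max); apply: eq_bigr => r _.
rewrite !mxE nth_cat ss ltnn subnn /=; congr (_ * (_ * \det _)).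
apply/matrixP => i j; rewrite !mxE nth_reindex /= nth_cat ss.
have -> : bump n j = j by rewrite /bump leqNgt ltn_ord.
by rewrite ltn_ord.
Qed.

(* Replacing the last row by the row r expresses the determinant through
   cofactors that do not depend on r. *)
Lemma cdet_last_row n s : exists C : nat -> A,
  C n = cdet n s /\
  forall r, cdet n.+1 (reindex (fun i => if (i < n)%N then i else r) s) =
            \sum_(j < n.+1) C j * nth (fun=> 0) s j r.
Proof.
pose C j := (-1) ^+ (n + j) *
  \det (\matrix_(i < n, k < n) nth (fun=> 0) s (bump j k) i).
exists C; split.
  rewrite /C addnn -signr_odd odd_double expr0 mul1r; congr (\det _).
  apply/matrixP => i j; rewrite !mxE /bump leqNgt.
  by have -> : (j < n)%N := ltn_ord j.
move=> r; rewrite /cdet (expand_det_row _ ord_max); apply: eq_bigr => j _.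
rewrite !mxE nth_reindex ltnn mulrC; congr (_ * \det _ * _).
apply/matrixP => i k; rewrite !mxE nth_reindex /=.
have jn : (i < n)%N := ltn_ord i.
by rewrite /bump (leqNgt n) jn add0n jn.
Qed.

Lemma cdet_last_lin n s t (C : nat -> A) m : size s = n ->
  cdet n.+1 (s ++ [:: (fun r => \sum_(j < m) C j * nth (fun=> 0) t j r)]) =
  \sum_(j < m) C j * cdet n.+1 (s ++ [:: nth (fun=> 0) t j]).
Proof.
move=> ss; rewrite cdet_last_col //.
transitivity (\sum_(r < n.+1) \sum_(j < m) C j * (nth (fun=> 0) t j r *
   ((-1) ^+ (r + n) * cdet n (reindex (bump r) s)))).
  by apply: eq_bigr => r _; rewrite mulr_suml; apply: eq_bigr => j _; rewrite mulrA.
rewrite exchange_big /=; apply: eq_bigr => j _.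
by rewrite cdet_last_col // mulr_sumr.
Qed.

(** Combine the columns of [s ++ [:: b]] with the cofactors of [cdet_last_row] and append the result
    to [s ++ [:: a]]. By linearity only the term of [b] survives, the others repeating a column of
    [s]. In the expansion along the last column only the rows [n] and [n.+1] survive, since the
    earlier entries are determinants with a repeated row. *)
Lemma cdet_jacobi n s a b : size s = n ->
  cdet n s * cdet n.+2 (s ++ [:: a; b]) =
  cdet n.+1 (s ++ [:: a]) * cdet n.+1 (reindex (bump n) (s ++ [:: b])) -
  cdet n.+1 (reindex (bump n) (s ++ [:: a])) * cdet n.+1 (s ++ [:: b]).
Proof.
move=> ss; have [C [Cn Cr]] := cdet_last_row n (s ++ [:: b]).
have sa : size (s ++ [:: a]) = n.+1 by rewrite size_cat ss addn1.
have sb : size (s ++ [:: b]) = n.+1 by rewrite size_cat ss addn1.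
have Cn' : C n = cdet n s.
  by rewrite Cn; apply: cdet_ext => i j _ jn; rewrite nth_cat ss jn.
have nb : nth (fun=> 0) (s ++ [:: b]) n = b by rewrite nth_cat ss ltnn subnn.
have := cdet_last_lin (s ++ [:: b]) C n.+1 sa.
rewrite big_ord_recr /= nb Cn' big1 ?add0r; last first.
  move=> j _; rewrite (_ : cdet _ _ = 0) ?mulr0 //.
  have jn := ltn_ord j.
  apply: (@cdet_dup_col _ _ j n.+1); rewrite ?ltnS //; try lia.
  by move=> i; rewrite -catA !nth_cat ss jn ltnNge leqnSn /= subSnn.
rewrite -[X in _ = _ * cdet _ X]catA /= => <-; rewrite cdet_last_col //.
rewrite big_ord_recr big_ord_recr /= big1 ?add0r => [|i _]; last first.
  rewrite -Cr (@cdet_dup_row _ _ _ i n) ?mul0r //; rewrite ?ltnS ?ltnn ?ltn_ord //.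
    exact: ltnW (ltn_ord i).
  by rewrite neq_ltn ltn_ord.
rewrite -!Cr.
rewrite (cdet_reindex_id (f := fun i => if (i < n)%N then i else n)); last first.
  by move=> i h; case: ltnP => h'; lia.
rewrite (cdet_reindex_id (f := bump n.+1)); last first.
  by move=> i h; rewrite /bump leqNgt h.
rewrite (cdet_reindex (f := fun i => if (i < n)%N then i else n.+1) (g := bump n)); last first.
  by move=> i h; rewrite /bump; case: ltnP => h'; lia.
rewrite !exprD !exprS.
have e1 : (-1) ^+ n * (-1) ^+ n = 1 :> A by rewrite -expr2 sqrr_sign.
ring: e1.
Qed.

(** The device of [cdet_jacobi] with a combination of columns of [s] alone: appended to [s ++
    [:: b]] it gives 0, while the expansion leaves the rows [n], [n.+1] and [n.+2]. *)
Lemma cdet_plucker n s b : size s = n.+1 ->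
  cdet n.+2 (reindex (bump n) (s ++ [:: b])) * cdet n.+1 s
  - cdet n.+2 (reindex (bump n.+1) (s ++ [:: b])) * cdet n.+1 (reindex (bump n) s)
  + cdet n.+2 (s ++ [:: b]) *
    cdet n.+1 (reindex (fun i => if (i < n)%N then i else n.+2) s) = 0.
Proof.
move=> ss; have [C [_ Cr]] := cdet_last_row n s.
have sb : size (s ++ [:: b]) = n.+2 by rewrite size_cat ss addn1.
have := cdet_last_lin s C n.+1 sb.
rewrite [X in _ = X]big1; last first.
  move=> j _; rewrite (_ : cdet _ _ = 0) ?mulr0 //.
  have jn := ltn_ord j.
  apply: (@cdet_dup_col _ _ j n.+2); rewrite ?ltnS //; try lia.
  move=> i; rewrite -catA !nth_cat ss jn.
  by rewrite ltnNge leqnSn /= subSnn.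
rewrite (cdet_last_col _ sb).
rewrite big_ord_recr big_ord_recr big_ord_recr /= big1 ?add0r => [|i _]; last first.
  rewrite -Cr (@cdet_dup_row _ _ _ i n) ?mul0r //; rewrite ?ltnS ?ltnn ?ltn_ord //.
    exact: ltnW (ltn_ord i).
  by rewrite neq_ltn ltn_ord.
rewrite -!(Cr).
rewrite (cdet_reindex_id (f := fun i => if (i < n)%N then i else n)); last first.
  by move=> i h; case: ltnP => h'; lia.
rewrite (cdet_reindex_id (f := bump n.+2)); last first.
  by move=> i h; rewrite /bump leqNgt h.
rewrite (cdet_reindex (f := fun i => if (i < n)%N then i else n.+1) (g := bump n)); last first.
  by move=> i h; rewrite /bump; case: ltnP => h'; lia.
rewrite !exprD !exprS.
have e1 : (-1) ^+ n * (-1) ^+ n = 1 :> A by rewrite -expr2 sqrr_sign.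
by move=> h; rewrite -[RHS]h; ring: e1.
Qed.

(** First variation of the determinant of [V] in the direction [N]; the first argument of [V] and
    [N] is the column. *)
Definition rowsum n (V N : nat -> nat -> A) : A :=
  \sum_(i < n) \det (\matrix_(r < n, j < n) if r == i then N j r else V j r).

Lemma rowsumE n V N : rowsum n V N =
  \sum_(s : 'S_n) (-1) ^+ s *
     \sum_(i < n) N (s i) i * \prod_(r < n | r != i) V (s r) r.
Proof.
rewrite /rowsum /determinant exchange_big /=; apply: eq_bigr => s _.
rewrite mulr_sumr; apply: eq_bigr => i _; congr (_ * _).
rewrite (bigD1 i) //= mxE eqxx; congr (_ * _).
by apply: eq_bigr => r /negbTE ri; rewrite mxE ri.
Qed.

(** In the expansion over permutations the variation by rows is also the variation by columns, so a
    factor attached to a column comes out just as one attached to a row does. Energies and gauge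
    weights belong to columns, orders of differentiation to rows. *)
Lemma rowsum_scale n V (E : nat -> A) :
  rowsum n V (fun j i => E j * V j i) =
  (\sum_(j < n) E j) * \det (\matrix_(i < n, j < n) V j i).
Proof.
rewrite rowsumE /determinant mulr_sumr; apply: eq_bigr => s _.
rewrite mulrCA; congr (_ * _).
rewrite [X in _ = X * _](reindex_inj (@perm_inj _ s)) /= mulr_suml.
apply: eq_bigr => i _.
rewrite [in RHS](bigD1 i) //= mxE -mulrA; congr (_ * (_ * _)).
by apply: eq_bigr => r _; rewrite mxE.
Qed.

Lemma rowsum_diag n V (e : nat -> A) :
  rowsum n V (fun j i => e i * V j i) =
  (\sum_(j < n) e j) * \det (\matrix_(i < n, j < n) V j i).
Proof.
rewrite rowsumE /determinant mulr_sumr; apply: eq_bigr => s _.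
rewrite mulrCA; congr (_ * _).
rewrite mulr_suml; apply: eq_bigr => i _.
rewrite [in RHS](bigD1 i) //= mxE -mulrA; congr (_ * (_ * _)).
by apply: eq_bigr => r _; rewrite mxE.
Qed.

Lemma rowsumD n V N N' :
  rowsum n V (fun j i => N j i + N' j i) = rowsum n V N + rowsum n V N'.
Proof.
rewrite !rowsumE -big_split /=; apply: eq_bigr => s _.
rewrite -mulrDr -big_split /=; congr (_ * _).
by apply: eq_bigr => i _; rewrite mulrDl.
Qed.

Lemma rowsum_ext n V N V' N' :
  (forall j i, (j < n)%N -> (i < n)%N -> V j i = V' j i) ->
  (forall j i, (j < n)%N -> (i < n)%N -> N j i = N' j i) ->
  rowsum n V N = rowsum n V' N'.
Proof.
move=> e1 e2; apply: eq_bigr => i _; congr (\det _).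
by apply/matrixP => r j; rewrite !mxE e1 // e2.
Qed.

Lemma det_derivation (D : A -> A) n (V : nat -> nat -> A) :
  {morph D : x y / x + y} -> (forall x y, D (x * y) = D x * y + x * D y) ->
  D (\det (\matrix_(i < n, j < n) V j i)) = rowsum n V (fun j i => D (V j i)).
Proof.
move=> Dadd Dmul.
have D0 : D 0 = 0 by apply: (addIr (D 0)); rewrite -Dadd !add0r.
have D1 : D 1 = 0.
  by apply: (addIr (D 1)); rewrite add0r -{3}[1]mulr1 Dmul mulr1 mul1r.
have DN x : D (- x) = - D x.
  by apply: (addIr (D x)); rewrite -Dadd !addNr.
have Dsum (I : Type) (r : seq I) (F : I -> A) :
    D (\sum_(i <- r) F i) = \sum_(i <- r) D (F i).
  by elim/big_rec2: _ => // i y1 y2 _ <-; rewrite Dadd.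
have Dprod (F : 'I_n -> A) (r : seq 'I_n) : uniq r ->
    D (\prod_(i <- r) F i) =
    \sum_(i <- r) D (F i) * \prod_(k <- r | k != i) F k.
  elim: r => [|x r IH] /=; first by rewrite !big_nil.
  case/andP=> xr ur; rewrite !big_cons Dmul IH // eqxx /=; congr (_ * _ + _).
    rewrite big_seq [RHS]big_seq_cond; apply: eq_bigl => k.
    by case: (boolP (k \in r)) => // kr; case: eqP kr xr => // -> ->.
  rewrite mulr_sumr big_seq [RHS]big_seq; apply: eq_bigr => i ir.
  rewrite big_cons ifT; first by rewrite mulrCA.
  by apply: contraNneq xr => ->.
have Dsign (e : bool) x : D ((-1) ^+ e * x) = (-1) ^+ e * D x.
  by case: e; rewrite ?expr1 ?expr0 ?mulN1r ?mul1r ?DN.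
rewrite /determinant Dsum rowsumE; apply: eq_bigr => s _.
rewrite Dsign Dprod ?index_enum_uniq //; congr (_ * _).
apply: eq_bigr => i _; rewrite mxE; congr (_ * _).
by apply: eq_bigr => r _; rewrite mxE.
Qed.

Lemma det_row_scale n (V N : nat -> nat -> A) (e : A) (k : 'I_n) :
  \det (\matrix_(r < n, j < n) if r == k then e * N j r else V j r) =
  e * \det (\matrix_(r < n, j < n) if r == k then N j r else V j r).
Proof.
rewrite /determinant mulr_sumr; apply: eq_bigr => s _.
rewrite mulrCA; congr (_ * _); rewrite !(bigD1 (P := predT) k) //= !mxE eqxx mulrA.
by congr (_ * _); apply: eq_bigr => r /negbTE rk; rewrite !mxE rk.
Qed.

Lemma rowsum_reindex n s (e : nat -> A) (f h : nat -> nat) :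
  rowsum n (fun j i => nth (fun=> 0) s j (f i))
           (fun j i => e i * nth (fun=> 0) s j (h i)) =
  \sum_(k < n) e k * cdet n (reindex (fun i => if i == k then h i else f i) s).
Proof.
apply: eq_bigr => k _.
transitivity (e k * \det (\matrix_(r < n, j < n) if r == k
   then nth (fun=> 0) s j (h r) else nth (fun=> 0) s j (f r))).
  rewrite -(det_row_scale (fun j i => nth (fun=> 0) s j (f i))
                          (fun j i => nth (fun=> 0) s j (h i))).
  by congr (\det _); apply/matrixP => i j; rewrite !mxE; case: eqP => // ->.
congr (_ * \det _); apply/matrixP => i j.
by rewrite !mxE nth_reindex -(inj_eq val_inj); case: eqP.
Qed.

(** Raising any row but the last repeats the row after it. *)
Lemma rowsum_shift n s (e : nat -> A) :
  rowsum n.+1 (fun j i => nth (fun=> 0) s j i)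
              (fun j i => e i * nth (fun=> 0) s j i.+1) =
  e n * cdet n.+1 (reindex (bump n) s).
Proof.
rewrite (rowsum_reindex n.+1 s e id succn) big_ord_recr /= big1 ?add0r => [|k _]; last first.
  rewrite (@cdet_dup_row _ _ _ k k.+1) ?mulr0 ?ltnS ?(ltnW (ltn_ord k)) ?ltn_ord //.
    by rewrite neq_ltn ltnSn.
  by rewrite eqxx -[X in if X then _ else _]/(k.+1 == k)%N gtn_eqF.
congr (_ * _); apply: cdet_reindex => i h; rewrite /bump.
by case: eqP => h'; lia.
Qed.

(** Only the last two rows can rise by two without repeating a row, and the last but one passes over
    another on its way, whence the sign. In Schur functions this is p_2 = s_(2) - s_(1,1);
    [rowsum_bump_shift] is s_(1) s_(1) = s_(2) + s_(1,1). *)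
Lemma rowsum_shift2 n s :
  rowsum n.+2 (fun j i => nth (fun=> 0) s j i)
              (fun j i => nth (fun=> 0) s j i.+2) =
  cdet n.+2 (reindex (fun i => if (i < n.+1)%N then i else n.+3) s)
  - cdet n.+2 (reindex (bump n) s).
Proof.
transitivity (rowsum n.+2 (fun j i => nth (fun=> 0) s j i)
              (fun j i => 1 * nth (fun=> 0) s j i.+2)).
  by apply: rowsum_ext => // j i _ _; rewrite mul1r.
rewrite (rowsum_reindex n.+2 s (fun=> 1) id (fun i => i.+2)).
rewrite !big_ord_recr /= big1 ?add0r ?mul1r => [|k _]; last first.
  have kn := ltn_ord k.
  rewrite (@cdet_dup_row _ _ _ k k.+2) ?mulr0 //; try lia.
  by rewrite eqxx; case: eqP => //; lia.
rewrite addrC; congr (_ + _).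
  by apply: cdet_reindex => i h; case: ltnP => h'; case: eqP => // h''; lia.
apply: (@cdet_swap_row _ _ _ _ n n.+1); rewrite ?ltnS //= /bump.
- by rewrite neq_ltn ltnSn.
- by rewrite eqxx leqnSn.
- by rewrite gtn_eqF // leqnn.
by move=> i h n1 n2; rewrite (negbTE n1); lia.
Qed.

Lemma rowsum_shift2_1 s :
  rowsum 1 (fun j i => nth (fun=> 0) s j i) (fun j i => nth (fun=> 0) s j i.+2) =
  cdet 1 (reindex (fun=> 2%N) s).
Proof.
rewrite /rowsum big_ord_recl big_ord0 addr0; congr (\det _).
by apply/matrixP => i j; rewrite !mxE !ord1 eqxx nth_reindex.
Qed.

Lemma rowsum_bump_shift n s :
  rowsum n.+2 (fun j i => nth (fun=> 0) s j (bump n.+1 i))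
              (fun j i => nth (fun=> 0) s j (bump n.+1 i).+1) =
  cdet n.+2 (reindex (fun i => if (i < n.+1)%N then i else n.+3) s)
  + cdet n.+2 (reindex (bump n) s).
Proof.
transitivity (rowsum n.+2 (fun j i => nth (fun=> 0) s j (bump n.+1 i))
              (fun j i => 1 * nth (fun=> 0) s j (bump n.+1 i).+1)).
  by apply: rowsum_ext => // j i _ _; rewrite mul1r.
rewrite (rowsum_reindex n.+2 s (fun=> 1) (bump n.+1) (fun i => (bump n.+1 i).+1)).
rewrite !big_ord_recr /= big1 ?add0r ?mul1r => [|k _]; last first.
  have kn := ltn_ord k.
  rewrite (@cdet_dup_row _ _ _ k k.+1) ?mulr0 //; rewrite /bump; try lia.
  by rewrite eqxx; case: eqP => //; lia.
rewrite addrC; congr (_ + _); apply: cdet_reindex => i h; rewrite /bump.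
  by case: ltnP => h2; case: eqP => h1; case: ltnP => h3 /=; lia.
by case: eqP => h1; lia.
Qed.

Lemma rowsum_bump_shift_1 s :
  rowsum 1 (fun j i => nth (fun=> 0) s j (bump 0 i))
           (fun j i => nth (fun=> 0) s j (bump 0 i).+1) =
  cdet 1 (reindex (fun=> 2%N) s).
Proof.
rewrite /rowsum big_ord_recl big_ord0 addr0; congr (\det _).
by apply/matrixP => i j; rewrite !mxE !ord1 eqxx nth_reindex.
Qed.
End ColumnDeterminants.

(** * The hypergeometric family *)

Definition poch (K : pzRingType) (a : K) (n : nat) : K := \prod_(i < n) (a + i%:R).

(* Eigenstates, seed functions of type I, seed functions of type II. *)
Variant kind := St | TI | TII.

Definition kind_code (k : kind) : option bool :=
  match k with St => None | TI => Some true | TII => Some false end.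

Definition kind_decode (o : option bool) : kind :=
  match o with None => St | Some true => TI | Some false => TII end.

Lemma kind_codeK : cancel kind_code kind_decode.
Proof. by case. Qed.

HB.instance Definition _ := Equality.copy kind (can_type kind_codeK).

Section Columns.
Variable K : comNzRingType.
Implicit Types (al b kap : K) (p : {poly K}).

(** Normalised to be polynomial in all parameters: [kap = 0], [b = 1] gives n! times the Laguerre
    polynomial in y, and [kap = 1] gives n! times the Jacobi polynomial with parameters [al], [b] at
    1 - 2y. *)
Definition hgcoef al b kap n k : K :=
  (-1) ^+ k * 'C(n, k)%:R * poch (al + k.+1%:R) (n - k) *
  \prod_(i < k) (kap * (n%:R + al + 1 + i%:R) + b).

Definition hgpoly al b kap n : {poly K} := \poly_(k < n.+1) hgcoef al b kap n k.

Lemma hgcoef_rec al b kap n k :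
  (k.+1%:R * (k%:R + al + 1)) * hgcoef al b kap n k.+1 =
  - ((n%:R - k%:R) * (kap * (n%:R + k%:R + al + 1) + b)) * hgcoef al b kap n k.
Proof.
have [kn|kn] := ltnP k n; last first.
  rewrite /hgcoef (bin_small (m := k.+1)) // mulr0 !mul0r mulr0.
  by case: ltngtP kn => // [kn|->] _; rewrite ?(bin_small kn); ring.
rewrite /hgcoef big_ord_recr /= exprS.
have -> : poch (al + k.+1%:R) (n - k) = (al + k.+1%:R) * poch (al + k.+2%:R) (n - k.+1).
  rewrite /poch -[(n - k)%N]prednK ?subn_gt0 // big_ord_recl addr0 subnS.
  congr (_ * _); apply: eq_bigr => i _; rewrite /= /bump leq0n add1n -!natr1; ring.
have e : k.+1%:R * 'C(n, k.+1)%:R = (n%:R - k%:R) * 'C(n, k)%:R :> K.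
  by rewrite -natrM mul_bin_left natrM natrB // ltnW.
have eu : k%:R = k.+1%:R - 1 :> K by rewrite -natr1 addrK.
rewrite !eu in e *; move: e; set P1 := poch _ _; set P2 := \prod_(i < k) _.
move: k.+1%:R 'C(n, k.+1)%:R 'C(n, k)%:R ((-1) ^+ k) P1 P2 => u C' C t P1 P2 e.
by ring: e.
Qed.

Lemma coef_hgpoly al b kap n k : (hgpoly al b kap n)`_k = hgcoef al b kap n k.
Proof.
rewrite coef_poly; case: ltnP => // kn.
by rewrite /hgcoef bin_small // mulr0 !mul0r.
Qed.

Lemma hgpoly_ode al b kap n (p := hgpoly al b kap n) :
  'X * (1 - kap%:P * 'X) * p^`()^`()
  + ((al + 1)%:P - (b + kap * (al + 2))%:P * 'X) * p^`()
  + (n%:R * (kap * (n%:R + al + 1) + b))%:P * p = 0.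
Proof.
pose q := hgcoef al b kap n.
have p1 k : p^`()`_k = k.+1%:R * q k.+1.
  by rewrite coef_deriv coef_hgpoly mulr_natl.
have p1X k : (p^`() * 'X)`_k = k%:R * q k.
  by rewrite coefMX; case: k => [|k] /=; rewrite ?mul0r ?p1.
have p2X k : (p^`()^`() * 'X)`_k = k%:R * (k.+1%:R * q k.+1).
  rewrite coefMX; case: k => [|k] /=; first by rewrite mul0r.
  by rewrite coef_deriv p1 -[LHS]mulr_natl.
have p2XX k : (p^`()^`() * 'X * 'X)`_k = k%:R * (k%:R - 1) * q k.
  rewrite coefMX; case: k => [|k] /=; first by rewrite !mul0r.
  by rewrite p2X -[k.+1%:R]natr1 addrK; ring.
apply/polyP => k; rewrite coef0.
have -> : 'X * (1 - kap%:P * 'X) * p^`()^`()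
  + ((al + 1)%:P - (b + kap * (al + 2))%:P * 'X) * p^`()
  + (n%:R * (kap * (n%:R + al + 1) + b))%:P * p =
  p^`()^`() * 'X - kap%:P * (p^`()^`() * 'X * 'X) + (al + 1)%:P * p^`()
  - (b + kap * (al + 2))%:P * (p^`() * 'X)
  + (n%:R * (kap * (n%:R + al + 1) + b))%:P * p by ring.
rewrite !(coefD, coefN, coefCM) p2X p2XX p1X p1 coef_hgpoly -/q.
have := hgcoef_rec al b kap n k; rewrite -!/(q _).
move: (q k) (q k.+1) => x t e.
have -> : k%:R * (k.+1%:R * t) =
    k.+1%:R * (k%:R + al + 1) * t - (al + 1) * (k.+1%:R * t) by ring.
rewrite e; ring.
Qed.

Variables al b kap : K.

(* The common gauge-transformed equation lives on [0 < y], [0 < 1 - kap y].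
   The Laguerre case is [kap = 0, b = 1] with [y = eta], the Jacobi case is
   [kap = 1, b = h - 1/2] with [y = (1 - eta) / 2]; [al = g - 1/2] in both. *)
Definition zpoly : {poly K} := 1 - kap%:P * 'X.
Definition cpoly : {poly K} := 'X * zpoly.
Definition cpoly' : {poly K} := 1 - (2 * kap)%:P * 'X.
Definition c1poly : {poly K} := (al + 1)%:P - (b + kap * (al + 2))%:P * 'X.

Definition euler (p : {poly K}) : {poly K} := cpoly * p^`().

(** Logarithmic derivatives under cpoly d/dy of the gauge factors: 1; the exponential of b y if kap
    = 0, otherwise the power -b/kap of 1 - kap y; the power -al of y. *)
Definition omega (k : kind) : {poly K} :=
  match k with
  | St => 0
  | TI => b%:P * 'X
  | TII => - al%:P * zpoly
  end.

Definition basepoly (k : kind) (n : nat) : {poly K} :=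
  match k with
  | St => hgpoly al b kap n
  | TI => hgpoly al (- b) kap n
  | TII => hgpoly (- al) b kap n
  end.

(* Kept apart from [energyY]: the coefficient of [kap] separates partners whose
   eigenvalues coincide. *)
Definition energyX (k : kind) (n : nat) : K :=
  match k with
  | St => n%:R * (n%:R + al + 1)
  | TI => n%:R * (n%:R + al + 1)
  | TII => (n%:R - al) * (n%:R + 1)
  end.

Definition energyY (k : kind) (n : nat) : K :=
  match k with
  | St => - n%:R
  | TI => n%:R + al + 1
  | TII => al - n%:R
  end.

Definition energy k n : K := b * energyY k n - kap * energyX k n.

(* [col k p i] is [cpoly ^+ i] times the [i]-th derivative of [p] twisted by
   the logarithmic derivative [omega k / cpoly] of the gauge factor of the
   seed function. *)
Fixpoint col (k : kind) (p : {poly K}) (i : nat) : {poly K} :=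
  if i is i'.+1 then
    euler (col k p i') + (omega k - i'%:R * cpoly') * col k p i'
  else p.

Lemma eulerD : {morph euler : p q / p + q}.
Proof. by move=> p q; rewrite /euler derivD mulrDr. Qed.

Lemma eulerM p q : euler (p * q) = euler p * q + p * euler q.
Proof. by rewrite /euler derivM; ring. Qed.

Lemma eulerN p : euler (- p) = - euler p.
Proof. by rewrite /euler derivN mulrN. Qed.

Lemma eulerC a : euler a%:P = 0.
Proof. by rewrite /euler derivC mulr0. Qed.

Lemma euler_nat n : euler n%:R = 0.
Proof. by rewrite -polyC_natr eulerC. Qed.

Lemma eulerX : euler 'X = cpoly.
Proof. by rewrite /euler derivX mulr1. Qed.

Lemma euler_zpoly : euler zpoly = - kap%:P * cpoly.
Proof. by rewrite /zpoly eulerD eulerN eulerM eulerC eulerX -polyC1 eulerC; ring. Qed.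

Lemma euler_cpoly : euler cpoly = cpoly' * cpoly.
Proof.
rewrite {1}/cpoly eulerM eulerX euler_zpoly /cpoly /cpoly' /zpoly polyCM polyC_natr.
ring.
Qed.

Lemma euler_cpoly' : euler cpoly' = - 2 * kap%:P * cpoly.
Proof.
by rewrite /cpoly' -polyC1 eulerD eulerN eulerM !eulerC eulerX polyCM polyC_natr; ring.
Qed.

Lemma euler_c1poly : euler c1poly = - (b + kap * (al + 2))%:P * cpoly.
Proof. by rewrite /c1poly eulerD eulerN eulerM !eulerC eulerX; ring. Qed.

Lemma col_deriv k p i :
  euler (col k p i) = col k p i.+1 + (i%:R * cpoly' - omega k) * col k p i.
Proof. by rewrite /=; ring. Qed.

(** The contribution 'C(i,2) cpoly'' + i c1poly' of the coefficients when the second order equation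
    is differentiated i times. *)
Definition ebar (i : nat) : {poly K} :=
  - ('C(i, 2)%:R * 2 * kap%:P + i%:R * (b + kap * (al + 2))%:P).

(** The gauge factor alone solves the common second order equation, with the energy of index 0; this
    is the Riccati form of that fact. *)
Lemma omega_riccati k :
  euler (omega k) + omega k * (omega k - cpoly' + c1poly) =
  (energy k 0)%:P * cpoly.
Proof.
rewrite /energy; case: k; rewrite /omega /=.
- rewrite -polyC0 eulerC !(polyCD, polyCM, polyCN, polyC_natr, polyC1, polyC0).
  ring.
- rewrite eulerM eulerC eulerX /c1poly /cpoly' /cpoly /zpoly.
  rewrite !(polyCD, polyCM, polyCN, polyC_natr, polyC1, polyC0); ring.
- rewrite eulerM eulerN eulerC euler_zpoly /c1poly /cpoly' /cpoly /zpoly.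
  rewrite !(polyCD, polyCM, polyCN, polyC_natr, polyC1, polyC0); ring.
Qed.

Lemma basepoly_ode k n (p := basepoly k n) :
  cpoly * p^`()^`() + (2 * omega k + c1poly) * p^`()
   + (energy k 0 - energy k n)%:P * p = 0.
Proof.
rewrite {}/p /energy /c1poly /cpoly /zpoly.
have o := hgpoly_ode _ _ kap n.
case: k => /=; [move: (o al b)|move: (o al (- b))|move: (o (- al) b)];
  set q := hgpoly _ _ _ _ => {}o; rewrite -[RHS]o /zpoly;
  rewrite !(polyCD, polyCM, polyCN, polyC_natr, polyC1, polyC0); ring.
Qed.

(** A seed f, gauge factor included, satisfies cpoly f'' + c1poly f' = energy f. This is the i-th
    derivative of that equation, times the power i + 1 of cpoly and freed of the gauge factor. Only
    the energy depends on the column, which is what allows the equation to be applied to the rows of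
    a determinant. *)
Lemma col_rec k n i (v := col k (basepoly k n)) :
  v i.+2 + (i%:R * cpoly' + c1poly) * v i.+1
  + (ebar i - (energy k n)%:P) * cpoly * v i = 0.
Proof.
elim: i => [|i IH].
  have o := basepoly_ode k n; have r := omega_riccati k.
  have v1 : v 1%N = euler (v 0%N) + omega k * v 0%N by rewrite /v /=; ring.
  have v2 : v 2%N = euler (v 1%N) + (omega k - cpoly') * v 1%N by rewrite /v /=; ring.
  have ev1 : euler (v 1%N) = cpoly' * cpoly * (v 0%N)^`()
      + cpoly * (cpoly * (v 0%N)^`()^`())
      + (euler (omega k) * v 0%N + omega k * (cpoly * (v 0%N)^`())).
    rewrite v1 eulerD (eulerM (omega k)); congr (_ + _).
    by rewrite -euler_cpoly -[cpoly * _^`()^`()]/(euler _) -(eulerM cpoly).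
  have o' : cpoly * (v 0%N)^`()^`() + (2 * omega k + c1poly) * (v 0%N)^`()
   + ((energy k 0)%:P - (energy k n)%:P) * v 0%N = 0 by rewrite -polyCB.
  have ev0 : euler (v 0%N) = cpoly * (v 0%N)^`() by [].
  rewrite v2 ev1 v1 /ebar bin0n ev0.
  move: o' r {v1 v2 ev1 ev0 o}; move: (v 0%N) (omega k) (euler (omega k)) => p oo e o r.
  have -> : e = (energy k 0)%:P * cpoly - oo * (oo - cpoly' + c1poly).
    by rewrite -r addrK.
  by rewrite -[RHS](mulr0 cpoly) -o /=; ring.
have e1 : v i.+3 = euler (v i.+2) + (omega k - i.+2%:R * cpoly') * v i.+2 by [].
have e2 : v i.+2 = euler (v i.+1) + (omega k - i.+1%:R * cpoly') * v i.+1 by [].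
have e3 : v i.+1 = euler (v i) + (omega k - i%:R * cpoly') * v i by [].
have d2 : euler (v i.+1) = v i.+2 - (omega k - i.+1%:R * cpoly') * v i.+1.
  by rewrite e2 addrK.
have d3 : euler (v i) = v i.+1 - (omega k - i%:R * cpoly') * v i.
  by rewrite e3 addrK.
have e1' : euler (v i.+2) = v i.+3 - (omega k - i.+2%:R * cpoly') * v i.+2.
  by rewrite e1 addrK.
have eb : euler (ebar i - (energy k n)%:P) = 0.
  rewrite /ebar eulerD !eulerN eulerC eulerD (eulerM _ kap%:P) (eulerM i%:R).
  rewrite (eulerM 'C(i, 2)%:R) !euler_nat !eulerC. ring.
have e4 : euler (i%:R * cpoly' + c1poly) =
    - (i%:R * 2 * kap%:P + (b + kap * (al + 2))%:P) * cpoly.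
  by rewrite eulerD (eulerM i%:R) euler_nat euler_cpoly' euler_c1poly; ring.
have euler0 : euler 0 = 0 by rewrite -polyC0 eulerC.
have h : v i.+3 - (omega k - i.+2%:R * cpoly') * v i.+2
   + (euler (i%:R * cpoly' + c1poly) * v i.+1
      + (i%:R * cpoly' + c1poly) * euler (v i.+1))
   + (0 * cpoly + (ebar i - (energy k n)%:P) * (cpoly' * cpoly)) * v i
   + (ebar i - (energy k n)%:P) * cpoly * euler (v i) = 0.
  have E := congr1 euler IH; rewrite eulerD eulerD e1' euler0 in E; rewrite -[RHS]E.
  rewrite (eulerM (i%:R * cpoly' + c1poly)).
  rewrite (eulerM ((ebar i - (energy k n)%:P) * cpoly)).
  by rewrite (eulerM _ cpoly) eb euler_cpoly; ring.
have -> : ebar i.+1 = ebar i - (i%:R * 2 * kap%:P + (b + kap * (al + 2))%:P).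
  rewrite /ebar binS bin1 natrD -[i.+1%:R]natr1. ring.
move: h; rewrite e4 d2 d3.
move: IH {e1 e1' e2 e3 d2 d3 e4 eb}.
move: (v i.+3) (v i.+2) (v i.+1) (v i) => v3 v2 v1 v0 IH.
have -> : i.+2%:R = i%:R + 2 :> {poly K} by rewrite -addn2 natrD.
have -> : i.+1%:R = i%:R + 1 :> {poly K} by rewrite -natr1.
move=> h; rewrite -[LHS]subr0 -[in LHS](mulr0 (omega k - (i%:R + 1) * cpoly')).
by rewrite -[X in _ - _ * X]IH -[RHS]h; ring.
Qed.
End Columns.

(** * Bilinear equations *)

Section TauFunctions.
Variable K : comNzRingType.
Variables al b kap : K.
Implicit Types (s : seq (kind * nat)) (x : kind * nat).

Local Notation D := (euler kap).
Local Notation C := (cpoly kap).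
Local Notation c := (cpoly' kap).
Local Notation c1 := (c1poly al b kap).
Local Notation om := (omega al b kap).
Local Notation E x := (energy al b kap x.1 x.2).
Local Notation eb := (ebar al b kap).

Definition cols s :=
  [seq col al b kap x.1 (basepoly al b kap x.1 x.2) | x <- s].

(* [tau1], [tau2x], [tau2y] use the rows shifted by the partitions (1), (2)
   and (1,1). *)
Definition tau s : {poly K} := cdet (size s) (cols s).
Definition tau1 s : {poly K} := cdet (size s) (reindex (bump (size s).-1) (cols s)).
Definition tau2x s : {poly K} := cdet (size s)
  (reindex (fun i => if (i < (size s).-1)%N then i else (size s).+1) (cols s)).
Definition tau2y s : {poly K} :=
  if (1 < size s)%N then cdet (size s) (reindex (bump (size s).-2) (cols s)) else 0.

Definition weight s : {poly K} := 'C(size s, 2)%:R * c - \sum_(x <- s) om x.1.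

Lemma size_cols s : size (cols s) = size s.
Proof. by rewrite size_map. Qed.

Lemma nth_cols s j : (j < size s)%N -> nth (fun=> 0) (cols s) j =
  col al b kap (nth (St, 0%N) s j).1
   (basepoly al b kap (nth (St, 0%N) s j).1 (nth (St, 0%N) s j).2).
Proof. by move=> js; rewrite (nth_map (St, 0%N)). Qed.

Lemma sum_nth_ord (I : Type) (V : nmodType) (x0 : I) (t : seq I) (F : I -> V) :
  \sum_(j < size t) F (nth x0 t j) = \sum_(x <- t) F x.
Proof. by rewrite (big_nth x0) big_mkord. Qed.

Lemma euler_cdet s f :
  D (cdet (size s) (reindex f (cols s))) =
  rowsum (size s) (fun j i => nth (fun=> 0) (cols s) j (f i))
    (fun j i => nth (fun=> 0) (cols s) j (f i).+1)
  + (c * (\sum_(i < size s) (f i)%:R) - \sum_(x <- s) om x.1)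
    * cdet (size s) (reindex f (cols s)).
Proof.
have E0 : cdet (size s) (reindex f (cols s)) =
    \det (\matrix_(i < size s, j < size s) nth (fun=> 0) (cols s) j (f i)).
  by congr (\det _); apply/matrixP => i j; rewrite !mxE nth_reindex.
pose V j i := nth (fun=> 0) (cols s) j (f i).
rewrite E0 (det_derivation (size s) V (eulerD kap) (eulerM kap)).
transitivity (rowsum (size s) V (fun j i => nth (fun=> 0) (cols s) j (f i).+1
    + ((c * (f i)%:R) * V j i + (- om (nth (St, 0%N) s j).1) * V j i))).
  apply: rowsum_ext => // j i js _.
  by rewrite /V (nth_cols js) col_deriv; ring.
rewrite !rowsumD; congr (_ + _).
rewrite (rowsum_diag _ _ (fun i => c * (f i)%:R)).
rewrite (rowsum_scale _ _ (fun j => - om (nth (St, 0%N) s j).1)) -mulrDl.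
by rewrite sumrN (sum_nth_ord (St, 0%N) s (fun x => om x.1)) -[\sum_(j < _) _ * _]mulr_sumr.
Qed.

Lemma sum_ord_nat n : \sum_(i < n) (i : nat)%:R = 'C(n, 2)%:R :> {poly K}.
Proof. by rewrite -natr_sum -bin2_sum big_mkord. Qed.

Lemma euler_tau s : (0 < size s)%N -> D (tau s) = tau1 s + weight s * tau s.
Proof.
move=> s0; have := euler_cdet s id.
rewrite (cdet_reindex_id (f := id)) // sum_ord_nat => ->.
rewrite /weight [c * _]mulrC; congr (_ + _).
rewrite /tau1; move: (cols s) => t; case: (size s) s0 => // n _ /=.
rewrite -[RHS]mul1r -(rowsum_shift n t (fun=> 1)).
by apply: rowsum_ext => // j i _ _; rewrite mul1r.
Qed.

Lemma euler_tau1 s : (0 < size s)%N ->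
  D (tau1 s) = tau2x s + tau2y s + (weight s + c) * tau1 s.
Proof.
move=> s0; have := euler_cdet s (bump (size s).-1).
rewrite -/(tau1 s) => ->.
have -> : \sum_(i < size s) (bump (size s).-1 i)%:R = 'C(size s, 2)%:R + 1 :> {poly K}.
  case: (size s) s0 => // n _; rewrite -sum_ord_nat !big_ord_recr /=.
  rewrite (eq_bigr (fun i : 'I_n => (i : nat)%:R)) => [|i _].
    by rewrite /bump leqnn add1n -natr1 addrA.
  by rewrite /bump leqNgt ltn_ord.
congr (_ + _ * _); last by rewrite /weight; ring.
rewrite /tau2x /tau2y; move: (cols s) => t; case: (size s) s0 => // -[|n] _ /=.
  rewrite rowsum_bump_shift_1 addr0; exact: cdet_reindex.
by rewrite rowsum_bump_shift.
Qed.

(** The first variation in the direction given by [col_rec] is zero. Energies are column factors, so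
    they enter through their sum only. *)
Lemma tau_trace s : (0 < size s)%N ->
  tau2x s - tau2y s + ((size s).-1%:R * c + c1) * tau1 s
  + (\sum_(i < size s) eb i - (\sum_(x <- s) E x)%:P) * C * tau s = 0.
Proof.
move=> s0.
pose V j i := nth (fun=> 0) (cols s) j i.
have : rowsum (size s) V (fun j i => V j i.+2 + ((i%:R * c + c1) * V j i.+1
   + ((eb i * C) * V j i + (- (E (nth (St, 0%N) s j))%:P * C) * V j i))) = 0.
  rewrite (@rowsum_ext _ _ _ _ V (fun j i => 0 * V j i)) //.
    by rewrite (rowsum_diag _ _ (fun=> 0)) big1 ?mul0r.
  move=> j i js _; rewrite /V (nth_cols js) mul0r.
  by rewrite -[RHS](col_rec al b kap (nth (St, 0%N) s j).1 (nth (St, 0%N) s j).2 i) /=; ring.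
rewrite !rowsumD (rowsum_diag _ _ (fun i => eb i * C)).
rewrite (rowsum_scale _ _ (fun j => - (E (nth (St, 0%N) s j))%:P * C)).
have -> : \sum_(j < size s) - (E (nth (St, 0%N) s j))%:P * C =
    - (\sum_(x <- s) E x)%:P * C.
  by rewrite -mulr_suml sumrN (sum_nth_ord (St, 0%N) s (fun x => (E x)%:P)) rmorph_sum.
rewrite -mulr_suml.
have -> : \det (\matrix_(i < size s, j < size s) V j i) = tau s by [].
move=> h; rewrite -[RHS]h -[LHS]addrA; congr (_ + (_ + _)); last by ring.
  rewrite /tau2x /tau2y /V; move: (cols s) => t; case: (size s) s0 => // -[|n] _ /=.
    rewrite rowsum_shift2_1 subr0; exact: cdet_reindex.
  by rewrite rowsum_shift2.
rewrite /tau1 /V; move: (cols s) => t; case: (size s) s0 => // n _ /=.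
by rewrite (rowsum_shift n t (fun i => i%:R * c + c1)).
Qed.

Lemma tau_plucker s x : (0 < size s)%N ->
  tau2y (s ++ [:: x]) * tau s - tau1 (s ++ [:: x]) * tau1 s
  + tau (s ++ [:: x]) * tau2x s = 0.
Proof.
move=> s0; rewrite /tau2y /tau1 /tau2x /tau size_cat addn1 ltnS s0 /=.
rewrite [cols (_ ++ _)]map_cat /= -/(cols s).
case: (size s) s0 (size_cols s) => // n _ st /=.
exact: cdet_plucker.
Qed.

Lemma weight_rcons s x :
  weight (s ++ [:: x]) = weight s + (size s)%:R * c - om x.1.
Proof.
by rewrite /weight size_cat addn1 big_cat big_seq1 binS bin1 natrD /=; ring.
Qed.

(** Exchanging [F] and [T] replaces [g] by [c - g] and keeps [rho]. *)
Definition bilinear (F T g rho : {poly K}) : Prop :=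
  D (D F) * T - 2 * D F * D T + F * D (D T) + (g - c) * D F * T
  - g * F * D T + rho * F * T = 0.

(** Second derivatives bring in the sums [tau2x + tau2y], traces the differences [tau2x - tau2y].
    With the trace of the longer determinant added and that of the shorter one subtracted, the
    remaining second order terms are twice those of [tau_plucker]. *)
Lemma bilinear_rcons s x (k := (size s)%:R) : (0 < size s)%N ->
  bilinear (tau (s ++ [:: x])) (tau s)
   (- (k * c - c1 - 2 * om x.1))
   (- D (weight (s ++ [:: x])) + weight (s ++ [:: x]) ^+ 2
    + c * weight (s ++ [:: x]) - (k * c + c1) * weight (s ++ [:: x])
    - 2 * weight (s ++ [:: x]) * weight s - D (weight s) + weight s ^+ 2
    + c * weight s + ((k - 1) * c + c1) * weight s
    + (eb (size s) - (E x)%:P) * C).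
Proof.
move=> s0; set s' := s ++ [:: x].
have s'0 : (0 < size s')%N by rewrite /s' size_cat addn1.
have P := tau_plucker x s0; rewrite -/s' in P.
have T := tau_trace s0; have T' := tau_trace s'0.
have W : weight s' = weight s + k * c - om x.1 by exact: weight_rcons.
have D1 := euler_tau s0; have D2 := euler_tau1 s0.
have D1' := euler_tau s'0; have D2' := euler_tau1 s'0.
have DD : D (D (tau s)) = tau2x s + tau2y s + (weight s + c) * tau1 s +
   (D (weight s) * tau s + weight s * (tau1 s + weight s * tau s)).
  by rewrite D1 eulerD D2 (eulerM _ (weight s)) D1.
have DD' : D (D (tau s')) = tau2x s' + tau2y s' + (weight s' + c) * tau1 s' +
   (D (weight s') * tau s' + weight s' * (tau1 s' + weight s' * tau s')).
  by rewrite D1' eulerD D2' (eulerM _ (weight s')) D1'.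
rewrite /bilinear DD DD' D1 D1'.
have e1 : (size s)%:R = (size s).-1%:R + 1 :> {poly K} by case: (size s) s0 => // n _; rewrite natr1.
have e2 : (size s').-1%:R = k by rewrite /s' size_cat addn1.
have e3 : \sum_(i < size s') eb i = \sum_(i < size s) eb i + eb (size s).
  by rewrite /s' size_cat addn1 big_ord_recr.
have e4 : (\sum_(x <- s') E x)%:P = (\sum_(x <- s) E x)%:P + (E x)%:P :> {poly K}.
  by rewrite /s' big_cat big_seq1 polyCD.
rewrite e2 e3 e4 in T'.
rewrite /k e1 in W T' *.
move: P T T' W {D1 D2 D1' D2' DD DD'} => P T T' W.
move: (tau2x s) (tau2y s) (tau2x s') (tau2y s') (tau1 s) (tau1 s') (tau s) (tau s') P T T'.
move: (D (weight s)) (D (weight s')) => d d'.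
rewrite W; move: (weight s) => w.
move=> X Y X' Y' t1 t1' t t'.
set p := (P in P = 0 -> _); move=> P.
set q := (P in P = 0 -> _); move=> Q.
set r := (P in P = 0 -> _); move=> R.
transitivity (2 * p + t * r - t' * q); first by rewrite /p /q /r; ring.
by rewrite P Q R; ring.
Qed.
End TauFunctions.

(** * Equations at the zeros *)

Section RootRelation.
Variables (A K : comNzRingType) (D : A -> A) (ev : {rmorphism A -> K}).
Hypothesis DD : {morph D : x y / x + y}.
Hypothesis DM : forall x y, D (x * y) = D x * y + x * D y.

Let D0 : D 0 = 0. Proof. by apply: (addIr (D 0)); rewrite -DD !add0r. Qed.
Let D1 : D 1 = 0.
Proof. by apply: (addIr (D 1)); rewrite add0r -{3}[1]mulr1 DM mulr1 mul1r. Qed.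
Let DN x : D (- x) = - D x.
Proof. by apply: (addIr (D x)); rewrite -DD !addNr. Qed.
Let Dnat n : D n%:R = 0.
Proof. by elim: n => // n IH; rewrite -natr1 DD IH D1 addr0. Qed.

(** Where [T] vanishes, the highest derivative of [F] drops out of the equation and of its
    derivative; what is left gives [D F] and then [D (D F)] as multiples of [F]. *)
Lemma bilinear_at_root (F T c g rho : A) :
  D (D F) * T - 2 * D F * D T + F * D (D T) + (g - c) * D F * T
  - g * F * D T + rho * F * T = 0 -> ev T = 0 ->
  2 * ev (D F) * ev (D T) = ev F * (ev (D (D T)) - ev g * ev (D T)) /\
  2 * ev (D (D F)) * ev (D T) ^+ 2 = ev F *
   (- ev (D (D T)) ^+ 2 - (ev c + ev g) * ev (D T) * ev (D (D T))
    + 2 * ev (D T) * ev (D (D (D T)))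
    + (ev g * ev c - 2 * ev (D g) + 2 * ev rho) * ev (D T) ^+ 2).
Proof.
move=> H T0.
have H1 := congr1 ev H.
have H2 := congr1 (fun x => ev (D x)) H.
rewrite !(rmorphD, rmorphB, rmorphM, rmorphN, rmorph0, rmorph_nat) /= T0 in H1.
rewrite D0 !(DD, DN, DM, Dnat) in H2.
rewrite !(rmorphD, rmorphB, rmorphM, rmorphN, rmorph0, rmorph_nat) /= T0 in H2.
move: H1 H2.
move: (ev (D (D (D F)))) (ev (D (D F))) (ev (D F)) (ev F) => f3 f2 f1 f0.
move: (ev (D (D (D T)))) (ev (D (D T))) (ev (D T)) => t3 t2 t1.
move: (ev (D g)) (ev g) (ev (D c)) (ev c) (ev (D rho)) (ev rho) => dg g0 dc c0 dr r0.
set p := (X in X = 0 -> _); move=> P.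
set q := (X in X = 0 -> _); move=> Q.
have E1 : 2 * f1 * t1 = f0 * (t2 - g0 * t1).
  transitivity (f0 * (t2 - g0 * t1) - p); first by rewrite /p; ring.
  by rewrite P subr0.
split=> //.
transitivity (- (2 * f1 * t1) * (t2 + c0 * t1)
   + 2 * t1 * (f0 * (t3 - dg * t1 - g0 * t2 + r0 * t1)) - 2 * t1 * q).
  by rewrite /q; ring.
by rewrite Q E1; ring.
Qed.

(** At a zero of [T] the Wronskian of [B] and [T] is [- B * D T], and its second derivative is that
    of [delta * (Fa * Fb)]. By [bilinear_at_root] the latter is [delta * (Fa * Fb)] times a quantity
    free of [B], so everything can be expressed by [B] and [T]. *)
Lemma ratio_at_root (Fa Fb T B c ga gb ra rb delta : A) :
  D (D Fa) * T - 2 * D Fa * D T + Fa * D (D T) + (ga - c) * D Fa * T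
  - ga * Fa * D T + ra * Fa * T = 0 ->
  D (D Fb) * T - 2 * D Fb * D T + Fb * D (D T) + (gb - c) * D Fb * T
  - gb * Fb * D T + rb * Fb * T = 0 ->
  ga + gb = 0 -> D delta = 0 ->
  D B * T - B * D T = delta * (Fa * Fb) -> ev T = 0 ->
  4 * ev (D T) ^+ 2 * (ev (D (D B)) * ev (D T) - ev (D B) * ev (D (D T))) =
  ev B * ev (D T) * (2 * ev (D (D T)) ^+ 2 + 4 * ev c * ev (D T) * ev (D (D T))
     - 4 * ev (D T) * ev (D (D (D T)))
     - (4 * (ev ra + ev rb) - 2 * ev gb ^+ 2) * ev (D T) ^+ 2).
Proof.
move=> Ha Hb gab dd H T0.
have [a1 a2] := bilinear_at_root Ha T0.
have [b1 b2] := bilinear_at_root Hb T0.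
have ga_gb : ga = - gb by apply/eqP; rewrite -subr_eq0 opprK gab.
have H0 := congr1 ev H.
have H2 := congr1 (fun x => ev (D (D x))) H.
rewrite !(DD, DN, DM, dd, D0, mul0r, add0r) in H2.
rewrite !(rmorphD, rmorphB, rmorphM, rmorphN, rmorph0, rmorph_nat) /= T0 in H0 H2.
rewrite ga_gb ?DN ?rmorphN in a1 a2.
move: a1 a2 b1 b2 H0 H2.
move: (ev (D (D Fa))) (ev (D Fa)) (ev Fa) => a2 a1 a0.
move: (ev (D (D Fb))) (ev (D Fb)) (ev Fb) => b2 b1 b0.
move: (ev (D (D (D B)))) (ev (D (D B))) (ev (D B)) (ev B) => B3 B2 B1 B0.
move: (ev (D (D (D T)))) (ev (D (D T))) (ev (D T)) => t3 t2 t1.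
move: (ev (D gb)) (ev gb) (ev c) (ev ra) (ev rb) (ev delta) => dg g c0 r_a r_b d.
move=> ea1 ea2 eb1 eb2 H0 H2.
have E2 : B2 * t1 - B1 * t2 - B0 * t3 = d * (a2 * b0 + 2 * a1 * b1 + a0 * b2).
  move: H2; set p := (X in X = _); set q := (X in _ = X) => H2.
  transitivity p; first by rewrite /p; ring.
  by rewrite H2 /q; ring.
have E0 : - B0 * t1 = d * (a0 * b0) by rewrite -H0; ring.
transitivity (4 * t1 ^+ 2 * (B2 * t1 - B1 * t2 - B0 * t3) + 4 * t1 ^+ 2 * B0 * t3).
  by ring.
rewrite E2.
transitivity (2 * d * (2 * a2 * t1 ^+ 2 * b0 + 2 * b2 * t1 ^+ 2 * a0
   + (2 * a1 * t1) * (2 * b1 * t1)) + 4 * t1 ^+ 2 * B0 * t3); first by ring.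
rewrite ea1 ea2 eb1 eb2.
transitivity ((d * (a0 * b0)) * (- 2 * t2 ^+ 2 - 4 * c0 * t1 * t2 + 8 * t1 * t3
   + (4 * (r_a + r_b) - 2 * g ^+ 2) * t1 ^+ 2) + 4 * t1 ^+ 2 * B0 * t3); first by ring.
by rewrite -E0; ring.
Qed.
End RootRelation.

(** * Wronskian identities between neighbouring tau functions *)

Section TauIdentities.
Variable K : comNzRingType.
Variables al b kap : K.
Implicit Types (s : seq (kind * nat)) (x : kind * nat).

Local Notation D := (euler kap).
Local Notation C := (cpoly kap).
Local Notation c := (cpoly' kap).
Local Notation c1 := (c1poly al b kap).
Local Notation om := (omega al b kap).
Local Notation E x := (energy al b kap x.1 x.2).
Local Notation tau := (tau al b kap).
Local Notation tau1 := (tau1 al b kap).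
Local Notation tau2x := (tau2x al b kap).
Local Notation tau2y := (tau2y al b kap).
Local Notation weight := (weight al b kap).
Local Notation cols := (cols al b kap).

Lemma tau_perm s s' : perm_eq s s' -> exists e : bool, tau s' = (-1) ^+ e * tau s.
Proof.
move=> ps; have ss := perm_size ps.
have /(@tuple_permP _ _ _ (in_tuple s)) [p sp] : perm_eq s' s by rewrite perm_sym.
exists (odd_perm p); rewrite /tau /cdet -ss.
have -> : \matrix_(i < size s, j < size s) nth (fun=> 0) (cols s') j i =
   col_perm p (\matrix_(i < size s, j < size s) nth (fun=> 0) (cols s) j i).
  apply/matrixP => i j; rewrite !mxE !nth_cols -?ss ?ltn_ord //.
  have -> // : nth (St, 0%N) s' j = nth (St, 0%N) s (p j).
  by rewrite sp (nth_map j) ?size_enum_ord ?ltn_ord // nth_ord_enum (tnth_nth (St, 0%N)).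
by rewrite col_permE det_mulmx det_perm odd_permV mulrC; case: odd_perm.
Qed.

Lemma tau_jacobi s x y : (0 < size s)%N ->
  tau s * tau (s ++ [:: x; y]) =
  tau (s ++ [:: x]) * tau1 (s ++ [:: y]) - tau1 (s ++ [:: x]) * tau (s ++ [:: y]).
Proof.
move=> s0; rewrite /tau /tau1 !size_cat addn1 addn2 /=.
rewrite /cols !map_cat; apply: cdet_jacobi.
by rewrite size_map.
Qed.

(** Entries of one kind give equal weights, which cancel in the Wronskian and leave [tau_jacobi]. *)
Lemma tau_replace s x y : (0 < size s)%N -> x.1 = y.1 ->
  D (tau (s ++ [:: y])) * tau (s ++ [:: x]) -
  tau (s ++ [:: y]) * D (tau (s ++ [:: x])) = tau s * tau (s ++ [:: x; y]).
Proof.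
move=> s0 xy; rewrite tau_jacobi // !euler_tau ?size_cat ?addn1 //.
by rewrite !weight_rcons xy; ring.
Qed.

(** Jacobi identities for three choices of rows turn the products of [tau s] and [tau1 s] with the
    longer determinants into [tau2x] and [tau2y] of [s ++ [:: x]] and [s ++ [:: y]]. The traces of
    these two then cancel except for their energies, which is the origin of the constant
    [E x - E y]. *)
Lemma tau_remove s x y : (0 < size s)%N -> x.1 = TI -> y.1 = TII ->
  let A := C ^+ (size s) * tau s in
  let T := tau (s ++ [:: x; y]) in
  D A * T - A * D T =
  (E x - E y)%:P * (C ^+ (size s).+1 * tau (s ++ [:: x]) * tau (s ++ [:: y])).
Proof.
move=> s0 xI yII /=.
have sx : (0 < size (s ++ [:: x]))%N by rewrite size_cat addn1.
have sy : (0 < size (s ++ [:: y]))%N by rewrite size_cat addn1.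
have sxy : (0 < size (s ++ [:: x; y]))%N by rewrite size_cat addn2.
have J1 := tau_jacobi x y s0.
have J2 : tau s * tau1 (s ++ [:: x; y]) =
   tau (s ++ [:: x]) * tau2x (s ++ [:: y]) - tau2x (s ++ [:: x]) * tau (s ++ [:: y]).
  rewrite /tau /tau1 /tau2x !size_cat addn1 addn2 /=.
  have := cdet_jacobi
    (fun i => col al b kap x.1 (basepoly al b kap x.1 x.2) (bump (size s).+1 i))
    (fun i => col al b kap y.1 (basepoly al b kap y.1 y.2) (bump (size s).+1 i))
    (etrans (size_map _ _) (size_cols al b kap s) :
       size (reindex (bump (size s).+1) (cols s)) = size s).
  rewrite (cdet_reindex_id (n := size s) (f := bump (size s).+1)); last first.
    by move=> i h; rewrite /bump leqNgt (leqW h).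
  have catE z : reindex (bump (size s).+1) (cols s) ++
     [:: (fun i => col al b kap z.1 (basepoly al b kap z.1 z.2) (bump (size s).+1 i))]
     = reindex (bump (size s).+1) (cols (s ++ [:: z])).
    by rewrite /cols map_cat /reindex map_cat.
  rewrite !catE.
  rewrite (cdet_reindex_id (n := (size s).+1) (f := bump (size s).+1)); last first.
    by move=> i h; rewrite /bump leqNgt h.
  rewrite (cdet_reindex_id (n := (size s).+1) (f := bump (size s).+1)); last first.
    by move=> i h; rewrite /bump leqNgt h.
  have rr z : cdet (size s).+1 (reindex (bump (size s))
        (reindex (bump (size s).+1) (cols (s ++ [:: z])))) =
     cdet (size s).+1 (reindex (fun i => if (i < size s)%N then i else (size s).+2)
        (cols (s ++ [:: z]))).
    rewrite reindex_comp; apply: cdet_reindex => i h.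
    rewrite /=; case: ltnP => h1.
      by rewrite /bump (leqNgt (size s) i) h1 (leqNgt _.+1) ltnS ltnW.
    have -> : i = size s by lia.
    by rewrite /bump leqnn add1n leqnn add1n.
  rewrite !rr => <-; congr (_ * cdet _ _).
  by rewrite /cols map_cat /reindex map_cat.
have J3 : tau1 s * tau (s ++ [:: x; y]) =
   tau (s ++ [:: x]) * tau2y (s ++ [:: y]) - tau2y (s ++ [:: x]) * tau (s ++ [:: y]).
  have [n sn] : exists n, size s = n.+1 by case: (size s) s0 => // n; exists n.
  (* Exchanging the rows [n] and [n.+1] makes the leading minor in [cdet_jacobi] equal to [tau1 s];
     the other minors change sign or become [tau2y]. *)
  pose f i := if i == n then n.+1 else if i == n.+1 then n else i.
  have fs z : size (reindex f (cols z)) = size z by rewrite size_map size_cols.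
  have := cdet_jacobi
    (fun i => col al b kap x.1 (basepoly al b kap x.1 x.2) (f i))
    (fun i => col al b kap y.1 (basepoly al b kap y.1 y.2) (f i)) (fs s).
  have catE z : reindex f (cols s) ++
     [:: (fun i => col al b kap z.1 (basepoly al b kap z.1 z.2) (f i))]
     = reindex f (cols (s ++ [:: z])).
    by rewrite /cols map_cat /reindex map_cat.
  have catE2 : reindex f (cols s) ++
     [:: (fun i => col al b kap x.1 (basepoly al b kap x.1 x.2) (f i));
         (fun i => col al b kap y.1 (basepoly al b kap y.1 y.2) (f i))]
     = reindex f (cols (s ++ [:: x; y])).
    by rewrite /cols map_cat /reindex map_cat.
  rewrite catE2 !catE /tau /tau1 /tau2y !size_cat addn1 addn2 sn /=.
  have r1 : cdet n.+1 (reindex f (cols s)) = cdet n.+1 (reindex (bump n) (cols s)).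
    apply: cdet_reindex => i h; rewrite /f /bump.
    by case: eqP => h1; [lia|case: eqP => h2; lia].
  have swap m z : (n.+1 < m)%N -> cdet m (reindex f (cols z)) = - cdet m (cols z).
    move=> nm.
    have -> : cdet m (cols z) = cdet m (reindex id (cols z)).
      by rewrite (cdet_reindex_id (f := id)).
    have fn : f n = n.+1 by rewrite /f eqxx.
    have fn1 : f n.+1 = n by rewrite /f gtn_eqF // eqxx.
    have fi i : (i < m)%N -> i != n -> i != n.+1 -> f i = i.
      by move=> _ /negbTE h1 /negbTE h2; rewrite /f h1 h2.
    have nn : n != n.+1 by rewrite neq_ltn ltnSn.
    exact: (@cdet_swap_row _ m f id (cols z) n n.+1 (ltn_trans (ltnSn n) nm) nm nn fn fn1 fi).
  have rr z : cdet n.+2 (reindex (bump n.+1) (reindex f (cols (s ++ [:: z])))) =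
     cdet n.+2 (reindex (bump n) (cols (s ++ [:: z]))).
    rewrite reindex_comp; apply: cdet_reindex => i h; rewrite /= /f /bump.
    by case: (leqP n.+1 i) => h1; case: (leqP n i) => h2; case: eqP => h3;
      try case: eqP => h4; lia.
  rewrite r1 !rr !swap // => e.
  by rewrite -[LHS]opprK -mulrN e; ring.
have W1 := weight_rcons al b kap s x; have W2 := weight_rcons al b kap s y.
have W12 : weight (s ++ [:: x; y]) =
    weight (s ++ [:: x]) + (size s).+1%:R * c - om y.1.
  by rewrite -cat1s catA weight_rcons size_cat addn1.
(* Special to one entry of each type: their gauge weights add up to a first order coefficient of the
   common equation. *)
have oxy : om x.1 + om y.1 = c - c1.
  rewrite xI yII /omega /zpoly /cpoly' /c1poly.
  by rewrite !(polyCD, polyCM, polyCN, polyC_natr, polyC1, polyC0); ring.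
have Tx := tau_trace al b kap sx; have Ty := tau_trace al b kap sy.
rewrite !size_cat !addn1 /= in Tx Ty.
rewrite !big_cat !big_seq1 /= (polyCD _ (E x)) in Tx.
rewrite !big_cat !big_seq1 /= (polyCD _ (E y)) in Ty.
have DCn m : D (C ^+ m) = m%:R * c * C ^+ m.
  elim: m => [|m IH]; first by rewrite expr0 mul0r mul0r -polyC1 eulerC.
  by rewrite exprS (eulerM _ C) IH euler_cpoly -natr1; ring.
rewrite (eulerM _ (C ^+ size s)) DCn (euler_tau al b kap s0) (euler_tau al b kap sxy) W12 W1.
have -> : om x.1 = c - c1 - om y.1 by rewrite -oxy addrK.
have n1 : (size s).+1%:R = (size s)%:R + 1 :> {poly K} by rewrite natr1.
rewrite polyCB (exprS _ (size s)) n1.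
move/eqP: J1; rewrite -subr_eq0; move/eqP: J2; rewrite -subr_eq0.
move/eqP: J3; rewrite -subr_eq0.
move: Tx Ty {W1 W2 W12 n1 DCn oxy}.
move: (tau2x _) (tau2x _) (tau2y _) (tau2y _) => X Y X' Y'.
move: (tau1 (s ++ [:: x])) (tau1 (s ++ [:: y])) => Tx1 Ty1.
move: (tau (s ++ [:: x])) (tau (s ++ [:: y])) => Tx Ty.
move: (tau1 (s ++ [:: x; y])) (tau (s ++ [:: x; y])) => T1 T.
set tx := (P in P = 0 -> _); move=> Htx.
set ty := (P in P = 0 -> _); move=> Hty.
set j3 := (P in P == 0 -> _); move=> /eqP H3.
set j2 := (P in P == 0 -> _); move=> /eqP H2.
set j1 := (P in P == 0 -> _); move=> /eqP H1.
set r := (RHS).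
transitivity (r + C ^+ size s * (Ty * tx - Tx * ty - j2 + j3
   - ((size s)%:R * c + c1) * j1)).
  by rewrite /r /tx /ty /j1 /j2 /j3; ring.
by rewrite Htx Hty H1 H2 H3; ring.
Qed.
End TauIdentities.

Section RootEquations.
Variable K : comNzRingType.
Variables al b kap : K.
Implicit Types (s : seq (kind * nat)) (x : kind * nat).

Local Notation D := (euler kap).
Local Notation C := (cpoly kap).
Local Notation c := (cpoly' kap).
Local Notation c1 := (c1poly al b kap).
Local Notation om := (omega al b kap).
Local Notation E x := (energy al b kap x.1 x.2).
Local Notation eb := (ebar al b kap).
Local Notation tau := (tau al b kap).
Local Notation weight := (weight al b kap).

Lemma ebarE i : eb i =
  - (i%:R * (i%:R - 1) * kap%:P + i%:R * (b + kap * (al + 2))%:P).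
Proof.
rewrite /ebar; congr (- (_ * _ + _)); rewrite mulr_natr -mulrnA.
have -> : ('C(i, 2) * 2 = i * i.-1)%N by rewrite mulnC -(mul_bin_diag i 1) bin1.
by case: i => [|i]; rewrite ?mul0n ?mul0r // natrM /= -[i.+1%:R]natr1 addrK.
Qed.

(* The terms of the root equation that depend on the seeds only through their
   number [k] and total weight [w]; partners of one tau function share them. *)
Definition root_potential (k : {poly K}) (w : {poly K}) : {poly K} :=
  let sF := w + k * c in
  let st := w - (k - 1) * c in
  let Dc := - 2 * kap%:P * C in
  let e i := - (i * (i - 1) * kap%:P + i * (b + kap * (al + 2))%:P) in
  4 * ((- (D w + k * Dc) + sF ^+ 2 + c * sF - (k * c + c1) * sF - 2 * sF * w
        - D w + w ^+ 2 + c * w + ((k - 1) * c + c1) * w + e k * C)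
     + (- D w + w ^+ 2 + c * w - ((k - 1) * c + c1) * w - 2 * w * st
        - (D w - (k - 1) * Dc) + st ^+ 2 + c * st + ((k - 2) * c + c1) * st
        + e (k - 1) * C))
  - 2 * (k * c - c1) ^+ 2.

Lemma horner_lam (p q : {poly K}) S r : (p - 4 * q * S%:P).[r] = p.[r] - 4 * q.[r] * S.
Proof. by rewrite hornerD hornerN !hornerM hornerC -polyC_natr hornerC. Qed.

Lemma horner_quad (p q g : {poly K}) r :
  (4 * (p + q) - 2 * g ^+ 2).[r] = 4 * (p.[r] + q.[r]) - 2 * g.[r] ^+ 2.
Proof.
by rewrite hornerD hornerN !hornerM (hornerD p q) -(polyC_natr _ 4) -(polyC_natr _ 2) !hornerC.
Qed.

(** The conclusion of [ratio_at_root], with the energy sum [S] split off from the potential [lam]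
    because it is the only coefficient that varies with the partner. *)
Definition root_equation (T B lam : {poly K}) (S r : K) : Prop :=
  4 * (D T).[r] ^+ 2 * ((D (D B)).[r] * (D T).[r] - (D B).[r] * (D (D T)).[r]) =
  B.[r] * (D T).[r] * (2 * (D (D T)).[r] ^+ 2 + 4 * c.[r] * (D T).[r] * (D (D T)).[r]
     - 4 * (D T).[r] * (D (D (D T))).[r]
     - (lam.[r] - 4 * C.[r] * S) * (D T).[r] ^+ 2).

(** The two neighbours are [tau s], one column shorter than [T], and [tau (s ++ [:: x; y])], one
    column longer. Since [T] is the longer function in the first bilinear equation, its coefficient
    [ga] turns into [c - ga]. *)
Lemma root_equation_replace s x y r : (0 < size s)%N -> x.1 = y.1 ->
  let T := tau (s ++ [:: x]) in root T r ->
  root_equation T (tau (s ++ [:: y]))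
    (root_potential (size s).+1%:R (weight (s ++ [:: x]))) (E x + E y) r.
Proof.
move=> s0 xy T /rootP Tr.
have sx : (0 < size (s ++ [:: x]))%N by rewrite size_cat addn1.
have Ba := bilinear_rcons al b kap x s0.
have Bb := bilinear_rcons al b kap y sx.
have H := tau_replace al b kap s0 xy.
rewrite -catA /= in Bb.
set ga := - _ in Ba; set ra := (X in bilinear _ _ _ _ X) in Ba.
set gb := - _ in Bb; set rb := (X in bilinear _ _ _ _ X) in Bb.
rewrite -/T in Ba Bb H.
have Ba' : D (D (tau s)) * T - 2 * D (tau s) * D T + tau s * D (D T)
   + ((c - ga) - c) * D (tau s) * T - (c - ga) * tau s * D T + ra * tau s * T = 0.
  by rewrite -Ba; ring.
have H' : D (tau (s ++ [:: y])) * T - tau (s ++ [:: y]) * D T =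
   1 * (tau s * tau (s ++ [:: x; y])) by rewrite mul1r.
have gab : c - ga + gb = 0.
  by rewrite /ga /gb xy size_cat addn1 -[(size s).+1%:R]natr1; ring.
have D1 : D 1 = 0 by rewrite -polyC1 eulerC.
have := ratio_at_root (ev := horner_eval r) (eulerD kap) (eulerM kap)
  Ba' Bb gab D1 H' Tr.
rewrite /root_equation /horner_eval => ->; congr (_ * _ * (_ - _ * _)).
rewrite -horner_lam -horner_quad.
congr horner.
have ws := weight_rcons al b kap s x.
have wy : weight (s ++ [:: x; y]) = weight (s ++ [:: x]) + (size s).+1%:R * c - om y.1.
  by rewrite -cat1s catA weight_rcons size_cat addn1.
have w0 : weight s = weight (s ++ [:: x]) - (size s)%:R * c + om y.1 by rewrite ws xy; ring.
have Dw0 : D (weight s) = D (weight (s ++ [:: x])) - (size s)%:R * D c + D (om y.1).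
  by rewrite w0 eulerD eulerD eulerN (eulerM _ (size s)%:R) euler_nat mul0r add0r.
have Dwy : D (weight (s ++ [:: x; y])) =
    D (weight (s ++ [:: x])) + (size s).+1%:R * D c - D (om y.1).
  by rewrite wy eulerD eulerD eulerN (eulerM _ (size s).+1%:R) euler_nat mul0r add0r.
rewrite /root_potential /ra /rb /gb Dw0 Dwy wy w0 !ebarE size_cat addn1 -[(size s).+1%:R]natr1.
rewrite (polyCD (E x)) !euler_cpoly'.
move: (weight _) (D (weight _)) ((E x)%:P) ((E y)%:P) => w dw Ex Ey.
have [->|[->|->]] : y.1 = St \/ y.1 = TI \/ y.1 = TII.
- by case: (y.1); auto.
- rewrite /om -polyC0 eulerC polyC0; ring.
- rewrite /omega (eulerM _ b%:P) eulerC eulerX /cpoly' /c1poly /cpoly /zpoly.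
  rewrite !(polyCD, polyCM, polyCN, polyC_natr, polyC1, polyC0); ring.
- rewrite /omega (eulerM _ (- al%:P)) eulerN eulerC euler_zpoly.
  rewrite /cpoly' /c1poly /cpoly /zpoly.
  rewrite !(polyCD, polyCM, polyCN, polyC_natr, polyC1, polyC0); ring.
Qed.

(** Both neighbours are one column shorter than [T]. The power of [C] in [tau_remove] is attached to
    one of them, where it shifts the first order coefficient so that the two add up to 0. *)
Lemma root_equation_remove s x y r : (0 < size s)%N -> x.1 = TI -> y.1 = TII ->
  let T := tau (s ++ [:: x; y]) in root T r ->
  root_equation T (C ^+ size s * tau s)
    (root_potential (size s).+2%:R (weight (s ++ [:: x; y]))) (E x + E y) r.
Proof.
move=> s0 xI yII T /rootP Tr.
have sx : (0 < size (s ++ [:: x]))%N by rewrite size_cat addn1.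
have sy : (0 < size (s ++ [:: y]))%N by rewrite size_cat addn1.
have Ba := bilinear_rcons al b kap x sy.
have Bb := bilinear_rcons al b kap y sx.
have H := tau_remove al b kap s0 xI yII.
rewrite -!catA /= in Ba Bb.
set ga := - _ in Ba; set ra := (X in bilinear _ _ _ _ X) in Ba.
set gb := - _ in Bb; set rb := (X in bilinear _ _ _ _ X) in Bb.
rewrite -/T in Bb; rewrite /= -/T in H.
have [e Te] : exists e : bool, tau (s ++ [:: y; x]) = (-1) ^+ e * T.
  by apply: tau_perm; rewrite perm_cat2l (perm_catC [:: x] [:: y]).
have De z : D ((-1) ^+ e * z) = (-1) ^+ e * D z.
  by case: e {Te} => /=; rewrite ?expr0 ?expr1 ?mul1r ?mulN1r ?eulerN.
have Ba' : D (D (tau (s ++ [:: y]))) * T - 2 * D (tau (s ++ [:: y])) * D T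
   + tau (s ++ [:: y]) * D (D T)
   + ((c - ga) - c) * D (tau (s ++ [:: y])) * T - (c - ga) * tau (s ++ [:: y]) * D T
   + ra * tau (s ++ [:: y]) * T = 0.
  have e2 : (-1) ^+ e * (-1) ^+ e = 1 :> {poly K} by rewrite -expr2 sqrr_sign.
  move: Ba; rewrite /bilinear Te !De => Ba.
  by rewrite -[RHS](mulr0 ((-1) ^+ e)) -Ba; ring: e2.
pose m : {poly K} := (size s).+1%:R.
pose F := C ^+ (size s).+1 * tau (s ++ [:: y]).
have Dm : D m = 0 by rewrite euler_nat.
have DCn n : D (C ^+ n) = n%:R * c * C ^+ n.
  elim: n => [|n IH]; first by rewrite expr0 mul0r mul0r -polyC1 eulerC.
  by rewrite exprS (eulerM _ C) IH euler_cpoly -natr1; ring.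
have Bb' : D (D (tau (s ++ [:: x]))) * T - 2 * D (tau (s ++ [:: x])) * D T
   + tau (s ++ [:: x]) * D (D T)
   + ((c - gb) - c) * D (tau (s ++ [:: x])) * T - (c - gb) * tau (s ++ [:: x]) * D T
   + rb * tau (s ++ [:: x]) * T = 0.
  by rewrite -Bb; ring.
have DF : D F = m * c * F + C ^+ (size s).+1 * D (tau (s ++ [:: y])).
  by rewrite /F (eulerM _ (C ^+ _)) DCn -/m mulrA.
have DDF : D (D F) = m * D c * F + m * c * D F + m * c * C ^+ (size s).+1 * D (tau (s ++ [:: y]))
   + C ^+ (size s).+1 * D (D (tau (s ++ [:: y]))).
  rewrite DF eulerD (eulerM _ (m * c)) (eulerM _ m) Dm -DF (eulerM _ (C ^+ _)) DCn -/m.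
  by rewrite mul0r add0r !addrA.
pose g' := c - ga - 2 * m * c.
pose r' := ra + m ^+ 2 * c ^+ 2 - m * D c - (c - ga - c) * m * c.
have Ba2 : D (D F) * T - 2 * D F * D T + F * D (D T) + (g' - c) * D F * T
   - g' * F * D T + r' * F * T = 0.
  rewrite DDF DF /F -[RHS](mulr0 (C ^+ (size s).+1)) -Ba' /g' /r'; ring.
have oxy : om TI + om TII = c - c1.
  rewrite /omega /zpoly /cpoly' /c1poly.
  by rewrite !(polyCD, polyCM, polyCN, polyC_natr, polyC1, polyC0); ring.
have gab : g' + (c - gb) = 0.
  rewrite /g' /ga /gb xI yII /m !size_cat !addn1.
  rewrite (_ : om TI = c - c1 - om TII); last by rewrite -oxy addrK.
  ring.
have D1 : D (E x - E y)%:P = 0 by rewrite eulerC.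
have H' : D (C ^+ size s * tau s) * T - C ^+ size s * tau s * D T =
   (E x - E y)%:P * (F * tau (s ++ [:: x])).
  by rewrite H /F; ring.
have := ratio_at_root (ev := horner_eval r) (eulerD kap) (eulerM kap)
  Ba2 Bb' gab D1 H' Tr.
rewrite /root_equation /horner_eval => ->; congr (_ * _ * (_ - _ * _)).
set w := weight (s ++ [:: x; y]).
rewrite -horner_lam -horner_quad.
congr horner.
have n1 : (size s).+1%:R = (size s)%:R + 1 :> {poly K} by rewrite -natr1.
have n2 : (size s).+2%:R = (size s)%:R + 1 + 1 :> {poly K} by rewrite -n1 -natr1.
have wy : w = weight (s ++ [:: x]) + (size s).+1%:R * c - om TII.
  by rewrite /w -cat1s catA weight_rcons size_cat addn1 yII.
have wx : w = weight (s ++ [:: y]) + (size s).+1%:R * c - om TI.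
  rewrite wy !weight_rcons xI yII; ring.
have wyx : weight (s ++ [:: y; x]) = w.
  by rewrite -cat1s catA weight_rcons size_cat addn1 wx xI.
have w1 : weight (s ++ [:: x]) = w - (size s).+1%:R * c + om TII by rewrite wy; ring.
have w2 : weight (s ++ [:: y]) = w - (size s).+1%:R * c + om TI by rewrite wx; ring.
have Dw1 : D (weight (s ++ [:: x])) = D w - (size s).+1%:R * D c + D (om TII).
  by rewrite w1 eulerD eulerD eulerN (eulerM _ (size s).+1%:R) euler_nat mul0r add0r.
have Dw2 : D (weight (s ++ [:: y])) = D w - (size s).+1%:R * D c + D (om TI).
  by rewrite w2 eulerD eulerD eulerN (eulerM _ (size s).+1%:R) euler_nat mul0r add0r.
rewrite /root_potential /r' /ra /rb /ga /gb wyx -/w Dw1 Dw2 w1 w2 !ebarE !size_cat !addn1 /m n1 n2.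
rewrite (polyCD (E x)) !euler_cpoly' xI yII.
move: w {wy wx wyx w1 w2 Dw1 Dw2} (D w) ((E x)%:P) ((E y)%:P) => w dw Ex Ey.
rewrite /omega (eulerM _ b%:P) eulerC eulerX (eulerM _ (- al%:P)) eulerN eulerC euler_zpoly.
rewrite /cpoly' /c1poly /cpoly /zpoly.
rewrite !(polyCD, polyCM, polyCN, polyC_natr, polyC1, polyC0); ring.
Qed.
End RootEquations.

(** * Orthogonality of residues *)

Section Residues.
Variable K : comUnitRingType.

Lemma deriv_cpoly (kap : K) : (cpoly kap)^`() = cpoly' kap.
Proof.
rewrite /cpoly /zpoly /cpoly' derivM derivB derivM derivX derivC -polyC1 derivC.
by rewrite polyCM polyC_natr; ring.
Qed.

(** The trivial factor [f] and the passage from the derivation [euler] to d/dy contribute only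
    multiples of [Q.[r]]: the terms in Q' cancel in Q'' P' - Q' P'' at a zero of [P]. All these
    multiples form [kk], which is common to all partners. *)
Lemma root_transfer (kap : K) (f P lam : {poly K}) (r : K) :
  P.[r] = 0 -> f.[r] \is a GRing.unit -> P^`().[r] \is a GRing.unit ->
  (cpoly kap).[r] \is a GRing.unit -> (2 : K) \is a GRing.unit ->
  exists kk : K, forall Q S, root_equation kap (f * P) (f * Q) lam S r ->
  Q^`()^`().[r] * P^`().[r] - Q^`().[r] * P^`()^`().[r] =
  Q.[r] * (kk + S * (P^`().[r] / (cpoly kap).[r])).
Proof.
rewrite /root_equation /euler.
move: (cpoly kap) (cpoly' kap) (deriv_cpoly kap) => C c dC Pr uf uP uC u2.
pose t1 := (C * (f * P)^`()).[r].
pose t2 := (C * (C * (f * P)^`())^`()).[r].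
pose t3 := (C * (C * (C * (f * P)^`())^`())^`()).[r].
pose U := 2 * t2 ^+ 2 + 4 * c.[r] * t1 * t2 - 4 * t1 * t3 - lam.[r] * t1 ^+ 2.
pose f0 := f.[r]; pose f1 := f^`().[r]; pose f2 := f^`()^`().[r].
pose C0 := C.[r]; pose P1 := P^`().[r]; pose P2 := P^`()^`().[r].
pose u := 4 * f0 ^+ 4 * C0 ^+ 5 * P1 ^+ 2.
have uu : u \is a GRing.unit.
  have u4 : (4 : K) \is a GRing.unit.
    by rewrite (_ : 4 = 2 * 2 :> K) ?unitrM ?u2 // -natrM.
  by rewrite unitrM unitrM unitrM u4 (unitrX 4 uf) (unitrX 5 uC) (unitrX 2 uP).
have eu : u = 4 * f0 ^+ 4 * C0 ^+ 5 * P1 ^+ 2 by [].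
clearbody u.
(* The coefficient of [Q.[r]] that the factor [f] adds to Q'' P' - Q' P''. *)
pose h := f0 * f2 * P1 - 2 * f1 ^+ 2 * P1 - f0 * f1 * P2.
exists ((f0 * t1 * U - 4 * t1 ^+ 2 * C0 ^+ 3 * h) / u) => Q S.
rewrite -/t1 -/t2 -/t3 (hornerM f) => H.
have e1 : t1 = C0 * (f0 * P1).
  by rewrite /t1 derivM hornerM hornerD !hornerM Pr mulr0 add0r.
have e2 : t2 = C0 * (c.[r] * (f0 * P1) + C0 * (2 * f1 * P1 + f0 * P2)).
  rewrite /t2 !(derivM, derivD) dC !(hornerM, hornerD) Pr /C0 /f1 /f0 /P1 /P2; ring.
have b1 : (C * (f * Q)^`()).[r] = C0 * (f1 * Q.[r] + f0 * Q^`().[r]).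
  by rewrite derivM !(hornerM, hornerD).
have b2 : (C * (C * (f * Q)^`())^`()).[r] = C0 * (c.[r] * (f1 * Q.[r] + f0 * Q^`().[r])
    + C0 * (f2 * Q.[r] + 2 * f1 * Q^`().[r] + f0 * Q^`()^`().[r])).
  rewrite !(derivM, derivD) dC !(hornerM, hornerD) /C0 /f2 /f1 /f0; ring.
rewrite b1 b2 -/f0 -/C0 in H; rewrite -/P1 -/P2 -/C0.
apply: (mulrI uu).
have -> : u * (Q.[r] * ((f0 * t1 * U - 4 * t1 ^+ 2 * C0 ^+ 3 * h) / u + S * (P1 / C0))) =
   Q.[r] * ((f0 * t1 * U - 4 * t1 ^+ 2 * C0 ^+ 3 * h) * (u / u)
     + S * P1 * (4 * f0 ^+ 4 * C0 ^+ 4 * P1 ^+ 2) * (C0 / C0)).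
  by ring: eu.
rewrite !divrr // !mulr1.
move: H; set R := (X in _ = X) => H.
transitivity (R - 4 * t1 ^+ 2 * C0 ^+ 3 * h * Q.[r]); last first.
  by rewrite /R -/U /U e1; ring.
rewrite -H /h e2 e1 eu; ring.
Qed.

Variable n : nat.
Implicit Types (eta a w : 'I_n -> K).

(** Over the dual numbers distinct points may differ by a nilpotent, which interpolation does not
    allow. *)
Definition unit_gaps eta := forall l k, l != k -> eta l - eta k \is a GRing.unit.

Lemma uniq_roots_gaps eta : unit_gaps eta -> uniq_roots [seq eta l | l <- enum 'I_n].
Proof.
move=> g; elim: (enum 'I_n) (enum_uniq 'I_n) => // l r IH /= /andP[lr ur].
rewrite IH // andbT; apply/allP => _ /mapP[k kr ->].
rewrite /diff_roots mulrC eqxx /=; apply: g.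
by apply: contraNneq lr => <-.
Qed.

Definition prodX eta (P : pred 'I_n) : {poly K} := \prod_(l | P l) ('X - (eta l)%:P).

Lemma size_prodX eta (P : pred 'I_n) : size (prodX eta P) = #|P|.+1.
Proof.
by rewrite /prodX -big_filter size_prod_XsubC -sum1_size big_filter sum1_card.
Qed.

Lemma prodXD1 eta (P : pred 'I_n) l : P l ->
  prodX eta P = ('X - (eta l)%:P) * prodX eta (fun k => P k && (k != l)).
Proof. by move=> Pl; rewrite /prodX (bigD1 l). Qed.

Lemma unit_prodX eta (P : pred 'I_n) l : unit_gaps eta ->
  (forall k, P k -> k != l) -> (prodX eta P).[eta l] \is a GRing.unit.
Proof.
move=> g Pl; rewrite /prodX horner_prod.
apply: (big_ind (fun x => x \is a GRing.unit)); [exact: unitr1| |].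
  by move=> x y ux uy; rewrite unitrM ux.
by move=> k Pk; rewrite hornerXsubC; apply: g; rewrite eq_sym Pl.
Qed.

Lemma prodX_root eta (P : pred 'I_n) l : P l -> (prodX eta P).[eta l] = 0.
Proof. by move=> Pl; rewrite (prodXD1 _ Pl) hornerM hornerXsubC subrr mul0r. Qed.

Lemma lagrange eta (A : {poly K}) : unit_gaps eta -> (size A <= n)%N ->
  A = \sum_l (A.[eta l] / (prodX eta (predC1 l)).[eta l])%:P * prodX eta (predC1 l).
Proof.
move=> g sA; apply/eqP; rewrite -subr_eq0; apply/eqP.
set Z := _ - _; apply/eqP; apply/negPn/negP => Z0.
have rZ : all (root Z) [seq eta l | l <- enum 'I_n].
  apply/allP => _ /mapP[l _ ->]; apply/rootP.
  rewrite /Z hornerD hornerN horner_sum (bigD1 l) //= big1 ?addr0.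
    by rewrite hornerM hornerC divrK ?subrr // unit_prodX.
  move=> k kl; rewrite hornerM (@prodX_root eta _ l) ?mulr0 //=.
  by rewrite eq_sym.
have := max_ring_poly_roots Z0 rZ (uniq_roots_gaps g).
rewrite size_map size_enum_ord ltnNge => /negP; apply.
apply: leq_trans (size_polyD _ _) _; rewrite geq_max sA size_polyN.
apply: leq_trans (size_sum _ _ _) _; apply/bigmax_leqP => l _.
apply: leq_trans (size_polyMleq _ _) _; rewrite size_prodX.
apply: leq_trans (_ : 1 + #|predC1 l|.+1 .-1 <= _)%N.
  case: (size _) (size_polyC_leq1 (A.[eta l] / (prodX eta (predC1 l)).[eta l])) => [|[]] //.
rewrite /= add1n -[X in (_ <= X)%N](card_ord n) (cardC1 l) prednK // card_ord.
by rewrite (leq_ltn_trans _ (ltn_ord l)).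
Qed.

Lemma derivCmul (x : K) (p : {poly K}) : (x%:P * p)^`() = x%:P * p^`().
Proof. by rewrite derivM derivC mul0r add0r. Qed.

Lemma deriv_prodX_root eta lc l :
  (lc%:P * prodX eta predT)^`().[eta l] = lc * (prodX eta (predC1 l)).[eta l].
Proof.
rewrite (prodXD1 _ (l := l)) // derivCmul derivM derivXsubC mul1r.
by rewrite !(hornerXsubC, hornerM, hornerD, hornerC) subrr mul0r addr0.
Qed.

(* The equation expresses that the residues [a k] of [A / P] form an
   eigenvector of a matrix that depends on [P] only. *)
Lemma residue_eigenvector eta (lc : K) (P : {poly K}) l (kk C : K) :
  unit_gaps eta -> lc \is a GRing.unit -> P = lc%:P * prodX eta predT ->
  C \is a GRing.unit -> exists q : K, forall (A : {poly K}) (S : K),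
  (size A <= n)%N ->
  A^`()^`().[eta l] * P^`().[eta l] - A^`().[eta l] * P^`()^`().[eta l] =
    A.[eta l] * (kk + S * (P^`().[eta l] / C)) ->
  let a k := A.[eta k] / P^`().[eta k] in
  a l * (q + S / C) = - 2 * \sum_(k | k != l) a k * (eta l - eta k)^-1 ^+ 2.
Proof.
move=> g ulc eP uC.
pose Pl := prodX eta (predC1 l).
pose p0 := Pl.[eta l]; pose p1 := Pl^`().[eta l]; pose p2 := Pl^`()^`().[eta l].
have up : p0 \is a GRing.unit by apply: unit_prodX.
have ePl : P = lc%:P * (('X - (eta l)%:P) * Pl) by rewrite eP (prodXD1 _ (l := l)).
have P1 : P^`().[eta l] = lc * p0 by rewrite eP deriv_prodX_root.
have d1 : (1 : {poly K})^`() = 0 by rewrite -polyC1 derivC.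
have P2 : P^`()^`().[eta l] = 2 * lc * p1.
  rewrite ePl !(derivXsubC, d1, mul0r, add0r, mul1r, derivCmul, derivD, derivM).
  rewrite !(hornerXsubC, hornerM, hornerD, hornerC) subrr /p1; ring.
exists ((kk - lc * p2) / (lc * p0) + 2 * p1 ^+ 2 / p0 ^+ 2) => A S sA H a.
have al : a l * (lc * p0) = A.[eta l] by rewrite /a P1 divrK // unitrM ulc.
pose Plk k := prodX eta (fun j => predC1 l j && (j != k)).
have ePk k : k != l -> prodX eta (predC1 k) = ('X - (eta l)%:P) * Plk k.
  move=> kl; rewrite (prodXD1 _ (l := l)) /=; last by rewrite eq_sym.
  by congr (_ * _); apply: eq_bigl => j; rewrite /= andbC.
have ePlk k : k != l -> Pl = ('X - (eta k)%:P) * Plk k.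
  by move=> kl; rewrite /Pl (prodXD1 _ (l := k)).
(* [G / Pl] is the part of [A / P] that is regular at [eta l]; below, [W] computes its derivative
   there, times [p0 ^+ 2]. *)
pose G := \sum_(k | k != l) (a k)%:P * Plk k.
have eA : A = lc%:P * ((a l)%:P * Pl + ('X - (eta l)%:P) * G).
  rewrite [LHS](lagrange g sA) (bigD1 l) //= mulrDr; congr (_ + _).
    rewrite mulrA -polyCM /a P1 -/Pl -/p0; congr (_%:P * _).
    by rewrite invrM // [RHS]mulrC -!mulrA mulVr // mulr1.
  rewrite /G !mulr_sumr; apply: eq_bigr => k kl.
  rewrite [X in _ = _ * X]mulrCA -ePk // mulrA -polyCM; congr (_%:P * _).
  by rewrite /a eP deriv_prodX_root invrM ?unit_prodX // [RHS]mulrC -!mulrA mulVr // mulr1.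
have A1 : A^`().[eta l] = lc * (a l * p1 + G.[eta l]).
  rewrite eA !(derivXsubC, d1, mul0r, add0r, mul1r, derivCmul, derivD, derivM).
  by rewrite !(hornerXsubC, hornerM, hornerD, hornerC) subrr /p1; ring.
have A2 : A^`()^`().[eta l] = lc * (a l * p2 + 2 * G^`().[eta l]).
  rewrite eA !(derivXsubC, d1, mul0r, add0r, mul1r, derivCmul, derivD, derivM).
  by rewrite !(hornerXsubC, hornerM, hornerD, hornerC) subrr /p2; ring.
have W : G^`().[eta l] * p0 - G.[eta l] * p1 =
    - (p0 ^+ 2 * \sum_(k | k != l) a k * (eta l - eta k)^-1 ^+ 2).
  rewrite /G raddf_sum /= !horner_sum !mulr_suml mulr_sumr -sumrB -sumrN.
  apply: eq_bigr => k kl; rewrite derivCmul !(hornerM, hornerC).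
  have d0 : p0 = (eta l - eta k) * (Plk k).[eta l].
    by rewrite /p0 (ePlk k kl) hornerM hornerXsubC.
  have e1 : p1 = (Plk k).[eta l] + (eta l - eta k) * (Plk k)^`().[eta l].
    rewrite /p1 (ePlk k kl) derivM derivXsubC !(hornerXsubC, hornerM, hornerD, hornerC).
    by rewrite mul1r.
  have ud : eta l - eta k \is a GRing.unit by apply: g; rewrite eq_sym.
  have e2 : (Plk k).[eta l] = p0 * (eta l - eta k)^-1 by rewrite d0 mulrC mulKr.
  rewrite e2 in e1 *; rewrite e1; set d := eta l - eta k in ud *; set v := d^-1.
  transitivity (a k * (Plk k)^`().[eta l] * p0 * (1 - d * v) - a k * p0 ^+ 2 * v ^+ 2).
    by ring.
  by rewrite /v mulrV // subrr mulr0 add0r; ring.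
have u2 : lc ^+ 2 * p0 ^+ 2 \is a GRing.unit.
  by rewrite unitrM (unitrX 2 ulc) (unitrX 2 up).
apply: (mulrI u2).
move: H; rewrite A1 A2 P1 P2 -al => H.
set s := \sum_(k | _) _ in W *.
have W' : p0 ^+ 2 * s = G.[eta l] * p1 - G^`().[eta l] * p0 by rewrite -opprB W opprK.
transitivity (- 2 * lc ^+ 2 * (p0 ^+ 2 * s)); last by ring.
rewrite W'.
transitivity (a l * (lc * p0) * (kk + S * (lc * p0 / C))
   - a l * lc ^+ 2 * (p0 * p2 - 2 * p1 ^+ 2)); last by rewrite -H; ring.
rewrite invrM //.
transitivity (a l * lc * p0 * kk * (lc / lc) * (p0 / p0)
   - a l * lc ^+ 2 * p0 * p2 * (lc / lc) * (p0 / p0)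
   + 2 * a l * lc ^+ 2 * p1 ^+ 2 * (p0 / p0) ^+ 2 + a l * lc ^+ 2 * p0 ^+ 2 * S / C).
  by rewrite -exprVn; ring.
by rewrite !divrr //; ring.
Qed.

(** Pair each eigenvector equation with the residues of the other numerator and subtract: the
    diagonal terms and, by symmetry of the inverse squares, the double sums cancel. The factor
    [S - S'] is kept, since over the dual numbers it may be a nonzero nilpotent. *)
Lemma residue_orthogonality eta (lc : K) (P A B : {poly K}) (kk C : 'I_n -> K) (S S' : K) :
  unit_gaps eta -> lc \is a GRing.unit -> P = lc%:P * prodX eta predT ->
  (forall l, C l \is a GRing.unit) -> (size A <= n)%N -> (size B <= n)%N ->
  (forall l, A^`()^`().[eta l] * P^`().[eta l] - A^`().[eta l] * P^`()^`().[eta l] =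
    A.[eta l] * (kk l + S * (P^`().[eta l] / C l))) ->
  (forall l, B^`()^`().[eta l] * P^`().[eta l] - B^`().[eta l] * P^`()^`().[eta l] =
    B.[eta l] * (kk l + S' * (P^`().[eta l] / C l))) ->
  (S - S') * (\sum_l A.[eta l] * B.[eta l] / (C l * P^`().[eta l] ^+ 2)) = 0.
Proof.
move=> g ulc eP uC sA sB HA HB.
pose a k := A.[eta k] / P^`().[eta k]; pose b k := B.[eta k] / P^`().[eta k].
have uP l : P^`().[eta l] \is a GRing.unit.
  by rewrite eP deriv_prodX_root unitrM ulc unit_prodX.
transitivity (\sum_l (b l * (- 2 * \sum_(k | k != l) a k * (eta l - eta k)^-1 ^+ 2)
   - a l * (- 2 * \sum_(k | k != l) b k * (eta l - eta k)^-1 ^+ 2))).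
  rewrite mulr_sumr; apply: eq_bigr => l _.
  have [q Q] := residue_eigenvector l (kk l) g ulc eP (uC l).
  rewrite -(Q A S sA (HA l)) -(Q B S' sB (HB l)) -/(a _) -/(b _).
  rewrite invrM ?unitrX // -exprVn /a /b; ring.
rewrite sumrB.
have -> : \sum_l b l * (- 2 * \sum_(k | k != l) a k * (eta l - eta k)^-1 ^+ 2) =
   \sum_l \sum_(k | k != l) - 2 * (b l * a k * (eta l - eta k)^-1 ^+ 2).
  apply: eq_bigr => l _; rewrite !mulr_sumr; apply: eq_bigr => k _; ring.
rewrite (exchange_big_dep predT) //= -sumrB big1 // => l _.
apply/eqP; rewrite subr_eq0; apply/eqP; rewrite !mulr_sumr.
apply: eq_big => [k|k kl]; first by rewrite eq_sym.
rewrite -[in LHS]opprB invrN; ring.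
Qed.
End Residues.

(** * Trivial factors and degree *)

Lemma uniq_sumn_ge (s : seq nat) : uniq s -> ('C(size s, 2) <= sumn s)%N.
Proof.
have [n] := ubnP (size s); elim: n s => // n IH s sn us.
case: (posnP (size s)) => [->|s0] //.
have /hasP[x xs xge] : has (leq (size s).-1) s.
  apply/negPn/negP => /hasPn h.
  have : (size s <= size (iota 0 (size s).-1))%N.
    apply: uniq_leq_size => // x xs.
    by rewrite mem_iota add0n /= ltnNge h.
  by rewrite size_iota; case: (size s) s0 => // m _; rewrite ltnn.
have -> : sumn s = (x + sumn (rem x s))%N.
  by rewrite (perm_sumn (perm_to_rem xs)).
have sr : size (rem x s) = (size s).-1 by apply: size_rem.
have := IH (rem x s); rewrite sr rem_uniq // => /(_ _ isT).
case: (size s) s0 sn xge => // m _; rewrite !ltnS /= => mn xge /(_ mn) H.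
by rewrite binS bin1 addnC leq_add.
Qed.

Lemma inj_in_sum_ge (I : finType) (J : {pred I}) (g : I -> nat) :
  {in J &, injective g} -> ('C(#|J|, 2) <= \sum_(j in J) g j)%N.
Proof.
move=> gi; have u : uniq [seq g j | j <- enum J].
  by rewrite map_inj_in_uniq ?enum_uniq // => x y; rewrite !mem_enum; apply: gi.
have := uniq_sumn_ge u; rewrite size_map -cardE sumnE big_map.
by rewrite big_enum.
Qed.

Section Polynomiality.
Variable K : comNzRingType.
Variables al b kap : K.

Local Notation c := (cpoly' kap).
Local Notation z := (zpoly kap).
Local Notation D := (euler kap).

Definition shift_coef (k : kind) (i l : nat) : K :=
  match k with
  | St => (i%:R - l%:R) * kap
  | TI => b + (i%:R - l%:R) * kap
  | TII => l%:R - i%:R - al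
  end.

(** Differentiating a gauge factor produces poles at only one of the zeros of ['X] and [z]. After
    multiplication by the power i of [cpoly], the factor without poles keeps the exponent i, while
    the other keeps the order l of the derivative of the polynomial, as recorded in [mono]. *)
Fixpoint gcoef (k : kind) (i l : nat) : K :=
  if i is i'.+1 then
    shift_coef k i' l * gcoef k i' l + (if l is l'.+1 then gcoef k i' l' else 0)
  else (l == 0%N)%:R.

Definition mono (k : kind) (i l : nat) : {poly K} :=
  match k with TII => z ^+ i * 'X^l | _ => 'X^i * z ^+ l end.

Lemma gcoef_small k i l : (i < l)%N -> gcoef k i l = 0.
Proof.
elim: i l => [|i IH] [|l] //= h.
by rewrite !IH ?mulr0 ?add0r // ltnW.
Qed.

Lemma gcoef_St i l : gcoef St i l = (l == i)%:R.
Proof.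
elim: i l => [|i IH] l //=; rewrite IH.
have -> : (i%:R - l%:R) * kap * (l == i)%:R = 0.
  by case: eqP => [->|_]; rewrite ?mulr0 // subrr !mul0r.
by rewrite add0r; case: l => // l; rewrite IH eqSS.
Qed.

Lemma euler_exp (p u : {poly K}) n : D p = u * p -> D (p ^+ n) = n%:R * u * p ^+ n.
Proof.
move=> Dp; elim: n => [|n IH]; first by rewrite expr0 !mul0r -polyC1 eulerC.
by rewrite exprS (eulerM _ p) IH Dp -[n.+1%:R]natr1; ring.
Qed.

Lemma mono_shift k i l p :
  D (mono k i l * p) + (omega al b kap k - i%:R * c) * (mono k i l * p) =
  (shift_coef k i l)%:P * mono k i.+1 l * p + mono k i.+1 l.+1 * p^`().
Proof.
have DX n : D 'X^n = n%:R * z * 'X^n.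
  by apply: euler_exp; rewrite eulerX /cpoly mulrC.
have Dz n : D (z ^+ n) = n%:R * (- kap%:P * 'X) * z ^+ n.
  by apply: euler_exp; rewrite euler_zpoly /cpoly; ring.
have Dp q : D q = 'X * z * q^`() by [].
have ez : z = 1 - kap%:P * 'X by [].
have ec : c = 1 - 2 * kap%:P * 'X by rewrite /cpoly' polyCM polyC_natr.
case: k; rewrite /mono /omega /shift_coef (eulerM _ (_ * _)) (eulerM _ (_ ^+ i)) DX Dz (Dp p);
  rewrite !exprS ec !(polyCD, polyCM, polyCN, polyC_natr).
- move: ('X^i) (z ^+ l) => u v; rewrite ez; ring.
- move: ('X^i) (z ^+ l) => u v; rewrite ez; ring.
- move: ('X^l) (z ^+ i) => u v; rewrite ez; ring.
Qed.

Lemma col_expand k p N i : (i < N)%N ->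
  col al b kap k p i = \sum_(l < N) (gcoef k i l)%:P * (mono k i l * p^`(l)).
Proof.
elim: i => [|i IH] iN /=.
  case: N iN => // N _; rewrite big_ord_recl big1 ?addr0 /=.
    by case: k; rewrite /mono !expr0 !mul1r.
  by move=> l _; rewrite mul0r.
rewrite (IH (ltnW iN)).
rewrite (big_morph D (eulerD kap) (_ : D 0 = 0)); last by rewrite -polyC0 eulerC.
rewrite mulr_sumr -big_split /=.
transitivity (\sum_(l < N) (gcoef k i l * shift_coef k i l)%:P * (mono k i.+1 l * p^`(l))
   + \sum_(l < N) (gcoef k i l)%:P * (mono k i.+1 l.+1 * p^`(l.+1))).
  rewrite -big_split /=; apply: eq_bigr => l _.
  rewrite (eulerM _ (gcoef k i l)%:P) eulerC mul0r add0r [X in _ + X]mulrCA -mulrDr mono_shift.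
  by rewrite polyCM; ring.
case: N iN IH => // N iN _.
rewrite [X in _ + X]big_ord_recr /= gcoef_small // mul0r addr0.
rewrite [RHS](_ : _ = \sum_(l < N.+1) ((gcoef k i l * shift_coef k i l)%:P
    + (if l : nat is l'.+1 then gcoef k i l' else 0)%:P) * (mono k i.+1 l * p^`(l))); last first.
  by apply: eq_bigr => l _; rewrite -polyCD [_ * shift_coef _ _ _]mulrC.
under [RHS]eq_bigr do rewrite mulrDl.
rewrite big_split /=; congr (_ + _).
rewrite [RHS]big_ord_recl /= mul0r add0r.
by apply: eq_bigr => l _.
Qed.

Lemma size_basepoly k n : (size (basepoly al b kap k n) <= n.+1)%N.
Proof. by case: k; apply: size_poly. Qed.

Lemma size_zpoly : (size z <= 2)%N.
Proof.
rewrite (leq_trans (size_polyD _ _)) // size_polyN geq_max size_poly1 /=.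
apply: leq_trans (size_polyMleq _ _) _; rewrite size_polyX addn2 /=.
exact: size_polyC_leq1.
Qed.

Lemma size_polyM_le (p q : {poly K}) m n :
  (size p <= m.+1)%N -> (size q <= n.+1)%N -> (size (p * q)%R <= (m + n).+1)%N.
Proof. by move=> sp sq; apply: leq_trans (size_polyMleq _ _) _; lia. Qed.

Lemma size_exp_le (p : {poly K}) n : (size p <= 2)%N -> (size (p ^+ n)%R <= n.+1)%N.
Proof.
move=> sp; elim: n => [|n IH]; first by rewrite expr0 size_poly1.
by rewrite exprS; apply: (@size_polyM_le p (p ^+ n) 1 n).
Qed.

Lemma size_prod_le (I : finType) (F : I -> {poly K}) (d : I -> nat) :
  (forall i, size (F i) <= (d i).+1)%N -> (size (\prod_i F i)%R <= (\sum_i d i).+1)%N.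
Proof.
move=> sF; elim/big_rec2: _ => [|i m p _ IH]; first by rewrite size_poly1.
exact: size_polyM_le.
Qed.

Lemma monoE k i l :
  mono k i l = 'X^(if k == TII then l else i) * z ^+ (if k == TII then i else l).
Proof. by case: k; rewrite // /mono mulrC. Qed.

Definition kcount (k : kind) (cs : seq (kind * nat)) : nat :=
  count (fun x => x.1 == k) cs.

(** A type II column contributes its order of differentiation to the exponent of ['X], every other
    column its row number. In each of the two groups these numbers are distinct, so k of them sum to
    at least 'C(k, 2). For [expZ] type I plays this part. *)
Definition expX (cs : seq (kind * nat)) : nat :=
  let m := kcount TII cs in
  ('C(size cs - m, 2) + 'C(m, 2))%N.

Definition expZ (cs : seq (kind * nat)) : nat :=
  let m := kcount TI cs in
  ('C(size cs - m, 2) + 'C(m, 2))%N.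

(** Bounds by [m] the degree left after removal of the trivial factors, written additively to avoid
    truncated subtraction. *)
Definition excess_le (m : nat) (cs : seq (kind * nat)) : bool :=
  (\sum_(x <- cs) x.2 + 'C(size cs, 2) <= m + expX cs + expZ cs)%N.

Lemma card_count_nth (cs : seq (kind * nat)) (a : pred (kind * nat)) :
  #|[pred j : 'I_(size cs) | a (nth (St, 0%N) cs j)]| = count a cs.
Proof.
rewrite -sum1_card -sum1_count (big_nth (St, 0%N)) big_mkord.
by apply: eq_bigl => j.
Qed.

Lemma tau_factor (cs : seq (kind * nat)) :
  exists2 P : {poly K}, tau al b kap cs = 'X^(expX cs) * z ^+ (expZ cs) * P &
  forall m, excess_le m cs -> (size P <= m.+1)%N.
Proof.
(* Expanding the columns, a product survives only if the derivative orders
   within each kind are distinct, which bounds its exponents from below. *)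
pose N := size cs; pose kd (j : 'I_N) := (nth (St, 0%N) cs j).1.
pose d (j : 'I_N) := (nth (St, 0%N) cs j).2.
pose p j := basepoly al b kap (kd j) (d j).
pose good (t : {poly K}) := exists2 P : {poly K}, t = 'X^(expX cs) * z ^+ (expZ cs) * P &
  forall m, excess_le m cs -> (size P <= m.+1)%N.
have good0 : good 0 by exists 0; rewrite ?mulr0 // => m _; rewrite size_poly0.
have goodD t u : good t -> good u -> good (t + u).
  move=> [P -> hP] [Q -> hQ]; exists (P + Q); first by rewrite mulrDr.
  move=> m hm; apply: leq_trans (size_polyD _ _) _.
  by rewrite geq_max hP // hQ.
rewrite -/(good _).
have -> : tau al b kap cs = \sum_(f : {ffun 'I_N -> 'I_N}) \sum_(s : 'S_N)
    (-1) ^+ s * \prod_(j < N) ((gcoef (kd j) (s j) (f j))%:P *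
       (mono (kd j) (s j) (f j) * (p j)^`(f j))).
  rewrite /tau /cdet -det_tr /determinant exchange_big /=.
  apply: eq_bigr => s _; rewrite -mulr_sumr; congr (_ * _).
  rewrite -(bigA_distr_bigA (fun j l : 'I_N => (gcoef (kd j) (s j) l)%:P *
       (mono (kd j) (s j) l * (p j)^`(l)))) /=.
  by apply: eq_bigr => j _; rewrite !mxE nth_cols // (col_expand _ _ (ltn_ord (s j))).
apply: (big_ind good) => // f _.
case: (boolP [forall i, forall j, (i != j) && (kd i == kd j) ==> (f i != f j)]); last first.
  rewrite negb_forall => /existsP[k]; rewrite negb_forall => /existsP[j].
  rewrite negb_imply negbK => /andP[/andP[ij /eqP kij] /eqP fij].
  rewrite (_ : (\sum_s _) = 0) //.
  (* For a fixed [f] the derivatives come out of the sum over permutations; equal orders within one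
     kind leave a determinant with two equal rows. *)
  transitivity ((\prod_(j < N) (p j)^`(f j)) * \det (\matrix_(j < N, r < N)
     ((gcoef (kd j) r (f j))%:P * mono (kd j) r (f j)))).
    rewrite /determinant mulr_sumr; apply: eq_bigr => s _.
    rewrite mulrCA; congr (_ * _); rewrite -big_split /=.
    by apply: eq_bigr => r _; rewrite mxE; ring.
  rewrite (determinant_alternate ij) ?mulr0 // => r.
  by rewrite !mxE kij fij.
move=> /forallP inj; apply: (big_ind good) => // s _.
have finj k : {in [pred j | kd j == k] &, injective (fun j => f j : nat)}.
  move=> i j; rewrite !inE => /eqP ki /eqP kj /val_inj fij; apply/eqP.
  apply: contraT => ij; have /forallP/(_ j) := inj i.
  by rewrite ij ki kj eqxx fij eqxx.
have sinj (J : {pred 'I_N}) : {in J &, injective (fun j => s j : nat)}.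
  by move=> i j _ _ /val_inj/perm_inj.
case: (boolP [forall j, (kd j == St) ==> (f j == s j)]); last first.
  rewrite negb_forall => /existsP[j]; rewrite negb_imply => /andP[/eqP kj /negbTE fs].
  rewrite (bigD1 j) //= kj gcoef_St -(inj_eq val_inj) in fs *.
  by rewrite fs !mul0r mulr0.
move=> /forallP fSt.
case: (boolP [forall j, f j <= d j]%N); last first.
  rewrite negb_forall => /existsP[j]; rewrite -ltnNge => dj.
  rewrite (bigD1 j) //= (_ : (p j)^`(f j) = 0) ?mulr0 ?mul0r ?mulr0 //.
  apply/eqP; rewrite -size_poly_eq0 -leqn0.
  apply: leq_trans (_ : size (p j) - f j <= 0)%N; last first.
    by rewrite leqn0 subn_eq0 (leq_trans (size_basepoly _ _)).
  elim: (f j : nat) (p j) => [|n IH] q; first by rewrite subn0.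
  rewrite derivSn; apply: leq_trans (IH _) _.
  by apply: leq_trans (leq_sub2r _ (size_poly _ _)) _; lia.
move=> /forallP fd.
pose ex := (\sum_(j < N) if kd j == TII then f j : nat else s j)%N.
pose ez := (\sum_(j < N) if kd j == TII then s j : nat else f j)%N.
have split_ge (k : kind) (g h : 'I_N -> nat) :
    {in [pred j | kd j == k] &, injective g} ->
    {in [predC [pred j | kd j == k]] &, injective h} ->
    ('C(size cs - kcount k cs, 2) + 'C(kcount k cs, 2)
     <= \sum_(j < N) if kd j == k then g j else h j)%N.
  move=> gi hi; have cJ : #|[pred j | kd j == k]| = kcount k cs.
    exact: (card_count_nth cs (fun x => x.1 == k)).
  have cJ' : #|[predC [pred j | kd j == k]]| = (size cs - kcount k cs)%N.
    by rewrite -cJ -[X in (X - _)%N](card_ord N) -(cardC [pred j | kd j == k]) addKn.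
  rewrite -cJ' -cJ addnC (bigID [pred j | kd j == k]) /=; apply: leq_add.
    apply: leq_trans (inj_in_sum_ge gi) _.
    rewrite leq_eqVlt; apply/orP; left; apply/eqP; apply: eq_bigr => j jk.
    by rewrite (_ : (kd j == k) = true).
  apply: leq_trans (inj_in_sum_ge hi) _.
  rewrite leq_eqVlt; apply/orP; left; apply/eqP; apply: eq_bigr => j jk.
  by rewrite (_ : (kd j == k) = false) ?(negbTE jk) //; apply: negbTE.
have exE : (expX cs <= ex)%N.
  have := split_ge TII (fun j => f j : nat) (fun j => s j : nat) (finj _) (sinj _). exact.
have ezE : (expZ cs <= ez)%N.
  rewrite (_ : ez = \sum_(j < N) if kd j == TI then f j : nat else s j)%N.
    exact: (split_ge TI (fun j => f j) (fun j => s j) (finj _) (sinj _)).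
  apply: eq_bigr => j _; have := fSt j; case: (kd j) => //= /eqP ->.
  by [].
exists ('X^(ex - expX cs) * z ^+ (ez - expZ cs) * (((-1) ^+ s *
   \prod_(j < N) gcoef (kd j) (s j) (f j))%:P * \prod_(j < N) (p j)^`(f j))).
  rewrite big_split big_split /=.
  have -> : \prod_(j < N) mono (kd j) (s j) (f j) = 'X^ex * z ^+ ez.
    rewrite /ex /ez !expr_sum -big_split; apply: eq_bigr => j _.
    by rewrite monoE; case: ifP.
  have -> : 'X^ex = 'X^(ex - expX cs) * 'X^(expX cs) :> {poly K}.
    by rewrite -exprD subnK.
  have -> : z ^+ ez = z ^+ (ez - expZ cs) * z ^+ expZ cs by rewrite -exprD subnK.
  rewrite (polyCM ((-1) ^+ s)) rmorph_sign rmorph_prod /=.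
  move: ('X^(ex - _)) ('X^(expX cs)) (z ^+ (ez - _)) (z ^+ expZ cs) => x1 x2 z1 z2.
  move: (\prod_(j < N) _) (\prod_(j < N) _) ((-1) ^+ s) => P1 P2 sg.
  by ring.
move=> m hm.
move: hm; rewrite /excess_le => hm.
have sumd : (\sum_(x <- cs) x.2 = \sum_(j < N) d j)%N.
  by rewrite (big_nth (St, 0%N)) big_mkord.
have sums : (\sum_(j < N) s j = 'C(size cs, 2))%N.
  rewrite -bin2_sum big_mkord [RHS](reindex_inj (@perm_inj _ s)) /=.
  by [].
(* Each differentiation lowers the degree of a polynomial by one and raises that of its monomial
   factor by one, so the total degree bound does not depend on [f]. *)
have exz : (ex + ez = \sum_(j < N) s j + \sum_(j < N) f j)%N.
  rewrite /ex /ez -!big_split /=; apply: eq_bigr => j _.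
  by case: ifP => _ //; rewrite addnC.
have sfd : (\sum_(j < N) (d j - f j) + \sum_(j < N) f j = \sum_(j < N) d j)%N.
  by rewrite -big_split /=; apply: eq_bigr => j _; rewrite subnK.
have spd : (size (\prod_(j < N) (p j)^`(f j))%R <= (\sum_(j < N) (d j - f j)).+1)%N.
  apply: size_prod_le => j.
  apply: leq_trans (_ : size (p j) - f j <= _)%N.
    elim: (f j : nat) (p j) => [|n IH] q; first by rewrite subn0.
    rewrite derivSn; apply: leq_trans (IH _) _.
    by apply: leq_trans (leq_sub2r _ (size_poly _ _)) _; lia.
  by have := size_basepoly (kd j) (d j); have := fd j; rewrite -/(p j); lia.
apply: leq_trans (_ : ((ex - expX cs) + (ez - expZ cs) + (0 + \sum_(j < N) (d j - f j))).+1 <= _)%N.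
  apply: size_polyM_le; first apply: size_polyM_le.
  - by rewrite size_polyXn.
  - exact: size_exp_le size_zpoly.
  - by apply: size_polyM_le => //; apply: size_polyC_leq1.
rewrite sumd -sums in hm; lia.
Qed.
End Polynomiality.

(** * Deformation over the dual numbers *)

(** A name of its own keeps this multiplication apart from the componentwise one on pairs. *)
Definition dual (F : fieldType) : Type := (F * F)%type.

Section DualNumbers.
Variable F : fieldType.

HB.instance Definition _ := GRing.Zmodule.copy (dual F) (F * F)%type.

Definition dual_one : dual F := (1, 0).
Definition dual_mul (x y : dual F) : dual F :=
  (x.1 * y.1, x.1 * y.2 + x.2 * y.1).
Definition dual_unit : pred (dual F) := fun x => x.1 != 0.
Definition dual_inv (x : dual F) : dual F :=
  if x.1 == 0 then x else (x.1^-1, - x.2 / x.1 ^+ 2).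

Fact dual_mulA : associative dual_mul.
Proof. by move=> [a a'] [b b'] [c c']; congr pair => /=; ring. Qed.
Fact dual_mulC : commutative dual_mul.
Proof. by move=> [a a'] [b b']; congr pair => /=; ring. Qed.
Fact dual_mul1 : left_id dual_one dual_mul.
Proof. by move=> [a a']; congr pair => /=; ring. Qed.
Fact dual_mulDl : left_distributive dual_mul +%R.
Proof. by move=> [a a'] [b b'] [c c']; congr pair => /=; ring. Qed.
Fact dual_one_neq0 : dual_one != 0.
Proof. by apply/eqP => -[] /eqP; rewrite oner_eq0. Qed.

HB.instance Definition _ := GRing.Zmodule_isComNzRing.Build (dual F)
  dual_mulA dual_mulC dual_mul1 dual_mulDl dual_one_neq0.

Fact dual_mulVx : {in dual_unit, left_inverse 1 dual_inv *%R}.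
Proof.
move=> [a a'] a0; have {}a0 : a != 0 by exact: a0.
by rewrite /dual_inv /= (negbTE a0); congr pair => /=; field.
Qed.
Fact dual_unitPl (x y : dual F) : y * x = 1 -> dual_unit x.
Proof.
move=> /(congr1 fst) /= h; apply/eqP => x0.
by move/eqP: h; rewrite x0 mulr0 eq_sym oner_eq0.
Qed.
Fact dual_invr_out : {in [predC dual_unit], dual_inv =1 id}.
Proof. by move=> x /negPn x0; rewrite /dual_inv x0. Qed.

HB.instance Definition _ := GRing.ComNzRing_hasMulInverse.Build (dual F)
  dual_mulVx dual_unitPl dual_invr_out.

Definition dual_fst (x : dual F) : F := x.1.
Definition dual_const (a : F) : dual F := (a, 0).
Definition dual_eps : dual F := (0, 1).

Fact dual_fst_zmod : zmod_morphism dual_fst. Proof. by []. Qed.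
Fact dual_fst_monoid : monoid_morphism dual_fst. Proof. by []. Qed.
HB.instance Definition _ := GRing.isZmodMorphism.Build (dual F) F dual_fst dual_fst_zmod.
HB.instance Definition _ := GRing.isMonoidMorphism.Build (dual F) F dual_fst dual_fst_monoid.

Fact dual_const_zmod : zmod_morphism dual_const.
Proof. by move=> a b; congr pair; rewrite subr0. Qed.
Fact dual_const_monoid : monoid_morphism dual_const.
Proof. by split=> // a b; congr pair => /=; ring. Qed.
HB.instance Definition _ := GRing.isZmodMorphism.Build F (dual F) dual_const dual_const_zmod.
HB.instance Definition _ := GRing.isMonoidMorphism.Build F (dual F) dual_const dual_const_monoid.

Lemma dual_unitE (x : dual F) : (x \is a GRing.unit) = (dual_fst x != 0).
Proof. by []. Qed.

Lemma dual_eps_mul (x : dual F) : dual_eps * x = (0, dual_fst x).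
Proof. by congr pair => /=; rewrite !(mul0r, mul1r, add0r). Qed.

Lemma dual_eps2 : dual_eps * dual_eps = 0.
Proof. by rewrite dual_eps_mul. Qed.
End DualNumbers.

(** * Change of the base ring *)

Section Naturality.
Variables (K L : comNzRingType) (phi : {rmorphism K -> L}) (al b kap : K).

Lemma map_hgpoly a b' k n :
  map_poly phi (hgpoly a b' k n) = hgpoly (phi a) (phi b') (phi k) n.
Proof.
apply/polyP => i; rewrite coef_map !coef_hgpoly /hgcoef /poch.
rewrite /= !rmorphM rmorph_sign rmorph_nat !rmorph_prod; congr (_ * _ * _ * _).
  by apply: eq_bigr => j _; rewrite !rmorphD /= !rmorph_nat.
by apply: eq_bigr => j _; rewrite rmorphD rmorphM /= !rmorphD /= !rmorph_nat rmorph1.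
Qed.

Lemma map_zpoly : map_poly phi (zpoly kap) = zpoly (phi kap).
Proof. by rewrite /zpoly rmorphB rmorphM rmorph1 /= map_polyC map_polyX. Qed.

Lemma map_cpoly : map_poly phi (cpoly kap) = cpoly (phi kap).
Proof. by rewrite /cpoly rmorphM /= map_polyX map_zpoly. Qed.

Lemma map_cpoly' : map_poly phi (cpoly' kap) = cpoly' (phi kap).
Proof.
by rewrite /cpoly' rmorphB rmorphM rmorph1 /= map_polyC map_polyX /= rmorphM rmorph_nat.
Qed.

Lemma map_omega k : map_poly phi (omega al b kap k) = omega (phi al) (phi b) (phi kap) k.
Proof.
case: k => /=; first by rewrite rmorph0.
  by rewrite rmorphM /= map_polyC map_polyX.
by rewrite rmorphM rmorphN /= map_polyC map_zpoly.
Qed.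

Lemma map_basepoly k n :
  map_poly phi (basepoly al b kap k n) = basepoly (phi al) (phi b) (phi kap) k n.
Proof. by case: k => /=; rewrite map_hgpoly ?rmorphN. Qed.

Lemma map_euler (p : {poly K}) :
  map_poly phi (euler kap p) = euler (phi kap) (map_poly phi p).
Proof. by rewrite /euler rmorphM /= map_cpoly deriv_map. Qed.

Lemma map_col k p i : map_poly phi (col al b kap k p i) =
  col (phi al) (phi b) (phi kap) k (map_poly phi p) i.
Proof.
elim: i => //= i IH; rewrite rmorphD /= map_euler IH rmorphM /= IH.
by rewrite rmorphB rmorphM /= map_omega map_cpoly' rmorph_nat.
Qed.

Lemma map_tau cs : map_poly phi (tau al b kap cs) = tau (phi al) (phi b) (phi kap) cs.
Proof.
rewrite /tau /cdet -(det_map_mx (map_poly phi)); congr (\det _).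
apply/matrixP => i j; rewrite !mxE !nth_cols //.
by rewrite /= map_col map_basepoly.
Qed.
End Naturality.

(* [partner cs cs' x y]: [cs'] arises from [cs] either by exchanging the entry
   [x] for an entry [y] of the same kind, or by deleting an entry [x] of type I
   and an entry [y] of type II. *)
Inductive partner (cs cs' : seq (kind * nat)) : kind * nat -> kind * nat -> Prop :=
| PartnerReplace s x y of (0 < size s)%N & x.1 = y.1
    & perm_eq cs (s ++ [:: x]) & perm_eq cs' (s ++ [:: y]) : partner cs cs' x y
| PartnerRemove s x y of (0 < size s)%N & x.1 = TI & y.1 = TII
    & perm_eq cs (s ++ [:: x; y]) & perm_eq cs' s : partner cs cs' x y.

Section Partners.
Variable K : comNzRingType.
Variables al b kap : K.
Local Notation E x := (energy al b kap x.1 x.2).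
Local Notation tau := (tau al b kap).
Local Notation weight := (weight al b kap).

Lemma weight_perm s s' : perm_eq s s' -> weight s = weight s'.
Proof. by move=> p; rewrite /weight (perm_size p) (perm_big _ p). Qed.

Lemma kcount_perm k s s' : perm_eq s s' -> kcount k s = kcount k s'.
Proof. by move/seq.permP => h; apply: h. Qed.

Lemma expX_perm s s' : perm_eq s s' -> expX s = expX s'.
Proof. by move=> p; rewrite /expX (kcount_perm _ p) (perm_size p). Qed.

Lemma expZ_perm s s' : perm_eq s s' -> expZ s = expZ s'.
Proof. by move=> p; rewrite /expZ (kcount_perm _ p) (perm_size p). Qed.

Lemma kcount_cat k s s' : kcount k (s ++ s') = (kcount k s + kcount k s')%N.
Proof. exact: count_cat. Qed.

Lemma root_equation_sign (e e' : bool) T B lam S r :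
  root_equation kap T B lam S r ->
  root_equation kap ((-1) ^+ e * T) ((-1) ^+ e' * B) lam S r.
Proof.
have De (e0 : bool) (w : {poly K}) : euler kap ((-1) ^+ e0 * w) = (-1) ^+ e0 * euler kap w.
  by case: e0; rewrite ?expr0 ?expr1 ?mul1r ?mulN1r ?eulerN.
have He (e0 : bool) (w : {poly K}) : ((-1) ^+ e0 * w).[r] = (-1) ^+ e0 * w.[r].
  by case: e0; rewrite ?expr0 ?expr1 ?mul1r ?mulN1r ?hornerN.
rewrite /root_equation !De !He => H.
move: H.
move: (euler kap (euler kap (euler kap T))).[r] (euler kap (euler kap T)).[r] (euler kap T).[r]
  => t3 t2 t1.
move: (euler kap (euler kap B)).[r] (euler kap B).[r] B.[r] => b2 b1 b0 H.
have s2 : (-1) ^+ e * (-1) ^+ e = 1 :> K by rewrite -expr2 sqrr_sign.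
transitivity ((-1) ^+ e * (-1) ^+ e' * (4 * t1 ^+ 2 * (b2 * t1 - b1 * t2))); first by ring: s2.
rewrite H; ring: s2.
Qed.

(** For a deleted pair, the power of [cpoly] required by [tau_remove] is exactly the surplus of
    trivial factors of [cs] over those of [cs']. Numerator and denominator therefore carry the same
    trivial factor. *)
Lemma partner_root_equation cs cs' x y : partner cs cs' x y ->
  exists m, [/\ expX cs = (m + expX cs')%N, expZ cs = (m + expZ cs')%N &
   forall r, root (tau cs) r -> root_equation kap (tau cs) (cpoly kap ^+ m * tau cs')
     (root_potential al b kap (size cs)%:R (weight cs)) (E x + E y) r].
Proof.
case=> {x y} s x y s0 => [xy pc pc'|xI yII pc pc'].
  exists 0%N; rewrite !add0n; split=> [||r rT].
  - rewrite (expX_perm pc) (expX_perm pc') /expX !size_cat !kcount_cat /kcount /=.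
    by rewrite xy.
  - rewrite (expZ_perm pc) (expZ_perm pc') /expZ !size_cat !kcount_cat /kcount /=.
    by rewrite xy.
  have [e Te] := tau_perm al b kap pc; have [e' Te'] := tau_perm al b kap pc'.
  have rT' : root (tau (s ++ [:: x])) r.
    move/rootP: rT => rT; apply/rootP; rewrite Te.
    by rewrite hornerM rT mulr0.
  have H := root_equation_replace s0 xy rT'.
  rewrite (weight_perm pc) (perm_size pc) size_cat addn1 expr0 mul1r.
  have -> : tau cs = (-1) ^+ e * tau (s ++ [:: x]) by rewrite Te signrMK.
  have -> : tau cs' = (-1) ^+ e' * tau (s ++ [:: y]) by rewrite Te' signrMK.
  exact: root_equation_sign.
exists (size s); split=> [||r rT].
- rewrite (expX_perm pc) (expX_perm pc') /expX !size_cat !kcount_cat /kcount /= xI yII /=.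
  have := count_size (fun z => z.1 == TII) s; move: (count _ s) (size s) => m n mn.
  have -> : (n + 2 - (m + (0 + (1 + 0))) = (n - m).+1)%N by lia.
  rewrite (_ : m + _ = m.+1)%N; last by lia.
  by rewrite !binS !bin1; lia.
- rewrite (expZ_perm pc) (expZ_perm pc') /expZ !size_cat !kcount_cat /kcount /= xI yII /=.
  have := count_size (fun z => z.1 == TI) s; move: (count _ s) (size s) => m n mn.
  have -> : (n + 2 - (m + (1 + (0 + 0))) = (n - m).+1)%N by lia.
  rewrite (_ : m + _ = m.+1)%N; last by lia.
  by rewrite !binS !bin1; lia.
have [e Te] := tau_perm al b kap pc; have [e' Te'] := tau_perm al b kap pc'.
have rT' : root (tau (s ++ [:: x; y])) r.
  move/rootP: rT => rT; apply/rootP; rewrite Te.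
  by rewrite hornerM rT mulr0.
have H := root_equation_remove s0 xI yII rT'.
rewrite (weight_perm pc) (perm_size pc) size_cat addn2.
have -> : tau cs = (-1) ^+ e * tau (s ++ [:: x; y]) by rewrite Te signrMK.
have -> : tau cs' = (-1) ^+ e' * tau s by rewrite Te' signrMK.
by rewrite mulrCA; apply: root_equation_sign.
Qed.
End Partners.

Lemma prodX_factor (K : comUnitRingType) n (eta : 'I_n -> K) (P : {poly K}) :
  unit_gaps eta -> (size P <= n.+1)%N -> (forall l, root P (eta l)) ->
  exists lc : K, P = lc%:P * prodX eta predT.
Proof.
move=> g sP rP.
have rs : all (root P) [seq eta l | l <- enum 'I_n] by apply/allP => _ /mapP[l _ ->].
have [q Pq] := uniq_roots_prod_XsubC rs (uniq_roots_gaps g).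
rewrite big_map big_enum /= in Pq; change (P = q * prodX eta predT) in Pq.
have mon : prodX eta predT \is monic by apply: monic_prod_XsubC.
have [q0|q0] := eqVneq q 0; first by exists 0; rewrite Pq q0 polyC0 !mul0r.
have sq : (size q <= 1)%N.
  by move: sP; rewrite Pq size_Mmonic // size_prodX card_ord addnS /= -[n.+1]add1n leq_add2r.
by exists q`_0; rewrite -(size1_polyC sq).
Qed.

Lemma horner_nilpotent (K : comNzRingType) (p : {poly K}) (x h : K) :
  h * h = 0 -> p.[x + h] = p.[x] + p^`().[x] * h.
Proof.
move=> hh; elim/poly_ind: p => [|p c IH]; first by rewrite deriv0 !horner0 mul0r addr0.
rewrite !poly.derivE !hornerE IH; ring: hh.
Qed.

(** One Newton step from [y], exact because eps squares to 0. *)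
Lemma root_lift (F : fieldType) (P : {poly dual F}) (y : F) :
  root (map_poly (@dual_fst F) P) y -> (map_poly (@dual_fst F) P)^`().[y] != 0 ->
  exists eta : dual F, dual_fst eta = y /\ root P eta.
Proof.
pose p0 := P.[dual_const y]; pose p1 := P^`().[dual_const y].
have fc : dual_fst (dual_const y) = y by [].
have e0 : (map_poly (@dual_fst F) P).[y] = dual_fst p0 by rewrite -{1}fc horner_map.
have e1 : (map_poly (@dual_fst F) P)^`().[y] = dual_fst p1.
  by rewrite -{1}fc deriv_map horner_map.
move=> /rootP; rewrite e0 e1 => f0 f1.
pose t := - p0.2 / dual_fst p1.
exists (dual_const y + dual_eps F * dual_const t); split.
  by rewrite rmorphD rmorphM /= /dual_fst /= mul0r addr0.
apply/rootP; rewrite horner_nilpotent; last first.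
  by rewrite mulrACA dual_eps2 mul0r.
rewrite -/p0 -/p1 mulrCA [_ * (p1 * _)]dual_eps_mul rmorphM /=.
have -> : p0 = (0, p0.2) by rewrite -[in RHS]f0; case: (p0).
by congr pair => /=; rewrite ?addr0 // /t mulrCA divff // mulr1 subrr.
Qed.

(** * Orthogonality of partners over a field *)

Section PartnerOrthogonality.
Variables (F : fieldType) (al b kap : F) (n : nat).
Local Notation Z := (zpoly kap).

Lemma zpoly_neq0 : Z != 0.
Proof.
apply/eqP => /(congr1 (fun p : {poly F} => p`_0)) /eqP.
by rewrite coefB coef1 coefCM coefX mulr0 subr0 coef0 oner_eq0.
Qed.

Lemma gauge_neq0 i j : 'X^i * Z ^+ j != 0.
Proof. by rewrite mulf_neq0 // expf_neq0 // ?polyX_eq0 ?zpoly_neq0. Qed.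

Lemma partner_orthogonality (cs cs' cs'' : seq (kind * nat)) x y x' y'
    (P Q Q' : {poly F}) (eta : 'I_n -> F) :
  (2 : F) != 0 -> b != 0 ->
  partner cs cs' x y -> partner cs cs'' x' y' ->
  excess_le n cs -> excess_le n.-1 cs' -> excess_le n.-1 cs'' ->
  tau al b kap cs = 'X^(expX cs) * Z ^+ (expZ cs) * P ->
  tau al b kap cs' = 'X^(expX cs') * Z ^+ (expZ cs') * Q ->
  tau al b kap cs'' = 'X^(expX cs'') * Z ^+ (expZ cs'') * Q' ->
  size P = n.+1 -> injective eta -> (forall l, root P (eta l)) ->
  (forall l, (cpoly kap).[eta l] != 0) ->
  (energyX al x.1 x.2 + energyX al y.1 y.2 = energyX al x'.1 x'.2 + energyX al y'.1 y'.2 ->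
   energyY al x.1 x.2 + energyY al y.1 y.2 = energyY al x'.1 x'.2 + energyY al y'.1 y'.2 ->
   False) ->
  \sum_l Q.[eta l] * Q'.[eta l] / ((cpoly kap).[eta l] * P^`().[eta l] ^+ 2) = 0.
Proof.
move=> two b0 pp pp' ex ex' ex'' tP tQ tQ' sP ieta rP c0 gen.
have [n0|n_gt0] := posnP n.
  by rewrite big1 // => l _; have := ltn_ord l; rewrite {2}n0.
(* Moving [kap] to [kap + eps] separates eigenvalues that coincide at [kap];
   the simple zeros lift by Newton's method. *)
pose K := dual F : comUnitRingType.
pose fs : {rmorphism K -> F} := @dual_fst F.
pose alK : K := dual_const al; pose bK : K := dual_const b.
pose kK : K := dual_const kap + dual_eps F.
have fk : fs kK = kap by rewrite /fs /= /dual_fst /= addr0.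
have red p (PK : {poly K}) : tau alK bK kK p = 'X^(expX p) * zpoly kK ^+ (expZ p) * PK ->
    forall P0, tau al b kap p = 'X^(expX p) * Z ^+ (expZ p) * P0 -> map_poly fs PK = P0.
  move=> hK P0 h0; apply: (mulfI (gauge_neq0 (expX p) (expZ p))); rewrite -h0.
  have := map_tau fs alK bK kK p; rewrite fk => <-.
  by rewrite hK !rmorphM /= !rmorphXn /= map_polyX map_zpoly fk.
have [PK hP sPK] := tau_factor alK bK kK cs.
have [QK hQ sQK] := tau_factor alK bK kK cs'.
have [QK' hQ' sQK'] := tau_factor alK bK kK cs''.
have {}sPK := sPK _ ex; have {}sQK := sQK _ ex'; have {}sQK' := sQK' _ ex''.
rewrite prednK // in sQK sQK'.
have rdP := red _ _ hP _ tP; have rdQ := red _ _ hQ _ tQ; have rdQ' := red _ _ hQ' _ tQ'.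
have g : unit_gaps eta by move=> l k lk; rewrite unitfE subr_eq0 (inj_eq ieta).
have [lc Plc] : exists lc, P = lc%:P * prodX eta predT.
  by apply: prodX_factor => //; rewrite sP.
have lc0 : lc != 0.
  by apply/eqP => lc0; move: sP; rewrite Plc lc0 polyC0 mul0r size_poly0.
have P1 l : P^`().[eta l] != 0.
  rewrite Plc deriv_prodX_root mulf_neq0 // -unitfE; exact: unit_prodX.
have [etaK etaKP] : exists etaK : 'I_n -> K, forall l, fs (etaK l) = eta l /\ root PK (etaK l).
  have rdP0 : map_poly (@dual_fst F) PK = P := rdP.
  apply: (@fin_all_exists _ (fun=> K) (fun l e => fs e = eta l /\ root PK e)) => l.
  have h := @root_lift F PK (eta l); rewrite rdP0 in h.
  exact: h (rP l) (P1 l).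
have gK : unit_gaps etaK.
  move=> l k lk; rewrite dual_unitE rmorphB /=.
  have [-> _] := etaKP l; have [-> _] := etaKP k.
  by rewrite subr_eq0 (inj_eq ieta).
have [lcK PlcK] : exists lcK, PK = lcK%:P * prodX etaK predT.
  by apply: prodX_factor => // l; case: (etaKP l).
have evK (p : {poly K}) l : fs p.[etaK l] = (map_poly fs p).[eta l].
  by have [<- _] := etaKP l; rewrite horner_map.
have ulcK : lcK \is a GRing.unit.
  rewrite dual_unitE; apply/eqP => lk0.
  have : P = 0.
    by rewrite -rdP PlcK rmorphM /= map_polyC /= lk0 polyC0 mul0r.
  by move=> P0; move: sP; rewrite P0 size_poly0.
have u2 : (2 : K) \is a GRing.unit.
  by rewrite dual_unitE rmorph_nat.
have uC l : (cpoly kK).[etaK l] \is a GRing.unit.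
  by rewrite dual_unitE evK map_cpoly fk.
have uP l : PK^`().[etaK l] \is a GRing.unit.
  by rewrite dual_unitE evK -deriv_map rdP.
have [m [mX mZ req]] := partner_root_equation alK bK kK pp.
have [m' [mX' mZ' req']] := partner_root_equation alK bK kK pp'.
pose f := 'X^(expX cs) * zpoly kK ^+ (expZ cs).
have uf l : f.[etaK l] \is a GRing.unit.
  have := uC l; rewrite /f /cpoly !hornerM !horner_exp !unitrM => /andP[h1 h2].
  by rewrite !unitrX.
have [kk kkP] : exists kk : 'I_n -> K, forall l Q0 S,
    root_equation kK (f * PK) (f * Q0)
      (root_potential alK bK kK (size cs)%:R (weight alK bK kK cs)) S (etaK l) ->
    Q0^`()^`().[etaK l] * PK^`().[etaK l] - Q0^`().[etaK l] * PK^`()^`().[etaK l] =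
    Q0.[etaK l] * (kk l + S * (PK^`().[etaK l] / (cpoly kK).[etaK l])).
  have rl l : PK.[etaK l] = 0 by apply/rootP; case: (etaKP l).
  exact: fin_all_exists (fun l => root_transfer _ (rl l) (uf l) (uP l) (uC l) u2).
have rt l : root (tau alK bK kK cs) (etaK l).
  have [_ /rootP h] := etaKP l.
  by apply/rootP; rewrite hP hornerM h mulr0.
have fQ p q mm (X1 : expX cs = (mm + expX p)%N) (Z1 : expZ cs = (mm + expZ p)%N) :
    tau alK bK kK p = 'X^(expX p) * zpoly kK ^+ (expZ p) * q ->
    cpoly kK ^+ mm * tau alK bK kK p = f * q.
  move=> ->; rewrite /f X1 Z1 !exprD /cpoly exprMn; ring.
have H1 l := req _ (rt l); have H2 l := req' _ (rt l).
rewrite (fQ _ _ _ mX mZ hQ) hP in H1; rewrite (fQ _ _ _ mX' mZ' hQ') hP in H2.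
have := residue_orthogonality gK ulcK PlcK uC sQK sQK'
  (fun l => kkP l QK _ (H1 l)) (fun l => kkP l QK' _ (H2 l)).
set SS := \sum_l _ => HS.
have fSS : fs SS = \sum_l Q.[eta l] * Q'.[eta l] / ((cpoly kap).[eta l] * P^`().[eta l] ^+ 2).
  rewrite /SS (rmorph_sum fs); apply: eq_bigr => l _.
  rewrite (rmorphM fs) (rmorphV fs); last by rewrite unitrM uC unitrX.
  rewrite !(rmorphM fs) !evK rdQ rdQ' map_cpoly fk -deriv_map rdP.
  by [].
rewrite -fSS.
(* The eigenvalues differ by [b * dY - kap * dX] minus eps times [dX]. If the first part is nonzero,
   reducing [HS] suffices. If it is 0, then [dX] is not: [dX = 0] would give [dY = 0], as [b] is
   nonzero, against [gen]. The eps component of [HS] is then a nonzero multiple of the sum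
   sought. *)
pose dX := energyX al x.1 x.2 + energyX al y.1 y.2 - (energyX al x'.1 x'.2 + energyX al y'.1 y'.2).
pose dY := energyY al x.1 x.2 + energyY al y.1 y.2 - (energyY al x'.1 x'.2 + energyY al y'.1 y'.2).
pose dc : {rmorphism F -> K} := @dual_const F.
have dcE := (rmorphM dc, rmorphD dc, rmorphB dc, rmorphN dc, rmorph_nat dc, rmorph1 dc).
have eX (w : kind * nat) : energyX alK w.1 w.2 = dc (energyX al w.1 w.2).
  by case: w => -[] k; rewrite /energyX !dcE.
have eY (w : kind * nat) : energyY alK w.1 w.2 = dc (energyY al w.1 w.2).
  by case: w => -[] k; rewrite /energyY !dcE.
have eS : energy alK bK kK x.1 x.2 + energy alK bK kK y.1 y.2 -
   (energy alK bK kK x'.1 x'.2 + energy alK bK kK y'.1 y'.2) =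
   dc (b * dY - kap * dX) - dual_eps F * dc dX.
  rewrite /energy !eX !eY /dX /dY /bK /kK -/(dc b) -/(dc kap) !dcE.
  ring.
rewrite eS in HS.
have [h0|h0] := eqVneq (b * dY - kap * dX) 0; last first.
  move/(congr1 fs): HS; rewrite (rmorphM fs) (rmorph0 fs) => /eqP.
  rewrite mulf_eq0 => /orP[|/eqP //].
  by rewrite /fs /= /dual_fst /= mul0r subr0 (negbTE h0).
have dX0 : dX != 0.
  apply/eqP => dX0; have dY0 : dY = 0.
    by move/eqP: h0; rewrite dX0 mulr0 subr0 mulf_eq0 (negbTE b0) => /eqP.
  by apply: gen; apply/eqP; rewrite -subr_eq0; apply/eqP.
move: HS; rewrite h0 (rmorph0 dc) sub0r mulNr -mulrA dual_eps_mul.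
move=> /(congr1 (fun t : dual F => t.2)) /eqP; rewrite oppr_eq0 /=.
by rewrite mulf_eq0 (negbTE dX0) => /eqP.
Qed.
End PartnerOrthogonality.

(** * Wronskians of the seed functions *)

Section Seeds.
Import numFieldNormedType.Exports.
Variable R : realType.

Lemma horner_colS (k : kind) (al b kap : R) (q : {poly R}) i y :
  (col al b kap k q i.+1).[y] = (cpoly kap).[y] * (col al b kap k q i)^`().[y] +
    ((omega al b kap k).[y] - i%:R * (cpoly' kap).[y]) * (col al b kap k q i).[y].
Proof.
rewrite /= /euler -polyC_natr.
move: (omega _ _ _ _) (cpoly' _) (cpoly _) (col _ _ _ _ _ _) => o c C v.
by rewrite hornerD !hornerM hornerD hornerN hornerM hornerC.
Qed.

(** The recursion of [col] is one differentiation of this right-hand side: [omega] comes from [G],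
    and the multiple of [cpoly'] from the power of [sg / cpoly]. *)
Lemma derive1n_gauge (U : set R) (G : R -> R) (k : kind) (al b kap sg : R)
    (aff q : {poly R}) :
  open U -> deriv aff = sg%:P ->
  (forall x, U x -> (cpoly kap).[aff.[x]] != 0) ->
  (forall x, U x -> is_derive x 1 G
     (sg / (cpoly kap).[aff.[x]] * (omega al b kap k).[aff.[x]] * G x)) ->
  forall i x, U x -> derive1n i (fun y => G y * q.[aff.[y]]) x =
    (sg / (cpoly kap).[aff.[x]]) ^+ i * (G x * (col al b kap k q i).[aff.[x]]).
Proof.
move=> oU daff C0 dG; elim=> [|i IH] x Ux; first by rewrite expr0 mul1r.
rewrite derive1nS derive1E.
pose C := (cpoly kap \Po aff); pose v := (col al b kap k q i \Po aff).
have CE y : (cpoly kap).[aff.[y]] = C.[y] by rewrite horner_comp.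
have vE y : (col al b kap k q i).[aff.[y]] = v.[y] by rewrite horner_comp.
have eqn : \forall y \near x, (sg / C.[y]) ^+ i * (G y * v.[y]) =
    derive1n i (fun y => G y * q.[aff.[y]]) y.
  apply: filterS (open_nbhs_nbhs (conj oU Ux)) => y Uy.
  by rewrite IH // CE vE.
have Cx0 : C.[x] != 0 by rewrite -CE C0.
have dC : is_derive x 1 (fun y => (C.[y])^-1) (- C.[x] ^- 2 *: C^`().[x]).
  exact: is_deriveV.
pose w := (sg \*: (fun y => (C.[y])^-1) : R -> R).
have dw : is_derive x 1 w (sg *: (- C.[x] ^- 2 *: C^`().[x])) by exact: is_deriveZ.
have dwi := is_deriveX i dw.
have dGv := is_deriveM (dG x Ux) (is_derive_poly v x).
have dF := is_deriveM dwi dGv.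
have eqn' : \forall y \near x, (w ^+ i * (G * horner v)) y =
    derive1n i (fun y => G y * q.[aff.[y]]) y.
  by apply: filterS eqn => y <-; rewrite !fctE.
have [_ ->] := near_eq_is_derive eqn' dF.
have dCx : C^`().[x] = sg * (cpoly' kap).[aff.[x]].
  rewrite /C deriv_comp hornerM horner_comp daff hornerC mulrC.
  by rewrite deriv_cpoly.
have dvx : v^`().[x] = sg * (col al b kap k q i)^`().[aff.[x]].
  by rewrite /v deriv_comp hornerM horner_comp daff hornerC mulrC.
rewrite dCx dvx horner_colS !fctE /w /GRing.scale /= CE -vE.
move: Cx0; move: (C.[x]) (G x) (col _ _ _ _ _ _).[_] (col _ _ _ _ _ _)^`().[_] => c0 g0 v0 v1 c00.
move: (omega _ _ _ _).[_] (cpoly' _).[_] => o c.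
have -> : i%:R * (sg / c0) ^+ i.-1 * (sg * (- c0 ^- 2 * (sg * c))) =
   - (i%:R * (sg / c0) ^+ i * (sg * c / c0)).
  case: (i) => [|n] /=; first by rewrite !mul0r oppr0.
  by rewrite (exprS (sg / c0)); move: ((sg / c0) ^+ n) => w'; field.
by rewrite (exprS (sg / c0)); move: ((sg / c0) ^+ i) => w'; field.
Qed.

Definition seed_al (c : params R) : R :=
  match c with Laguerre g => g - 1 / 2 | Jacobi g _ => g - 1 / 2 end.
Definition seed_b (c : params R) : R :=
  match c with Laguerre _ => 1 | Jacobi _ h => h - 1 / 2 end.
Definition seed_kap (c : params R) : R :=
  match c with Laguerre _ => 0 | Jacobi _ _ => 1 end.
Definition seed_slope (c : params R) : R :=
  match c with Laguerre _ => 1 | Jacobi _ _ => - (1 / 2) end.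
Definition seed_aff (c : params R) : {poly R} :=
  match c with Laguerre _ => 'X | Jacobi _ _ => (1 / 2)%:P * (1 - 'X) end.

Definition seed_gauge (c : params R) (k : kind) (x : R) : R :=
  match k, c with
  | St, _ => 1
  | TI, Laguerre _ => expR x
  | TI, Jacobi _ h => ((1 + x) / 2) `^ (1 / 2 - h)
  | TII, Laguerre g => x `^ (1 / 2 - g)
  | TII, Jacobi g _ => ((1 - x) / 2) `^ (1 / 2 - g)
  end.

Definition seed (c : params R) (p : kind * nat) : R -> R :=
  match p.1 with
  | St => fun x => (base_poly c p.2).[x]
  | TI => muI c p.2
  | TII => muII c p.2
  end.

Definition columns (A : index_pair) (n : nat) : seq (kind * nat) :=
  [seq (TI, a) | a <- A.1] ++ [seq (TII, b) | b <- A.2] ++ [:: (St, n)].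

Lemma pochhammerE (a : R) n : pochhammer a n = poch a n.
Proof. by []. Qed.

Lemma laguerre_hgpoly (a : R) n : laguerre a n = n`!%:R^-1 *: hgpoly a 1 0 n.
Proof.
apply/polyP => k; rewrite coefZ coef_hgpoly coef_poly.
case: ltnP => kn; last by rewrite /hgcoef bin_small // mulr0 !mul0r mulr0.
rewrite /hgcoef -(bin_fact (n := n) (m := k)) //.
rewrite big1 => [|i _]; last by rewrite mul0r add0r.
rewrite !natrM.
have f0 m : m`!%:R != 0 :> R by rewrite pnatr_eq0 -lt0n fact_gt0.
have c0 : 'C(n, k)%:R != 0 :> R by rewrite pnatr_eq0 -lt0n bin_gt0.
rewrite pochhammerE.
by field; rewrite c0 !f0.
Qed.

Lemma laguerreN_hgpoly (a : R) n x :
  (laguerre a n).[- x] = (n`!%:R^-1 *: hgpoly a (- 1) 0 n).[x].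
Proof.
rewrite laguerre_hgpoly !hornerZ; congr (_ * _); rewrite !horner_poly.
apply: eq_bigr => k _; rewrite exprNn mulrA; congr (_ * _).
rewrite /hgcoef.
have -> : \prod_(i < k) (0 * (n%:R + a + 1 + i%:R) + 1) = 1 :> R.
  by rewrite big1 // => i _; rewrite mul0r add0r.
have -> : \prod_(i < k) (0 * (n%:R + a + 1 + i%:R) - 1) = (-1) ^+ k :> R.
  rewrite (eq_bigr (fun=> -1)) => [|i _]; last by rewrite mul0r add0r.
  by rewrite prodr_const card_ord.
by rewrite mulr1.
Qed.

Lemma jacobi_hgpoly (a b : R) n x :
  (jacobi a b n).[x] = (n`!%:R^-1 *: hgpoly a b 1 n).[1 / 2 * (1 - x)].
Proof.
rewrite hornerZ horner_poly /jacobi horner_sum mulr_sumr; apply: eq_bigr => k _.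
rewrite hornerZ horner_exp.
have -> : ((1 / 2) *: ('X - 1)).[x] = - 1 * (1 / 2 * (1 - x)) :> R.
  by rewrite hornerZ hornerD hornerN hornerX -polyC1 hornerC; ring.
rewrite exprMn !mulrA; congr (_ * _).
have kn : (k <= n)%N by rewrite -ltnS.
rewrite /hgcoef -(bin_fact kn) !natrM.
have f0 m : m`!%:R != 0 :> R by rewrite pnatr_eq0 -lt0n fact_gt0.
have c0 : 'C(n, k)%:R != 0 :> R by rewrite pnatr_eq0 -lt0n bin_gt0.
have -> : pochhammer (n%:R + a + b + 1) k =
   \prod_(i < k) (1 * (n%:R + a + 1 + i%:R) + b).
  by apply: eq_bigr => i _; ring.
rewrite pochhammerE.
by field; rewrite c0 !f0.
Qed.

Lemma seedE (c : params R) p : seed c p = fun x => seed_gauge c p.1 x *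
  (p.2`!%:R^-1 *: basepoly (seed_al c) (seed_b c) (seed_kap c) p.1 p.2).[(seed_aff c).[x]].
Proof.
apply/funext => x; have jx : ((1 / 2)%:P * (1 - 'X)).[x] = 1 / 2 * (1 - x) :> R.
  by rewrite hornerM hornerD hornerN hornerX -polyC1 !hornerC.
case: p c => -[] n [g|g h]; rewrite /seed /seed_gauge /seed_aff /=.
- by rewrite [RHS]mul1r hornerX laguerre_hgpoly.
- by rewrite [RHS]mul1r jx jacobi_hgpoly.
- by rewrite hornerX laguerreN_hgpoly.
- by rewrite jx jacobi_hgpoly opprB.
- by rewrite hornerX laguerre_hgpoly opprB.
- by rewrite jx jacobi_hgpoly opprB.
Qed.

Lemma seed_aff_deriv (c : params R) : (seed_aff c)^`() = (seed_slope c)%:P.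
Proof.
case: c => [g|g h] /=; first by rewrite derivX polyC1.
by rewrite derivM derivC derivB derivX -polyC1 derivC mul0r add0r sub0r mulrN polyCN mulr1.
Qed.

Lemma seed_aff_pos (c : params R) x : domain c x ->
  0 < (seed_aff c).[x] /\ 0 < (zpoly (seed_kap c)).[(seed_aff c).[x]].
Proof.
have zE k y : (zpoly k).[y] = 1 - k * y :> R.
  by rewrite /zpoly hornerD hornerN hornerM hornerX -polyC1 !hornerC.
rewrite zE; case: c => [g|g h] /=; first by rewrite hornerX mul0r subr0.
move=> /andP[h1 h2]; rewrite hornerM hornerD hornerN hornerX -polyC1 !hornerC.
by split; lra.
Qed.

Lemma domain_open (c : params R) : open (domain c).
Proof.
case: c => [g|g h]; first exact: (@open_gt R 0).
have -> : domain (Jacobi g h) = ([set x | -1 < x] `&` [set x | x < 1])%classic.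
  by apply/seteqP; split => x /= => [/andP[]|[-> ->]].
exact: openI (@open_gt R _) (@open_lt R _).
Qed.

Lemma powR_pred (x a : R) : 0 < x -> x `^ (a - 1) = x `^ a / x.
Proof. by move=> x0; rewrite powRB ?(gt_eqF x0) ?implybT // powRr1 // ltW. Qed.

Lemma is_derive_powR_affine (u v a x : R) : 0 < u + v * x ->
  is_derive x 1 (fun y => (u + v * y) `^ a) (a * v / (u + v * x) * (u + v * x) `^ a).
Proof.
move=> p0; pose p : {poly R} := u%:P + v%:P * 'X.
have pE y : p.[y] = u + v * y by rewrite hornerD hornerM hornerX !hornerC.
have -> : (fun y => (u + v * y) `^ a) = ((fun t : R => t `^ a) \o horner p).
  by apply/funext => y; rewrite /= pE.
have p0' : 0 < p.[x] by rewrite pE.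
apply: is_derive_eq (is_derive1_comp (@is_derive1_powR R a p.[x] p0') (is_derive_poly p x)) _.
rewrite pE powR_pred // /p derivD derivC derivM derivC derivX mul0r !add0r mulr1 hornerC.
by field; rewrite gt_eqF.
Qed.

Lemma seed_gauge_derive (c : params R) k x : domain c x ->
  is_derive x 1 (seed_gauge c k) (seed_slope c / (cpoly (seed_kap c)).[(seed_aff c).[x]] *
   (omega (seed_al c) (seed_b c) (seed_kap c) k).[(seed_aff c).[x]] * seed_gauge c k x).
Proof.
move=> dx; have [y0 z0] := seed_aff_pos dx.
have cE k' y : (cpoly k').[y] = y * (1 - k' * y) :> R.
  by rewrite /cpoly /zpoly hornerM hornerX hornerD hornerN hornerM hornerX -polyC1 !hornerC.
have zE k' y : (zpoly k').[y] = 1 - k' * y :> R.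
  by rewrite /zpoly hornerD hornerN hornerM hornerX -polyC1 !hornerC.
have jx : ((1 / 2)%:P * (1 - 'X)).[x] = 1 / 2 * (1 - x) :> R.
  by rewrite hornerM hornerD hornerN hornerX -polyC1 !hornerC.
rewrite cE; rewrite zE in z0.
case: k c dx y0 z0 => -[g|g h] dx y0 z0; rewrite /omega.
- by rewrite horner0 mulr0 mul0r; apply: is_derive_cst.
- by rewrite horner0 mulr0 mul0r; apply: is_derive_cst.
- rewrite /= hornerX in y0 *; rewrite hornerM hornerX hornerC.
  apply: is_derive_eq (is_derive_expR x) _.
  by field; rewrite ?mul0r ?subr0 ?oner_neq0 gt_eqF.
- rewrite /= jx in y0 z0 *; rewrite hornerM hornerX hornerC.
  have e (y : R) : (1 + y) / 2 = 1 / 2 + 1 / 2 * y by field.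
  have -> : seed_gauge (Jacobi g h) TI =
            (fun y => (1 / 2 + 1 / 2 * y) `^ (1 / 2 - h)).
    by apply/funext => y; rewrite /= e.
  have p0 : 0 < 1 / 2 + 1 / 2 * x by lra.
  apply: is_derive_eq (is_derive_powR_affine _ p0) _.
  by rewrite e; move: (_ `^ _) => w; field; rewrite !gt_eqF //; lra.
- rewrite /= hornerX in y0 z0 *; rewrite hornerM hornerN hornerC zE.
  apply: is_derive_eq (@is_derive1_powR R _ x y0) _.
  rewrite powR_pred //; move: (_ `^ _) => w.
  by field; rewrite ?mul0r ?subr0 ?oner_neq0 gt_eqF.
- rewrite /= jx in y0 z0 *; rewrite hornerM hornerN hornerC zE.
  have e (y : R) : (1 - y) / 2 = 1 / 2 + - (1 / 2) * y by field.
  have -> : seed_gauge (Jacobi g h) TII =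
            (fun y => (1 / 2 + - (1 / 2) * y) `^ (1 / 2 - g)).
    by apply/funext => y; rewrite /= e.
  have p0 : 0 < 1 / 2 + - (1 / 2) * x by lra.
  apply: is_derive_eq (is_derive_powR_affine _ p0) _.
  by rewrite e; move: (_ `^ _) => w; field; rewrite !gt_eqF //; lra.
Qed.

End Seeds.

Lemma det_scale (K : comNzRingType) n (r d : 'I_n -> K) (M : 'M[K]_n) :
  \det (\matrix_(i, j) (r i * (d j * M i j))) = (\prod_i r i) * (\prod_j d j) * \det M.
Proof.
rewrite /determinant mulr_sumr; apply: eq_bigr => s _.
rewrite mulrCA; congr (_ * _); rewrite (reindex_inj (@perm_inj _ s) (P := predT) (F := d)) /=.
by rewrite -!big_split /=; apply: eq_bigr => i _; rewrite mxE mulrA.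
Qed.

Lemma col_scale (K : comNzRingType) (al b kap : K) k (a : K) p i :
  col al b kap k (a *: p) i = a *: col al b kap k p i.
Proof.
elim: i => //= i ->; rewrite /euler derivZ -!mul_polyC; ring.
Qed.

Lemma binD m n : 'C(m + n, 2) = ('C(m, 2) + 'C(n, 2) + m * n)%N.
Proof.
elim: n => [|n IH]; first by rewrite addn0 muln0 bin0n !addn0.
by rewrite addnS !binS !bin1 IH; lia.
Qed.

Lemma binD_expX p q :
  'C((p + q).+1, 2) = (p.+1 * q + ('C(p.+1, 2) + 'C(q, 2)))%N.
Proof. by rewrite -addSn binD addnC. Qed.

(** * Multi-indexed polynomials as tau functions *)

Section MultiIndexed.
Import numFieldNormedType.Exports.
Variable R : realType.
Implicit Types (c : params R) (A : index_pair).

Lemma wronskian_seeds c A n x : domain c x ->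
  wronskian ([seq muI c a | a <- A.1] ++ [seq muII c b | b <- A.2] ++
             [:: fun y => (base_poly c n).[y]]) x =
  (seed_slope c / (cpoly (seed_kap c)).[(seed_aff c).[x]]) ^+ 'C(size (columns A n), 2) *
  (\prod_(p <- columns A n) (seed_gauge c p.1 x / p.2`!%:R)) *
  (tau (seed_al c) (seed_b c) (seed_kap c) (columns A n)).[(seed_aff c).[x]].
Proof.
move=> dx; set y := (seed_aff c).[x]; set w := seed_slope c / _.
have -> : [seq muI c a | a <- A.1] ++ [seq muII c b | b <- A.2] ++
     [:: fun y => (base_poly c n).[y]] = [seq seed c p | p <- columns A n].
  by rewrite /columns !map_cat -!map_comp.
rewrite /wronskian size_map; set s := columns A n.
have CN0 x' : domain c x' -> (cpoly (seed_kap c)).[(seed_aff c).[x']] != 0.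
  move=> /seed_aff_pos [y0 z0].
  by rewrite /cpoly hornerM hornerX mulf_neq0 ?gt_eqF.
have -> : \matrix_(i < size s, j < size s) derive1n i (nth (fun=> 0) [seq seed c p | p <- s] j) x
   = \matrix_(i < size s, j < size s) (w ^+ i * (seed_gauge c (nth (St, 0%N) s j).1 x /
      (nth (St, 0%N) s j).2`!%:R *
      (\matrix_(i < size s, j < size s)
         (nth (fun=> 0) (cols (seed_al c) (seed_b c) (seed_kap c) s) j i).[y]) i j)).
  apply/matrixP => i j; rewrite !mxE (nth_map (St, 0%N)) // nth_cols //.
  set p := nth _ s j; rewrite seedE.
  have dG x' (dx' : domain c x') := seed_gauge_derive p.1 dx'.
  rewrite (derive1n_gauge _ (@domain_open _ c) (seed_aff_deriv c) CN0 dG i dx).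
  by rewrite -/y -/w col_scale hornerZ; ring.
rewrite det_scale; congr (_ * _ * _).
- by rewrite -expr_sum -bin2_sum big_mkord.
- by rewrite (big_nth (St, 0%N)) big_mkord.
rewrite /tau /cdet -[RHS]/(horner_eval y _) -det_map_mx; congr (\det _).
by apply/matrixP => i j; rewrite !mxE.
Qed.

Lemma kcount_columns A n :
  kcount TI (columns A n) = size A.1 /\ kcount TII (columns A n) = size A.2.
Proof.
rewrite /columns !kcount_cat /kcount !count_map /= addn0.
have e1 (k k' : kind) (t : seq nat) : (k == k') = true ->
    count (fun x => (k, x).1 == k') t = size t.
  by move=> e; rewrite (eq_count (a2 := predT)) ?count_predT // => x /=; rewrite e.
have e0 (k k' : kind) (t : seq nat) : (k == k') = false ->
    count (fun x => (k, x).1 == k') t = 0%N.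
  by move=> e; rewrite (eq_count (a2 := pred0)) ?count_pred0 // => x /=; rewrite e.
by rewrite (e1 TI) // (e0 TII) // (e0 TI) // (e1 TII) // !addn0.
Qed.

Lemma size_columns A n : size (columns A n) = (size A.1 + size A.2).+1.
Proof. by rewrite /columns !size_cat !size_map addn1 addnS. Qed.

Lemma expX_columns A n :
  expX (columns A n) = ('C((size A.1).+1, 2) + 'C(size A.2, 2))%N.
Proof.
have [_ e] := kcount_columns A n; rewrite /expX e size_columns.
by congr ('C(_, 2) + _)%N; lia.
Qed.

Lemma expZ_columns A n :
  expZ (columns A n) = ('C((size A.2).+1, 2) + 'C(size A.1, 2))%N.
Proof.
have [e _] := kcount_columns A n; rewrite /expZ e size_columns.
by congr ('C(_, 2) + _)%N; lia.
Qed.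

(** The real exponents cancel: with p and q entries of types I and II, q factors of exponent 1/2 - g
    against (p + g + 1/2) q leave (p + 1) q, and in case J the other endpoint is symmetric. *)
Lemma gauge_prefactor c A n x (y := (seed_aff c).[x]) (z := (zpoly (seed_kap c)).[y]) :
  domain c x ->
  (\prod_(p <- columns A n) seed_gauge c p.1 x) * prefactor c A x =
  y ^+ ((size A.1).+1 * size A.2) * z ^+ ((size A.2).+1 * size A.1).
Proof.
move=> dx; have [y0 z0] := seed_aff_pos dx.
rewrite -/y -/z in y0 z0.
have cst (t : seq nat) (g : R) : \prod_(i <- t) g = g ^+ size t.
  by elim: t => [|a t IH]; rewrite ?big_nil // big_cons IH exprS.
rewrite /columns !big_cat big_seq1 !big_map.
transitivity (seed_gauge c TI x ^+ size A.1 * seed_gauge c TII x ^+ size A.2 * prefactor c A x).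
  by congr (_ * _); rewrite -(cst A.1) -(cst A.2) -[RHS]mulr1 -[RHS]mulrA.
move: y0 z0; rewrite {}/z {}/y.
set p := size A.1; set q := size A.2.
have pos_powR_exp (u a : R) m : 0 < u -> (u `^ a) ^+ m = u `^ (a * m%:R).
  by move=> u0; rewrite -powR_mulrn ?powR_ge0 // -powRrM.
have jx : ((1 / 2)%:P * (1 - 'X)).[x] = (1 - x) / 2 :> R.
  by rewrite hornerM hornerD hornerN hornerX -polyC1 !hornerC; field.
have zE k' y : (zpoly k').[y] = 1 - k' * y :> R.
  by rewrite /zpoly hornerD hornerN hornerM hornerX -polyC1 !hornerC.
rewrite zE; case: c dx => [g|g h] dx y0 z0; rewrite /prefactor -/p -/q /=.
  rewrite hornerX in y0 z0 *; rewrite mul0r subr0 expr1n mulr1.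
  rewrite pos_powR_exp // [_ * expR _]mulrC mulrACA -powRD; last by rewrite (gt_eqF y0) implybT.
  transitivity ((expR x ^+ p * expR (- (p%:R * x))) *
     x `^ ((1 / 2 - g) * q%:R + (p%:R + g + 1 / 2) * q%:R)); first by ring.
  rewrite -expRM_natl -expRD subrr expR0 mul1r -powR_mulrn ?ltW //.
  by congr (_ `^ _); rewrite natrM -natr1; field.
rewrite jx in y0 z0 *.
have -> : 1 - 1 * ((1 - x) / 2) = (1 + x) / 2 by field.
have z0' : 0 < (1 + x) / 2 by move: dx => /andP[? _]; lra.
rewrite !pos_powR_exp // -!powR_mulrn ?ltW //.
rewrite [X in X * _]mulrC mulrACA -!powRD ?(gt_eqF y0) ?(gt_eqF z0') ?implybT //.
by congr (_ `^ _ * _ `^ _); rewrite natrM -natr1; field.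
Qed.

(** The Wronskian has the power 'C(N, 2) of [cpoly] in its denominator. The gauge factors with the
    prefactor, and the trivial factors of tau, together supply exactly this power, so [P] remains up
    to a constant. *)
Lemma mi_poly_tau c A n (P : {poly R}) :
  tau (seed_al c) (seed_b c) (seed_kap c) (columns A n) =
    'X^(expX (columns A n)) * zpoly (seed_kap c) ^+ (expZ (columns A n)) * P ->
  exists2 k : R, k != 0 & mi_poly c A n = k *: (P \Po seed_aff c).
Proof.
move=> tP; set N := size (columns A n).
pose k := seed_slope c ^+ 'C(N, 2) * \prod_(p <- columns A n) (p.2`!%:R)^-1.
have slope0 : seed_slope c != 0.
  case: (c) => [g|g h] /=; first exact: oner_neq0.
  by rewrite oppr_eq0; apply: lt0r_neq0; lra.
have k0 : k != 0.
  rewrite mulf_neq0 ?expf_neq0 // prodf_seq_neq0; apply/allP => p _ /=.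
  by rewrite invr_eq0 pnatr_eq0 -lt0n fact_gt0.
have miE x : domain c x -> mi_fun c A n x = (k *: (P \Po seed_aff c)).[x].
  move=> dx; have [y0 z0] := seed_aff_pos dx.
  rewrite /mi_fun wronskian_seeds // tP !hornerM !horner_exp hornerX -/N.
  rewrite big_split /= hornerZ horner_comp.
  have G := gauge_prefactor A n dx; move: G.
  rewrite ?hornerX; set y := (seed_aff c).[x] in y0 z0 *.
  set z := (zpoly _).[_] in z0 *.
  set g := \prod_(p <- _) seed_gauge _ _ _; set pf := prefactor _ _ _ => G.
  rewrite /k; set s := seed_slope c; set d := \prod_(p <- _) _.
  have ey : y ^+ 'C(N, 2) = y ^+ ((size A.1).+1 * size A.2) * y ^+ expX (columns A n).
    by rewrite -exprD /N size_columns expX_columns; congr (_ ^+ _); exact: binD_expX.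
  have ez : z ^+ 'C(N, 2) = z ^+ ((size A.2).+1 * size A.1) * z ^+ expZ (columns A n).
    by rewrite -exprD /N size_columns expZ_columns; congr (_ ^+ _); rewrite addnC; exact: binD_expX.
  transitivity (s ^+ 'C(N, 2) / ((y ^+ 'C(N, 2)) * (z ^+ 'C(N, 2))) * d * (g * pf) *
     (y ^+ expX (columns A n) * z ^+ expZ (columns A n)) * P.[y]).
    by rewrite expr_div_n exprMn; ring.
  rewrite G ey ez; move: (_ ^+ 'C(N, 2)) => w.
  by field; rewrite !expf_neq0 // gt_eqF.
exists k => //.
rewrite /mi_poly; set B := (X in xget _ X).
have : B (xget 0 B).
  by apply: xgetPex; exists (k *: (P \Po seed_aff c)) => x dx; rewrite miE.
set Q := xget _ _ => hQ; apply/eqP; rewrite -subr_eq0; apply/eqP.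
set Z := _ - _; apply/eqP/negPn/negP => Z0.
(* The points 1/(i + 2) lie in both domains; they are one too many for a nonzero [Z]. *)
pose pts := [seq (i.+2%:R : R)^-1 | i <- iota 0 (size Z)].
have dpt i : domain c (i.+2%:R^-1 : R).
  have i0 : 0 < (i.+2%:R : R)^-1 by rewrite invr_gt0 ltr0n.
  case: (c) => [g|g h] //=; apply/andP; split; first by apply: lt_trans i0; rewrite ltrN10.
  by rewrite invf_lt1 ?ltr0n // ltr1n.
have rZ : all (root Z) pts.
  apply/allP => _ /mapP[i _ ->]; apply/rootP.
  by rewrite /Z hornerD hornerN hQ // miE // subrr.
have uZ : uniq pts.
  by rewrite map_inj_uniq ?iota_uniq // => i j /invr_inj /eqP; rewrite eqr_nat => /eqP [].
have := max_poly_roots Z0 rZ uZ.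
by rewrite size_map size_iota ltnn.
Qed.
End MultiIndexed.

(** * Partners of a multi-index *)

Lemma excess_le_columns A n m :
  excess_le m (columns A n) =
  (sumn A.1 + sumn A.2 + n + size A.1 * size A.2 <=
   m + 'C(size A.1, 2) + 'C(size A.2, 2))%N.
Proof.
rewrite /excess_le expX_columns expZ_columns size_columns binD_expX.
rewrite /columns !big_cat /= !big_map big_seq1 /= -!sumnE.
rewrite !binS !bin1; lia.
Qed.

Lemma excess_le_ell A n : excess_le (ell A + n) (columns A n).
Proof. by rewrite excess_le_columns /ell -!bin2; lia. Qed.

(** A lower index sum makes the degree smaller than the number of zeros, as interpolation at the
    zeros requires. *)
Lemma excess_le_small A A' n n' :
  size A'.1 = size A.1 -> size A'.2 = size A.2 ->
  (sumn A'.1 + sumn A'.2 + n' < sumn A.1 + sumn A.2 + n)%N ->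
  excess_le (ell A + n).-1 (columns A' n').
Proof.
move=> s1 s2 lt; have := excess_le_ell A n; rewrite !excess_le_columns s1 s2.
rewrite /ell -!bin2; lia.
Qed.

(** Replacing v by -(v + 1) for type II gives both types the same formulas: with m the value,
    [energyX] is m^2 + (al + 1) m and [energyY] is m + al + 1. *)
Definition mval (x : kind * nat) : int :=
  match x.1 with TII => - (x.2%:Z + 1) | _ => x.2%:Z end.

(* [EP_code D D' x y]: the entries [x] and [y] exchanged or deleted in passing
   from [D] to [D']. *)
Inductive EP_code (D D' : index_pair) : kind * nat -> kind * nat -> Prop :=
| EP_codeI j e of (j < size D.1)%N & (e < nth 0%N D.1 j)%N &
    D' = (set_nth 0%N D.1 j e, D.2) : EP_code D D' (TI, nth 0%N D.1 j) (TI, e)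
| EP_codeII j e of (j < size D.2)%N & (e < nth 0%N D.2 j)%N &
    D' = (D.1, set_nth 0%N D.2 j e) : EP_code D D' (TII, nth 0%N D.2 j) (TII, e)
| EP_codeIII d d' of d \in D.1 & d' \in D.2 &
    D' = (rem d D.1, rem d' D.2) : EP_code D D' (TI, d) (TII, d').

Lemma set_nth_split (t : seq nat) j e : (j < size t)%N ->
  set_nth 0%N t j e = take j t ++ e :: drop j.+1 t.
Proof.
elim: t j => // a t IH [|j] /= h; first by rewrite drop0.
by rewrite IH.
Qed.

Lemma nth_split (t : seq nat) j : (j < size t)%N ->
  t = take j t ++ nth 0%N t j :: drop j.+1 t.
Proof. by move=> h; rewrite -drop_nth // cat_take_drop. Qed.

Lemma perm_cat_last (T : eqType) (s1 s2 : seq T) x :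
  perm_eq (s1 ++ x :: s2) ((s1 ++ s2) ++ [:: x]).
Proof. by rewrite -catA perm_cat2l -cat1s perm_catC. Qed.

Lemma EP_partner D D' n : EP D D' -> exists x y,
  [/\ partner (columns D n) (columns D' n) x y,
      (0 < n)%N -> excess_le (ell D + n).-1 (columns D' n) & EP_code D D' x y].
Proof.
case=> [j e jD eD eN|j e jD eD eN|d d' dD d'D].
- exists (TI, nth 0%N D.1 j), (TI, e); split; last exact: EP_codeI.
    pose s := [seq (TI, a) | a <- take j D.1] ++ [seq (TI, a) | a <- drop j.+1 D.1] ++
      [seq (TII, b) | b <- D.2] ++ [:: (St, n)].
    have cs a : [seq (TI, b) | b <- take j D.1 ++ a :: drop j.+1 D.1] ++
        [seq (TII, b) | b <- D.2] ++ [:: (St, n)] =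
      [seq (TI, b) | b <- take j D.1] ++ (TI, a) :: [seq (TI, b) | b <- drop j.+1 D.1] ++
        [seq (TII, b) | b <- D.2] ++ [:: (St, n)].
      by rewrite map_cat -catA.
    apply: (@PartnerReplace _ _ s) => //; first by rewrite /s !size_cat /= !addnS.
      by rewrite /columns {1}(nth_split jD) cs; apply: perm_cat_last.
    by rewrite /columns /= (set_nth_split _ jD) cs; apply: perm_cat_last.
  move=> n0; apply: excess_le_small => //=.
    by rewrite size_set_nth; apply/maxn_idPr.
  by rewrite (set_nth_split _ jD) {3}(nth_split jD) !sumn_cat /=; lia.
- exists (TII, nth 0%N D.2 j), (TII, e); split; last exact: EP_codeII.
    pose t := [seq (TI, a) | a <- D.1] ++ [seq (TII, b) | b <- take j D.2].
    pose s := t ++ [seq (TII, b) | b <- drop j.+1 D.2] ++ [:: (St, n)].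
    have cs a : [seq (TI, b) | b <- D.1] ++
        [seq (TII, b) | b <- take j D.2 ++ a :: drop j.+1 D.2] ++ [:: (St, n)] =
      t ++ (TII, a) :: [seq (TII, b) | b <- drop j.+1 D.2] ++ [:: (St, n)].
      by rewrite map_cat /t -!catA.
    apply: (@PartnerReplace _ _ s) => //; first by rewrite /s !size_cat /= !addnS.
      by rewrite /columns {1}(nth_split jD) cs; apply: perm_cat_last.
    by rewrite /columns /= (set_nth_split _ jD) cs; apply: perm_cat_last.
  move=> n0; apply: excess_le_small => //=.
    by rewrite size_set_nth; apply/maxn_idPr.
  by rewrite (set_nth_split _ jD) {3}(nth_split jD) !sumn_cat /=; lia.
exists (TI, d), (TII, d'); split; last exact: EP_codeIII.
  apply: (@PartnerRemove _ _ (columns (rem d D.1, rem d' D.2) n)) => //.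
    by rewrite size_columns.
  have p1 := perm_map (fun a => (TI, a)) (perm_to_rem dD).
  have p2 := perm_map (fun a => (TII, a)) (perm_to_rem d'D).
  rewrite /columns /=.
  apply: (perm_trans (perm_cat p1 (perm_cat p2 (perm_refl _)))) => /=.
  apply/seq.permP => a; rewrite /= !(count_cat, map_cons) /= !count_cat /=; lia.
move=> n0; have := excess_le_ell D n; rewrite !excess_le_columns /=.
have sd := perm_sumn (perm_to_rem dD); have sd' := perm_sumn (perm_to_rem d'D).
have zd := perm_size (perm_to_rem dD); have zd' := perm_size (perm_to_rem d'D).
rewrite /= in sd sd' zd zd'; rewrite /ell -!bin2 zd zd' sd sd' !binS !bin1.
lia.
Qed.

Lemma EP_code_inj D D' D'' x y x' y' : uniq D.1 -> uniq D.2 ->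
  EP_code D D' x y -> EP_code D D'' x' y' -> x = x' -> y = y' -> D' = D''.
Proof.
move=> u1 u2.
case=> {x y} [j e jD eD ->|j e jD eD ->|d d' dD d'D ->];
  case=> {x' y'} [j1 e1 jD1 eD1 ->|j1 e1 jD1 eD1 ->|d1 d1' dD1 d'D1 ->] //.
- by move=> [/eqP]; rewrite nth_uniq // => /eqP -> [->].
- by move=> [/eqP]; rewrite nth_uniq // => /eqP -> [->].
- by move=> [->] [->].
Qed.

(** Sum and sum of squares determine the unordered pair of values. Its order and the kinds follow:
    values are nonnegative exactly for type I, and an exchanged entry decreases. *)
Lemma EP_code_mval D D' D'' x y x' y' :
  EP_code D D' x y -> EP_code D D'' x' y' ->
  mval x + mval y = mval x' + mval y' ->
  mval x ^+ 2 + mval y ^+ 2 = mval x' ^+ 2 + mval y' ^+ 2 ->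
  x = x' /\ y = y'.
Proof.
move=> c1 c2 e1 e2.
have : (mval x - mval x') * (mval x - mval y') = 0.
  have -> : mval y' = mval x + mval y - mval x' by rewrite e1; ring.
  apply: (@mulfI _ 2) => //.
  have : mval x' ^+ 2 + (mval x + mval y - mval x') ^+ 2 = mval x ^+ 2 + mval y ^+ 2.
    by rewrite e2 e1; ring.
  move=> h; rewrite mulr0 -[RHS](subrr (mval x ^+ 2 + mval y ^+ 2)) -{2}h; ring.
move/eqP; rewrite mulf_eq0 !subr_eq0 => /orP[/eqP ex|/eqP ex].
  have ey : mval y = mval y' by apply: (addrI (mval x)); rewrite e1 ex.
  move: ex ey {e1 e2}; case: c1 => [j e _ ? _|j e _ ? _|d d' _ _ _];
    case: c2 => [j1 e' _ ? _|j1 e' _ ? _|d1 d1' _ _ _]; rewrite /mval /= => h1 h2;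
    try (exfalso; lia); split; congr pair; lia.
have ey : mval y = mval x' by apply: (addrI (mval x)); rewrite e1 ex addrC.
move: ex ey {e1 e2}; case: c1 => [j e _ ? _|j e _ ? _|d d' _ _ _];
  case: c2 => [j1 e' _ ? _|j1 e' _ ? _|d1 d1' _ _ _]; rewrite /mval /= => h1 h2;
  exfalso; lia.
Qed.

(** * Separation of the energies *)

Section Energies.
Variable R : realType.
Implicit Types al : R.

Lemma energyX_mval al x : x.1 != St ->
  energyX al x.1 x.2 = (mval x)%:~R ^+ 2 + (al + 1) * (mval x)%:~R.
Proof.
case: x => -[] //= v _; rewrite /mval /=.
  by rewrite -pmulrn; ring.
by rewrite rmorphN rmorphD /= -pmulrn; ring.
Qed.

Lemma energyY_mval al x : x.1 != St ->
  energyY al x.1 x.2 = (mval x)%:~R + al + 1.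
Proof.
case: x => -[] //= v _; rewrite /mval /=.
by rewrite rmorphN rmorphD /= -pmulrn; ring.
Qed.

Lemma EP_code_kind D D' x y : EP_code D D' x y -> x.1 != St /\ y.1 != St.
Proof. by case. Qed.

Lemma EP_energies_neq al D D' D'' x y x' y' : uniq D.1 -> uniq D.2 ->
  EP_code D D' x y -> EP_code D D'' x' y' -> D' <> D'' ->
  energyX al x.1 x.2 + energyX al y.1 y.2 = energyX al x'.1 x'.2 + energyX al y'.1 y'.2 ->
  energyY al x.1 x.2 + energyY al y.1 y.2 = energyY al x'.1 x'.2 + energyY al y'.1 y'.2 ->
  False.
Proof.
move=> u1 u2 c1 c2 ne; have [kx ky] := EP_code_kind c1; have [kx' ky'] := EP_code_kind c2.
rewrite !energyX_mval // !energyY_mval // => eX eY.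
have e1 : mval x + mval y = mval x' + mval y'.
  by apply: (@intr_inj R); rewrite !rmorphD /=; lra.
have e2 : mval x ^+ 2 + mval y ^+ 2 = mval x' ^+ 2 + mval y' ^+ 2.
  apply: (@intr_inj R); rewrite !rmorphD /= !rmorphXn /=.
  have e1' : (mval x)%:~R + (mval y)%:~R = (mval x')%:~R + (mval y')%:~R :> R.
    by rewrite -!rmorphD /= e1.
  apply: (addIr ((al + 1) * ((mval x)%:~R + (mval y)%:~R))).
  rewrite {2}e1'; move: eX.
  by move: (mval x)%:~R (mval y)%:~R (mval x')%:~R (mval y')%:~R => p q p' q' eX; lra.
have [ex ey] := EP_code_mval c1 c2 e1 e2.
exact: ne (EP_code_inj u1 u2 c1 c2 ex ey).
Qed.

(** A matter of sign: the left-hand side is at most 0, whereas the right-hand side is positive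
    because the type II entries stay below [al]. *)
Lemma EP_state_energies_neq al D D' x y m n : 0 < al -> {in D.2, forall d, d%:R < al} ->
  EP_code D D' x y ->
  energyY al St m + energyY al St n = energyY al x.1 x.2 + energyY al y.1 y.2 -> False.
Proof.
move=> al0 alD; have m0 : 0 <= m%:R :> R by []; have n0 : 0 <= n%:R :> R by [].
case=> {x y} [j e jD eD _|j e jD eD _|d d' dD d'D _] /= h.
- have h1 : 0 <= (nth 0%N D.1 j)%:R :> R by []; have h2 : 0 <= e%:R :> R by [].
  lra.
- have h1 := alD _ (mem_nth 0%N jD); have h2 : e%:R < (nth 0%N D.2 j)%:R :> R by rewrite ltr_nat.
  lra.
- have h1 := alD _ d'D; have h2 : 0 <= d%:R :> R by [].
  lra.
Qed.

Lemma state_energies_neq al N m n : m <> n ->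
  energyY al St N + energyY al St m = energyY al St N + energyY al St n -> False.
Proof. by move=> mn /addrI /oppr_inj /eqP; rewrite eqr_nat => /eqP. Qed.

Lemma state_partner A N m : (0 < size A.1 + size A.2)%N ->
  partner (columns A N) (columns A m) (St, N) (St, m).
Proof.
move=> s0; apply: (@PartnerReplace _ _ ([seq (TI, a) | a <- A.1] ++ [seq (TII, b) | b <- A.2])) => //.
- by rewrite size_cat !size_map.
- by rewrite /columns catA.
- by rewrite /columns catA.
Qed.
End Energies.

(** * Sums over the complex zeros *)

Section MultiIndexedZeros.
Variables (R : realType) (c : params R).

Local Notation phi := (real_complex R).
Local Notation al := (seed_al c).
Local Notation b := (seed_b c).
Local Notation kap := (seed_kap c).

Lemma mi_polyC_tau A n : exists P k,
  [/\ tau (phi al) (phi b) (phi kap) (columns A n) =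
        'X^(expX (columns A n)) * zpoly (phi kap) ^+ (expZ (columns A n)) * P,
      k != 0, mi_polyC c A n = k *: (P \Po map_poly phi (seed_aff c)) &
      size P = size (mi_poly c A n)].
Proof.
have [P hP _] := tau_factor al b kap (columns A n).
have [k k0 mk] := mi_poly_tau hP.
exists (map_poly phi P), (phi k); split.
- by rewrite -map_tau hP !rmorphM /= !rmorphXn /= map_polyX map_zpoly.
- by rewrite fmorph_eq0.
- by rewrite /mi_polyC mk map_polyZ /= map_comp_poly.
rewrite size_map_poly mk size_scale // size_comp_poly2 //.
case: (c) => [g|g h] /=; first exact: size_polyX.
rewrite mul_polyC size_scale ?mulf_neq0 ?oner_eq0 ?invr_eq0 ?pnatr_eq0 //.
by rewrite -size_polyN opprB size_XsubC.
Qed.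

Lemma partner_sum (n : nat) (eta : 'I_n -> R[i]) (D D' D'' : index_pair)
    (N N' N'' : nat) x y x' y' :
  0 < b -> size (mi_poly c D N) = n.+1 ->
  (forall l, root (mi_polyC c D N) (eta l)) -> injective eta ->
  (forall l, ~~ singular c (eta l)) ->
  partner (columns D N) (columns D' N') x y ->
  partner (columns D N) (columns D'' N'') x' y' ->
  excess_le n (columns D N) -> excess_le n.-1 (columns D' N') ->
  excess_le n.-1 (columns D'' N'') ->
  (energyX al x.1 x.2 + energyX al y.1 y.2 = energyX al x'.1 x'.2 + energyX al y'.1 y'.2 ->
   energyY al x.1 x.2 + energyY al y.1 y.2 = energyY al x'.1 x'.2 + energyY al y'.1 y'.2 ->
   False) ->
  \sum_(l < n) (mi_polyC c D' N').[eta l] * (mi_polyC c D'' N'').[eta l] /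
    (etadot2 c (eta l) * (deriv (mi_polyC c D N)).[eta l] ^+ 2) = 0.
Proof.
move=> b0 sP rP ieta hs pp pp' ex ex' ex'' gen.
have [P [k [tP k0 mP zP]]] := mi_polyC_tau D N.
have [Q [k' [tQ _ mQ _]]] := mi_polyC_tau D' N'.
have [Q' [k'' [tQ' _ mQ' _]]] := mi_polyC_tau D'' N''.
pose aff := map_poly phi (seed_aff c).
pose ye l := aff.[eta l].
pose sl := phi (seed_slope c).
have sl0 : sl != 0.
  rewrite fmorph_eq0; case: (c) => [g|g h] /=; first exact: oner_neq0.
  by rewrite oppr_eq0 mulf_neq0 ?oner_eq0 ?invr_eq0 ?pnatr_eq0.
have affD : aff^`() = sl%:P by rewrite /aff deriv_map seed_aff_deriv map_polyC.
have affE u v : aff.[u] - aff.[v] = sl * (u - v).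
  rewrite /aff /sl; case: (c) => [g|g h] /=.
    by rewrite map_polyX !hornerX rmorph1 mul1r.
  rewrite rmorphM rmorphB rmorph1 /= map_polyC map_polyX /= rmorphN.
  rewrite !hornerM !hornerD !hornerN !hornerX -polyC1 !hornerC; ring.
have iye : injective ye.
  move=> l m; rewrite /ye => /eqP; rewrite -subr_eq0 affE mulf_eq0 (negbTE sl0) /=.
  by rewrite subr_eq0 => /eqP /ieta.
have rye l : root P (ye l).
  have := rP l; rewrite mP rootZ // => /rootP; rewrite horner_comp => h.
  exact/rootP.
have [kd [kd0 kdE]] : exists kd : R[i], kd != 0 /\
    forall l, etadot2 c (eta l) = kd * (cpoly (phi kap)).[ye l].
  have cE (k0' u : R[i]) : (cpoly k0').[u] = u * (1 - k0' * u).
    by rewrite /cpoly /zpoly hornerM hornerX hornerD hornerN hornerM hornerX -polyC1 !hornerC.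
  rewrite /ye /aff /etadot2; case: (c) => [g|g h] /=.
    exists 4; split => [|l]; first by rewrite pnatr_eq0.
    by rewrite cE map_polyX hornerX rmorph0; ring.
  (* With y = (1 - eta)/2, 4 (1 - eta^2) = 16 y (1 - y). *)
  exists 16; split => [|l]; first by rewrite pnatr_eq0.
  rewrite cE rmorph1 rmorphM rmorphB rmorph1 /= map_polyC map_polyX /= rmorphM rmorph1.
  rewrite fmorphV rmorph_nat hornerM hornerD hornerN hornerX -polyC1 !hornerC.
  by field.
have cne l : (cpoly (phi kap)).[ye l] != 0.
  apply/eqP => h; have := kdE l; rewrite h mulr0; have := hs l.
  rewrite /singular /etadot2; case: (c) => [g|g h'].
    by move=> h1 /eqP; rewrite mulf_eq0 (negbTE h1) pnatr_eq0.
  rewrite negb_or => /andP[h1 h2] /eqP; rewrite mulf_eq0 pnatr_eq0 /=.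
  rewrite subr_eq0 eq_sym sqrf_eq1 (negbTE h1) /= => h3.
  by rewrite h3 in h2.
have eX w : energyX (phi al) w.1 w.2 = phi (energyX al w.1 w.2).
  case: w => -[] v;
    rewrite /energyX /= !(rmorphN phi, rmorphM phi, rmorphD phi, rmorph_nat phi, rmorph1 phi) //.
have eY w : energyY (phi al) w.1 w.2 = phi (energyY al w.1 w.2).
  by case: w => -[] v; rewrite /energyY /= !(rmorphN phi, rmorphD phi, rmorph_nat phi, rmorph1 phi).
have gen' : energyX (phi al) x.1 x.2 + energyX (phi al) y.1 y.2 =
     energyX (phi al) x'.1 x'.2 + energyX (phi al) y'.1 y'.2 ->
   energyY (phi al) x.1 x.2 + energyY (phi al) y.1 y.2 =
     energyY (phi al) x'.1 x'.2 + energyY (phi al) y'.1 y'.2 -> False.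
  rewrite !eX !eY -!rmorphD /= => /fmorph_inj h1 /fmorph_inj h2.
  exact: gen h1 h2.
have two : (2 : R[i]) != 0 by rewrite pnatr_eq0.
have b0' : phi b != 0 by rewrite fmorph_eq0 gt_eqF.
have sP' : size P = n.+1 by rewrite zP.
have := partner_orthogonality two b0' pp pp' ex ex' ex'' tP tQ tQ' sP' iye rye cne gen'.
move=> H.
transitivity (k' * k'' / (kd * (k * sl) ^+ 2) *
   (\sum_l Q.[ye l] * Q'.[ye l] / ((cpoly (phi kap)).[ye l] * P^`().[ye l] ^+ 2))); last first.
  by rewrite H mulr0.
rewrite mulr_sumr; apply: eq_bigr => l _.
have dP : (mi_polyC c D N)^`().[eta l] = k * (P^`().[ye l] * sl).
  rewrite mP derivZ deriv_comp affD hornerZ mulrC [_ * sl%:P]mulrC mul_polyC hornerZ.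
  by rewrite horner_comp mulrC (mulrC sl).
rewrite dP mQ mQ' kdE !hornerZ !horner_comp -/aff -/(ye l).
rewrite !exprMn !invfM; ring.
Qed.
End MultiIndexedZeros.

Theorem theorem3p1 (R : realType) (c : params R) (D : index_pair) (N : nat)
    (eta : 'I_(ell D + N) -> R[i])
    (hD : multi_index D) (hc : admissible c D) (hN : (1 <= N)%N)
    (hdeg : size (mi_poly c D N) = (ell D + N).+1)
    (hzeros : forall z : R[i],
        root (mi_polyC c D N) z <-> exists l, eta l = z)
    (hdistinct : injective eta)
    (hsing : forall l, ~~ singular c (eta l)) :
  let S (P Q : {poly R[i]}) : R[i] :=
    \sum_(l < ell D + N)
      P.[eta l] * Q.[eta l] /
        (etadot2 c (eta l) * (deriv (mi_polyC c D N)).[eta l] ^+ 2) in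
  [/\ forall m n : nat, (m < N)%N -> (n < N)%N -> m <> n ->
        S (mi_polyC c D n) (mi_polyC c D m) = 0,
      forall (m : nat) (D' : index_pair), (m < N)%N -> EP D D' ->
        S (mi_polyC c D m) (mi_polyC c D' N) = 0
    & forall D' D'' : index_pair, EP D D' -> EP D D'' -> D' <> D'' ->
        S (mi_polyC c D' N) (mi_polyC c D'' N) = 0].
Proof.
move=> S.
have /and5P[/(sorted_uniq ltn_trans ltnn) u1 /(sorted_uniq ltn_trans ltnn) u2 _ _ sD] := hD.
have rP l : root (mi_polyC c D N) (eta l) by apply/hzeros; exists l.
have b0 : 0 < seed_b c.
  case: (c) hc => [g|g h] /= => [_|[_ _ hh _]]; first exact: ltr01.
  have : 0 <= (size D.1)%:R :> R by [].
  by lra.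
have al0 : 0 < seed_al c.
  have : 0 <= (size D.2)%:R :> R by [].
  by case: (c) hc => [g|g h] /= => [[hh _]|[hh _ _ _]]; lra.
have alD : {in D.2, forall d, d%:R < seed_al c}.
  by move=> d dD; case: (c) hc => [g|g h] /= => [[_ /(_ d dD)]|[_ /(_ d dD) + _ _]]; lra.
have ps := partner_sum b0 hdeg rP hdistinct hsing.
have eN := excess_le_ell D N.
have eS m : (m < N)%N -> excess_le (ell D + N).-1 (columns D m).
  by move=> mN; apply: excess_le_small => //; rewrite ltn_add2l.
split=> [m n mN nN mn|m D' mN ED|D' D'' ED ED' ne].
(* The lower eigenstates are partners too: the entry [(St, N)] is exchanged for [(St, n)] or
   [(St, m)]. *)
- apply: (ps _ _ _ _ _ _ _ _ (state_partner N n sD) (state_partner N m sD) eN (eS _ nN) (eS _ mN)).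
  by move=> _; apply: state_energies_neq => /esym.
- have [x [y [p e cd]]] := EP_partner N ED.
  apply: (ps _ _ _ _ _ _ _ _ (state_partner N m sD) p eN (eS _ mN) (e hN)).
  by move=> _; apply: EP_state_energies_neq al0 alD cd.
have [x [y [p e cd]]] := EP_partner N ED; have [x' [y' [p' e' cd']]] := EP_partner N ED'.
apply: (ps _ _ _ _ _ _ _ _ p p' eN (e hN) (e' hN)).
exact: EP_energies_neq u1 u2 cd cd' ne.
Qed.
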